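(* Let $N\in\mathbb{N}$, $p\in[1,\infty)$ and $\mathbb X,\mathbb Y\in\mathcal{FP}_p$. Then $\mathbb X\sim_\infty\mathbb Y$ (i.e. $\mathbb X$ and $\mathbb Y$ are equivalent in adapted distribution) if and only if $\mathcal{AW}_p(\mathbb X,\mathbb Y)=0$.
   Context: A filtered process is a tuple $\mathbb{X}=(\Omega^{\mathbb X},\mathcal{F}^{\mathbb X},\mathbb{P}^{\mathbb X},(\mathcal{F}^{\mathbb X}_t)_{t=1}^N,(X_t)_{t=1}^N)$ consisting of a probability space, a filtration on it, and a real-valued process $X=(X_t)_{t=1}^N$ adapted to the filtration. $\mathcal{FP}_p$ is the class of all filtered processes with $\mathbb{E}[\|X\|_p^p]=\mathbb{E}[\sum_{t=1}^N|X_t|^p]<\infty$. A coupling of $\mathbb X,\mathbb Y$ is a probability $\pi$ on $(\Omega^{\mathbb X}\times\Omega^{\mathbb Y},\mathcal{F}^{\mathbb X}\otimes\mathcal{F}^{\mathbb Y})$ with marginals $\mathbb{P}^{\mathbb X},\mathbb{P}^{\mathbb Y}$. Identify $\mathcal{F}^{\mathbb X}_t$ and $\mathcal{F}^{\mathbb Y}_t$ with the corresponding $\sigma$-algebras on the product space. $\pi$ is causal from $\mathbb X$ to $\mathbb Y$ if, for every $1\le t\le N$, under $\pi$ the $\sigma$-algebras $\mathcal{F}^{\mathbb X}_N$ and $\mathcal{F}^{\mathbb Y}_t$ are conditionally independent given $\mathcal{F}^{\mathbb X}_t$; it is anticausal if the same holds with the roles of $\mathbb X$ and $\mathbb Y$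 exchanged; it is bicausal if it is both. $\mathrm{Cpl}_{\mathrm{bc}}(\mathbb X,\mathbb Y)$ denotes the set of bicausal couplings and $\mathcal{AW}_p^p(\mathbb X,\mathbb Y):=\inf_{\pi\in\mathrm{Cpl}_{\mathrm{bc}}(\mathbb X,\mathbb Y)}\mathbb{E}_\pi[\|X-Y\|_p^p]$. Adapted functions: the set $\mathrm{AF}$ consists of all (formal) operations $f$, assigning to each filtered process $\mathbb X$ a random variable $f(\mathbb X)$ on $\Omega^{\mathbb X}$, which can be built by finitely many applications of: (AF1) if $\Phi:\mathbb{R}^N\to\mathbb{R}$ is continuous and bounded, then $\Phi\in\mathrm{AF}$ with $\Phi(\mathbb X):=\Phi(X)$; (AF2) if $m\in\mathbb N$, $f_1,\dots,f_m\in\mathrm{AF}$ and $\varphi\in C_b(\mathbb{R}^m)$, then $\varphi(f_1,\dots,f_m)\in\mathrm{AF}$ with $\varphi(f_1,\dots,f_m)(\mathbb X):=\varphi(f_1(\mathbb X),\dots,f_m(\mathbb X))$; (AF3) if $1\le t\le N$ and $g\in\mathrm{AF}$, then $(g|t)\in\mathrm{AF}$ with $(g|t)(\mathbb X):=\mathbb{E}[g(\mathbb X)|\mathcal{F}^{\mathbb X}_t]$. One writes $\mathbb X\sim_\infty\mathbb Y$ if $\mathbb{E}[f(\mathbb X)]=\mathbb{E}[f(\mathbb Y)]$ for every $f\in\mathrm{AF}$. *)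

(* Defs.v *)
From HB Require Import structures.
From mathcomp Require Import all_boot all_order all_algebra.
From mathcomp Require Import all_classical all_reals all_analysis.
From mathcomp Require Import measurable_realfun.

Set Implicit Arguments.
Unset Strict Implicit.
Unset Printing Implicit Defensive.

Import Order.TTheory GRing.Theory Num.Theory.
Import numFieldNormedType.Exports.

Local Open Scope classical_set_scope.
Local Open Scope ring_scope.

Definition measurable_wrt (T : Type) (R : realType) (G : set (set T))
    (W : T -> R) : Prop :=
  forall B : set R, measurable B -> G (W @^-1` B).

Section cond_exp.
Context (d : measure_display) (T : measurableType d) (R : realType).
Variables (P : probability T R) (G : set (set T)).

(* W is a version of E[Z | G]. *)
Definition is_cond_exp (Z W : T -> R) : Prop :=
  [/\ measurable_wrt G W,
      P.-integrable setT (EFin \o W) &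
      forall A, G A ->
        (\int[P]_(w in A) (W w)%:E = \int[P]_(w in A) (Z w)%:E)%E].

(* An arbitrarily chosen version of E[Z | G]. The default value 0 is never
   used when Z is integrable and G is a sub-sigma-algebra: see [cond_expP]. *)
Definition cond_exp (Z : T -> R) : T -> R :=
  xget (cst 0) [set W | is_cond_exp Z W].

Local Open Scope ereal_scope.
Local Open Scope charge_scope.

Lemma cond_expP (Z : T -> R) :
  sigma_algebra setT G -> G `<=` measurable ->
  P.-integrable setT (EFin \o Z) -> is_cond_exp Z (cond_exp Z).
Proof.
move=> Gsig Gsub intZ; rewrite /cond_exp; case: xgetP => // noW; exfalso.
have mZ (A : set T) : measurable_fun A (EFin \o Z).
  exact/measurable_funTS/(measurable_int _ intZ).
pose GT : measurableType _ := g_sigma_algebraType G.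
have mG (A : set GT) : measurable A -> G A.
  by rewrite /measurable/= sigma_algebra_id.
have Gm (A : set T) : G A -> measurable (A : set GT).
  by move=> GA; exact: sub_sigma_algebra.
pose j : T -> GT := idfun.
have mj : measurable_fun setT j.
  by move=> _ B mB; rewrite setTI; exact/Gsub/mG.
pose jm : {mfun T >-> GT} := MeasurableFun.Pack
  (MeasurableFun.Class (isMeasurableFun.Build _ _ _ _ _ mj)).
pose mu : probability GT R := distribution P jm.
pose nu' :=
  [the charge _ _ of @pushforward _ _ T GT R (induced_charge intZ) j].
pose nu : {charge set GT -> \bar R} := nu' mj.
have nuE A : nu A = \int[P]_(w in A) (Z w)%:E by [].
have numu : nu `<< mu.
  apply/null_content_dominatesP => A /mG/Gsub mA PA0.
  by rewrite nuE; apply: (@null_set_integral d T).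
have ffin x := @Radon_Nikodym_fin_num _ _ _ nu mu x numu.
have intf := Radon_Nikodym_integrable numu.
have fE A := @Radon_Nikodym_integral _ _ _ nu mu A numu.
move: ('d nu '/d mu) ffin intf fE => f ffin intf fE.
have fK : EFin \o (fine \o f) = f by apply/funext => x /=; rewrite fineK.
have mf : measurable_fun setT f := measurable_int _ intf.
have intPf : P.-integrable setT f.
  apply/integrableP; split.
    by have := measurableT_comp mf mj.
  have /integrableP[_] := intf.
  by rewrite ge0_integral_pushforward//; apply: measurableT_comp.
apply: (noW (fine \o f)); split.
- move=> B mB; apply: mG; rewrite -[X in measurable X]setTI.
  by apply: measurableT_comp => //; exact: measurable_fine.
- by rewrite fK.
- move=> A GA; rewrite -nuE fE; last exact: Gm.
  rewrite integral_pushforward//=; last exact: Gm.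
    by apply: eq_integral => x _; rewrite fineK.
  by apply: integrableS intPf => //; exact: Gsub.
Qed.

End cond_exp.

Definition cond_indep (d : measure_display) (T : measurableType d)
    (R : realType) (P : probability T R) (G H K : set (set T)) : Prop :=
  forall A B : set T, G A -> H B ->
    {ae P, forall w, cond_exp P K (\1_(A `&` B)) w =
                     cond_exp P K (\1_A) w * cond_exp P K (\1_B) w}.

(* A filtered process with N.+1 >= 1 time steps, indexed by 'I_N.+1: the index
   t stands for time t.+1, and ord_max for the terminal time. *)
Record filtered_process (R : realType) (N : nat) := FilteredProcess {
  fp_display : measure_display;
  fp_space : measurableType fp_display;
  fp_prob : probability fp_space R;
  fp_filt : 'I_N.+1 -> set (set fp_space);
  fp_filt_sigma : forall t, sigma_algebra setT (fp_filt t);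
  fp_filt_sub : forall t, fp_filt t `<=` measurable;
  fp_filt_mono : forall s t : 'I_N.+1, (s <= t)%N -> fp_filt s `<=` fp_filt t;
  fp_proc : 'I_N.+1 -> fp_space -> R;
  fp_adapted : forall t, measurable_wrt (fp_filt t) (fp_proc t)
}.

Arguments fp_filt {R N} _ _ _.
Arguments fp_proc {R N} _ _ _.

Definition in_FP (R : realType) (N : nat) (p : R)
    (X : filtered_process R N) : Prop :=
  ('E_(fp_prob X)[fun w => (\sum_(t < N.+1) `|fp_proc X t w| `^ p)%R] < +oo)%E.

Section adapted_functions.
Context (R : realType) (N : nat).

Inductive AF : Type :=
| AF1 (Phi : 'rV[R]_N.+1 -> R) of continuous Phi & bounded_fun Phi
| AF2 (m : nat) (phi : 'rV[R]_m.+1 -> R) of continuous phi & bounded_fun phi &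
    ('I_m.+1 -> AF)
| AF3 (t : 'I_N.+1) of AF.

Section evaluation.
Variable X : filtered_process R N.

Fixpoint AF_eval (f : AF) : fp_space X -> R :=
  match f with
  | AF1 Phi _ _ => fun w => Phi (\row_t fp_proc X t w)
  | AF2 m phi _ _ fs => fun w => phi (\row_i AF_eval (fs i) w)
  | AF3 t g => cond_exp (fp_prob X) (fp_filt X t) (AF_eval g)
  end.

End evaluation.

Arguments AF_eval : clear implicits.

Definition adapted_equiv (X Y : filtered_process R N) : Prop :=
  forall f : AF,
    ('E_(fp_prob X)[AF_eval X f] = 'E_(fp_prob Y)[AF_eval Y f])%E.

End adapted_functions.

Arguments AF_eval {R N} X f _.

Section adapted_wasserstein.
Context (R : realType) (N : nat).
Variables X Y : filtered_process R N.

Local Notation XY := (fp_space X * fp_space Y)%type.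

Definition coupling (pi : probability XY R) : Prop :=
  (forall A : set (fp_space X), measurable A ->
     pi (fst @^-1` A) = fp_prob X A) /\
  (forall B : set (fp_space Y), measurable B ->
     pi (snd @^-1` B) = fp_prob Y B).

(* The sigma-algebras of X and Y at time t, as sigma-algebras on the product. *)
Definition filtX (t : 'I_N.+1) : set (set XY) :=
  preimage_set_system setT fst (fp_filt X t).

Definition filtY (t : 'I_N.+1) : set (set XY) :=
  preimage_set_system setT snd (fp_filt Y t).

Definition causal (pi : probability XY R) : Prop :=
  forall t, cond_indep pi (filtX ord_max) (filtY t) (filtX t).

Definition anticausal (pi : probability XY R) : Prop :=
  forall t, cond_indep pi (filtY ord_max) (filtX t) (filtY t).

Definition Cpl_bc : set (probability XY R) :=
  [set pi | [/\ coupling pi, causal pi & anticausal pi]].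

Definition AW_pow (p : R) : \bar R :=
  ereal_inf [set ('E_pi[fun w =>
     (\sum_(t < N.+1) `|fp_proc X t w.1 - fp_proc Y t w.2| `^ p)%R])%E
   | pi in Cpl_bc].

Definition AW (p : R) : \bar R := (AW_pow p `^ p^-1)%E.

End adapted_wasserstein.

(* Main.v *)
(* Both implications avoid disintegration, since the underlying probability
   spaces are arbitrary and an optimal coupling need not exist.

   If AW = 0, one shows by induction on the adapted function f that
   E_pi |f(X) - f(Y)|^2 is small for every bicausal pi with small cost. The
   only delicate case is (g|t): causality and anticausality make the difference
   of the two conditional expectations orthogonal to the error committed by
   replacing g(X) - g(Y) by it, so passing to conditional expectations
   contracts in L^2(pi).

   Conversely, each process is given random labels, backwards in time: the
   probability of a label at time t is a product of small tent functions of the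
   (clamped) value X_t and of the conditional probabilities given F_t of the
   labels at time t+1. These probabilities are adapted functions. Given the
   past, the labels of X and Y are coupled by the maximal coupling of their
   conditional laws; this defines a density with respect to the product measure
   whose factor at time t integrates to 1 in each variable given the past, which
   is exactly bicausality. Equal labels at time t force the conditional laws of
   the next labels to be close, and at the first time the laws of the labels
   coincide because X and Y are equivalent. Hence labels agree at all times with
   probability close to 1, so X and Y are close in probability, and uniform
   integrability turns this into a small transport cost. *)
Require Import Defs.
From HB Require Import structures.
From mathcomp Require Import all_boot all_order all_algebra.
From mathcomp Require Import all_classical all_reals all_analysis.
From mathcomp Require Import measurable_realfun.
From mathcomp Require Import ring lra.

Set Implicit Arguments.
Unset Strict Implicit.
Unset Printing Implicit Defensive.

Import Order.TTheory GRing.Theory Num.Theory.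
Import numFieldNormedType.Exports.

Local Open Scope classical_set_scope.
Local Open Scope ring_scope.

(** * Integrals tested against a sub-sigma-algebra *)

(** Adapted functions are built from continuous operations, so a label cannot be the cell of a
    finite partition; a random label with continuous probabilities takes its place. This randomness
    is also what lets two unrelated spaces be coupled: the label laws are finite vectors, so their
    maximal coupling is a plain function of the two points, hence a density, and Tonelli's theorem
    replaces the composition of kernels. The backward order is forced by a count. The maximal
    coupling at time s+1 fails with probability at most the number of labels times the distance of
    the two conditional laws, so the mesh at time s can be fixed only once the number of labels at
    time s+1 is known. A recurrent obstacle is that conditional expectations are arbitrary versions,
    bounded or positive only almost surely. In the L2 arguments they are clamped; in the
    construction they are retracted continuously onto the probability vectors, so that the density,
    its marginals and the closeness of labels are treated pointwise, without exceptional sets on the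
    product. *)

Section sub_sigma_algebra.
Context (d : measure_display) (T : measurableType d) (R : realType).
Variables (G : set (set T)) (Gsig : sigma_algebra setT G).

(** Viewing [G] as a measurable type of its own makes the closure properties of measurable functions
    available for [measurable_wrt]. *)
Lemma measurable_wrtP (W : T -> R) :
  measurable_wrt G W <-> measurable_fun [set: g_sigma_algebraType G] W.
Proof.
split=> [mW _ B mB|mW B mB].
  by rewrite setTI; apply: sub_sigma_algebra; exact: mW.
by have := mW measurableT B mB; rewrite setTI /measurable/= sigma_algebra_id.
Qed.

Lemma measurable_wrt_set (A : set T) :
  G A <-> measurable (A : set (g_sigma_algebraType G)).
Proof.
by split=> [|]; rewrite /measurable/= sigma_algebra_id.
Qed.

Lemma measurable_wrtW (W : T -> R) :
  G `<=` measurable -> measurable_wrt G W -> measurable_fun setT W.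
Proof. by move=> Gm mW _ B mB; rewrite setTI; exact/Gm/mW. Qed.

Import HBNNSimple.
Local Open Scope ereal_scope.

(** The simple functions increasing to [h] are built over the type generated by [G], so their level
    sets lie in [G] and the hypothesis applies to each of them; monotone convergence concludes
    without any integrability. *)
Lemma ge0_integral_testing (P : probability T R) (U V h : T -> R) :
  G `<=` measurable ->
  measurable_fun setT U -> measurable_fun setT V ->
  (forall x, 0 <= U x)%R -> (forall x, 0 <= V x)%R ->
  (forall A, G A -> \int[P]_(x in A) (U x)%:E = \int[P]_(x in A) (V x)%:E) ->
  measurable_wrt G h -> (forall x, 0 <= h x)%R ->
  \int[P]_x (h x * U x)%:E = \int[P]_x (h x * V x)%:E.
Proof.
move=> Gm mU mV U0 V0 UV mh h0.
have mh' : measurable_fun [set: g_sigma_algebraType G] (EFin \o h).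
  by apply/measurable_EFinP/measurable_wrtP.
pose g := nnsfun_approx measurableT mh'.
have mg n : measurable_fun [set: T] (g n : T -> R).
  apply: (measurable_wrtW Gm); apply/measurable_wrtP.
  exact/measurable_funP.
have lemW (W : T -> R) : measurable_fun setT W -> (forall x, 0 <= W x)%R ->
    \int[P]_x (h x * W x)%:E = lim (\int[P]_x (g n x * W x)%:E @[n --> \oo]).
  move=> mW W0.
  rewrite -monotone_convergence//.
  - apply: eq_integral => x _; apply/esym/cvg_lim => //.
    under eq_fun do rewrite EFinM.
    rewrite EFinM; apply: cvgeZr => //.
    by apply: (@cvg_nnsfun_approx _ _ _ _ measurableT _ mh') => // y _; rewrite lee_fin.
  - by move=> n; apply/measurable_EFinP/measurable_funM.
  - by move=> n x _; rewrite lee_fin mulr_ge0.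
  - move=> x _ a b ab; rewrite lee_fin ler_wpM2r//.
    by have /lefP := nd_nnsfun_approx measurableT mh' ab; apply.
rewrite (lemW U)// (lemW V)//.
suff suf n : \int[P]_x (g n x * U x)%:E = \int[P]_x (g n x * V x)%:E.
  by under eq_fun do rewrite suf.
have fing : finite_set (range (g n : T -> R)) by exact: (@fimfunP _ _ (g n)).
have simW (W : T -> R) : measurable_fun setT W -> (forall x, 0 <= W x)%R ->
    \int[P]_x (g n x * W x)%:E =
    \sum_(y \in range (g n : T -> R)) y%:E * \int[P]_(x in g n @^-1` [set y]) (W x)%:E.
  move=> mW W0.
  have mgy y : measurable ((g n : T -> R) @^-1` [set y]).
    by rewrite -[X in measurable X]setTI; exact: mg.
  transitivity (\int[P]_x \sum_(y \in range (g n : T -> R))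
      (y * \1_(g n @^-1` [set y]) x * W x)%:E).
    apply: eq_integral => x _; rewrite fsumEFin// -mulr_fsuml.
    by congr (_ * _)%:E; exact: (fimfunE (g n) x).
  rewrite ge0_integral_fsum//; last 2 first.
  - by move=> y; apply/measurable_EFinP/measurable_funM => //; exact: measurable_funM.
  - move=> y x _; rewrite lee_fin mulr_ge0//; exact: nnfun_muleindic_ge0.
  apply: eq_fsbigr => y; rewrite inE => -[t _ gty].
  transitivity (\int[P]_x (y%:E * ((\1_(g n @^-1` [set y]) x)%:E * (W x)%:E))).
    by apply: eq_integral => x _; rewrite -!EFinM mulrA.
  rewrite ge0_integralZl//.
  - congr (_ * _); rewrite [RHS]integral_mkcond; apply: eq_integral => x _.
    by rewrite patchE indicE; case: ifPn => xy; rewrite ?mul1e ?mul0e.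
  - apply: emeasurable_funM; last exact/measurable_EFinP.
    by apply/measurable_EFinP/measurable_indic.
  - by move=> x _; rewrite mule_ge0// lee_fin.
  - by rewrite lee_fin -gty.
rewrite !simW//; apply: eq_fsbigr => y _; congr (_ * _); apply: UV.
apply/measurable_wrt_set.
by rewrite -[X in measurable X]setTI; exact/measurable_funP.
Qed.

End sub_sigma_algebra.

Section bounded_integrands.
Context (d : measure_display) (T : measurableType d) (R : realType).
Variable P : probability T R.
Implicit Types f g h U V W Z : T -> R.

Lemma bounded_onP f (M : R) (A : set T) :
  (forall x, `|f x| <= M) -> [bounded f x | x in A].
Proof.
move=> fM; exists M; split; first exact: num_real.
by move=> y My x _ /=; exact: le_trans (fM x) (ltW My).
Qed.

Lemma integrable_le_cst f (M : R) (A : set T) : measurable A ->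
  measurable_fun setT f -> (forall x, `|f x| <= M) ->
  P.-integrable A (EFin \o f).
Proof.
move=> mA mf fM; apply: measurable_bounded_integrable => //.
- by rewrite (le_lt_trans (probability_le1 P mA))// ltry.
- exact: measurable_funTS.
- exact: bounded_onP fM.
Qed.

Lemma integrable_mul_le_cst h f (M : R) (A : set T) : measurable A ->
  measurable_fun setT h -> (forall x, `|h x| <= M) ->
  P.-integrable A (EFin \o f) ->
  P.-integrable A (EFin \o (fun x => h x * f x)).
Proof.
move=> mA mh hM intf.
rewrite (_ : EFin \o _ = ((EFin \o h) \* (EFin \o f))%E)//.
apply: integrableMr => //; [exact: measurable_funTS|exact: bounded_onP hM].
Qed.

Lemma integrable_real_measurable f :
  P.-integrable setT (EFin \o f) -> measurable_fun setT f.
Proof. by move=> /measurable_int /measurable_EFinP. Qed.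

Lemma ae_eq_Rintegral f g (A : set T) : measurable A ->
  measurable_fun setT f -> measurable_fun setT g ->
  {ae P, forall x, f x = g x} ->
  \int[P]_(x in A) f x = \int[P]_(x in A) g x.
Proof.
move=> mA mf mg fg; congr fine; apply: ae_eq_integral => //.
- exact/measurable_EFinP/measurable_funTS.
- exact/measurable_EFinP/measurable_funTS.
- by apply: filterS fg => x -> _.
Qed.

Lemma integrable_ae_eq f g : measurable_fun setT g ->
  {ae P, forall x, f x = g x} ->
  P.-integrable setT (EFin \o f) -> P.-integrable setT (EFin \o g).
Proof.
move=> mg fg intf; apply/integrableP; split; first exact/measurable_EFinP.
have /integrableP[mf] := intf; congr (_ < _)%E; apply: ae_eq_integral => //.
- exact/measurableT_comp.
- exact/measurableT_comp/measurable_EFinP.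
- by apply: filterS fg => x /= -> _.
Qed.

Lemma Rintegral_indicr (A B : set T) f :
  \int[P]_(x in A) (\1_B x * f x) = \int[P]_(x in A `&` B) f x.
Proof.
rewrite Rintegral_mkcondr; apply: eq_Rintegral => x _.
by rewrite patchE indicE; case: ifPn => _; rewrite ?mul1r ?mul0r.
Qed.

Lemma Rintegral_indic (A B : set T) : measurable A -> measurable B ->
  \int[P]_(x in A) \1_B x = fine (P (A `&` B)).
Proof.
move=> mA mB; rewrite -[RHS]mul1r -Rintegral_cst; last exact: measurableI.
by rewrite -Rintegral_indicr; apply: eq_Rintegral => x _; rewrite mulr1.
Qed.

Lemma indic_le1 (A : set T) x : `|\1_A x| <= 1 :> R.
Proof. by rewrite indicE; case: (x \in A); rewrite ?normr1 ?normr0. Qed.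

Lemma Rintegral_ord_sum (A : set T) (h : nat -> T -> R) n :
  measurable A -> (forall i, P.-integrable A (EFin \o h i)) ->
  \int[P]_(x in A) (\sum_(i < n) h i x) = \sum_(i < n) \int[P]_(x in A) h i x /\
  P.-integrable A (EFin \o (fun x => \sum_(i < n) h i x)).
Proof.
move=> mA ih; elim: n => [|n [e IH]].
  rewrite big_ord0; under [X in Rintegral _ _ X]eq_fun do rewrite big_ord0.
  rewrite Rintegral_cst// mul0r; split => //.
  rewrite (_ : EFin \o _ = cst 0%E); first exact: integrable0.
  by apply/funext => x /=; rewrite big_ord0.
under [X in Rintegral _ _ X]eq_fun do rewrite big_ord_recr/=.
rewrite big_ord_recr/= RintegralD// e; split => //.
rewrite (_ : EFin \o _ =
  ((EFin \o (fun x => (\sum_(i < n) h i x)%R)) \+ (EFin \o h n))%E); last first.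
  by apply/funext => x /=; rewrite big_ord_recr.
exact: integrableD.
Qed.

End bounded_integrands.

Section testing.
Context (d : measure_display) (T : measurableType d) (R : realType).
Variables (P : probability T R) (G : set (set T)).
Hypotheses (Gsig : sigma_algebra setT G) (Gm : G `<=` measurable).
Implicit Types f g h U V W Z : T -> R.

Lemma Rintegral_testing U V h (M : R) :
  P.-integrable setT (EFin \o U) -> P.-integrable setT (EFin \o V) ->
  (forall A, G A -> \int[P]_(x in A) U x = \int[P]_(x in A) V x) ->
  measurable_wrt G h -> (forall x, `|h x| <= M) ->
  \int[P]_x (h x * U x) = \int[P]_x (h x * V x).
Proof.
move=> iU iV UV mh hM.
have mU := integrable_real_measurable iU.
have mV := integrable_real_measurable iV.
have mh' := measurable_wrtW Gm mh.
have intS f (A : set T) : measurable A -> P.-integrable setT (EFin \o f) ->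
    P.-integrable A (EFin \o f) by move=> mA; exact: integrableS.
(* These are the positive part of one function plus the negative part of the other: nonnegative,
   with the same difference as [U] and [V], hence still with equal integrals over the sets of
   [G]. *)
pose U' x := Num.max (U x) 0 + Num.max (- V x) 0.
pose V' x := Num.max (V x) 0 + Num.max (- U x) 0.
have UV' x : U' x - V' x = U x - V x.
  by rewrite /U' /V' /Num.max; do 4 case: ifPn; lra.
have maxint f : P.-integrable setT (EFin \o f) ->
    P.-integrable setT (EFin \o (fun x => Num.max (f x) 0)).
  move=> intf; have mf := integrable_real_measurable intf.
  apply: le_integrable intf => //.
    by apply/measurable_EFinP/measurable_maxr.
  by move=> x _; rewrite lee_fin /Num.max; case: ifPn => // _; rewrite normr0.
have optint f : P.-integrable setT (EFin \o f) ->
    P.-integrable setT (EFin \o (fun x => - f x)).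
  by move=> /integrableN.
have addint f g : P.-integrable setT (EFin \o f) ->
    P.-integrable setT (EFin \o g) ->
    P.-integrable setT (EFin \o (fun x => f x + g x)).
  by move=> i1 i2; exact: (integrableD measurableT i1 i2).
have iU' : P.-integrable setT (EFin \o U') by apply: addint; apply: maxint => //; exact: optint.
have iV' : P.-integrable setT (EFin \o V') by apply: addint; apply: maxint => //; exact: optint.
have UV'A A : G A -> (\int[P]_(x in A) (U' x)%:E = \int[P]_(x in A) (V' x)%:E)%E.
  move=> GA; have mA := Gm GA.
  have : \int[P]_(x in A) (U' x - V' x) = 0.
    under eq_Rintegral do rewrite UV'.
    by rewrite RintegralB//; [rewrite UV// subrr|exact: intS|exact: intS].
  rewrite RintegralB//; [|exact: intS|exact: intS].
  move=> /eqP; rewrite subr_eq0 => /eqP; rewrite /Rintegral => e.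
  rewrite -[LHS]fineK ?e ?fineK//; apply: integrable_fin_num => //; exact: intS.
have M0 : 0 <= M by exact: le_trans (hM point).
(* The shift makes the weight nonnegative; the extra term [M * (U x - V x)] integrates to zero
   because the whole space belongs to [G]. *)
pose h' x := h x + M.
have h'0 x : 0 <= h' x by have := hM x; rewrite ler_norml /h' => /andP[]; lra.
have mh'' : measurable_wrt G h'.
  apply/measurable_wrtP => //; apply: measurable_funD => //.
  exact/measurable_wrtP.
have E : \int[P]_x (h' x * U' x) = \int[P]_x (h' x * V' x).
  congr fine; apply: (ge0_integral_testing Gsig Gm) => //.
  - exact: integrable_real_measurable iU'.
  - exact: integrable_real_measurable iV'.
  - by move=> x; rewrite /U' addr_ge0// le_max lexx orbT.
  - by move=> x; rewrite /V' addr_ge0// le_max lexx orbT.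
have h'M x : `|h' x| <= M + M.
  by have := hM x; rewrite !ler_norml /h' => /andP[? ?]; apply/andP; split; lra.
have mh3 : measurable_fun setT h' by exact: measurable_wrtW mh''.
have iM f : P.-integrable setT (EFin \o f) ->
    P.-integrable setT (EFin \o (fun x => h x * f x)).
  exact: integrable_mul_le_cst hM.
have : \int[P]_x (h' x * U' x - h' x * V' x) = 0.
  rewrite RintegralB//; [by rewrite E subrr| |];
    exact: (integrable_mul_le_cst measurableT mh3 h'M).
rewrite (_ : (fun x => _) = (fun x => (h x * U x - h x * V x) + M * (U x - V x))); last first.
  by apply/funext => x; rewrite -mulrBr UV' /h'; lra.
have iB f g : P.-integrable setT (EFin \o f) ->
    P.-integrable setT (EFin \o g) ->
    P.-integrable setT (EFin \o (fun x => f x - g x)).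
  by move=> i1 i2; apply: addint => //; exact: optint.
rewrite RintegralD//; last 2 first.
- by apply: iB; exact: iM.
- by apply: (integrable_mul_le_cst measurableT (M := `|M|)) => //; exact: iB.
rewrite RintegralZl//; last exact: iB.
rewrite !RintegralB//; [|exact: iM|exact: iM].
rewrite UV; last by have [G0 GC _] := Gsig; rewrite -(setD0 setT); exact: GC.
by rewrite subrr mulr0 addr0 => /eqP; rewrite subr_eq0 => /eqP.
Qed.

(** The set where [V x < U x] itself belongs to [G]; testing on it forces a positive integrand to
    have integral zero there. *)
Lemma ae_le_testing U V :
  measurable_wrt G U -> measurable_wrt G V ->
  P.-integrable setT (EFin \o U) -> P.-integrable setT (EFin \o V) ->
  (forall A, G A -> \int[P]_(x in A) U x <= \int[P]_(x in A) V x) ->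
  {ae P, forall x, U x <= V x}.
Proof.
move=> mU mV iU iV UV.
pose A := [set x | V x < U x].
have GA : G A.
  apply/(measurable_wrt_set Gsig).
  have -> : A = (fun x => U x - V x) @^-1` `]0, +oo[%classic.
    by apply/seteqP; split=> x /=; rewrite in_itv/= andbT subr_gt0.
  rewrite -[X in measurable X]setTI; apply: measurable_funB => //;
    exact/measurable_wrtP.
have mA := Gm GA.
have mUV : measurable_fun setT (fun x => U x - V x).
  apply: measurable_funB; first exact: integrable_real_measurable iU.
  exact: integrable_real_measurable iV.
have iA f : P.-integrable setT (EFin \o f) -> P.-integrable A (EFin \o f).
  exact: integrableS.
have i0 : \int[P]_(x in A) (U x - V x) = 0.
  apply/eqP; rewrite eq_le; apply/andP; split.
    by rewrite RintegralB//; [rewrite subr_le0 UV|exact: iA|exact: iA].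
  by apply: Rintegral_ge0 => x; rewrite /A/= subr_ge0 => /ltW.
have : (\int[P]_(x in A) `|(U x - V x)%:E| = 0)%E.
  transitivity (\int[P]_(x in A) (U x - V x)%:E)%E.
    by apply: eq_integral => x; rewrite inE /A/= => VU /=; rewrite ger0_norm// subr_ge0 ltW.
  rewrite -[LHS]fineK; first by rewrite -/(Rintegral _ _ _) i0.
  apply: integrable_fin_num => //.
  exact: (integrableB mA (iA _ iU) (iA _ iV)).
move=> /ae_eq_integral_abs; move=> /(_ mA) H.
have : ae_eq P A (EFin \o (fun x => U x - V x)) (cst 0%E).
  by apply: H; exact/measurable_EFinP/measurable_funTS.
apply: filterS => x /= H2; rewrite leNgt; apply/negP => xA.
by have := H2 xA; case => /eqP; rewrite subr_eq0 gt_eqF.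
Qed.

Lemma ae_eq_testing U V :
  measurable_wrt G U -> measurable_wrt G V ->
  P.-integrable setT (EFin \o U) -> P.-integrable setT (EFin \o V) ->
  (forall A, G A -> \int[P]_(x in A) U x = \int[P]_(x in A) V x) ->
  {ae P, forall x, U x = V x}.
Proof.
move=> mU mV iU iV UV.
have H1 : {ae P, forall x, U x <= V x}.
  by apply: ae_le_testing => // A GA; rewrite UV.
have H2 : {ae P, forall x, V x <= U x}.
  by apply: ae_le_testing => // A GA; rewrite UV.
by apply: filterS2 H1 H2 => x *; apply/eqP; rewrite eq_le; apply/andP.
Qed.

Lemma cond_exp_Rintegral Z W A :
  is_cond_exp P G Z W -> G A ->
  \int[P]_(x in A) W x = \int[P]_(x in A) Z x.
Proof. by move=> [_ _ ZW] GA; congr fine; exact: ZW. Qed.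

Lemma is_cond_expP Z W :
  P.-integrable setT (EFin \o Z) ->
  measurable_wrt G W -> P.-integrable setT (EFin \o W) ->
  (forall A, G A -> \int[P]_(x in A) W x = \int[P]_(x in A) Z x) ->
  is_cond_exp P G Z W.
Proof.
move=> iZ mW iW ZW; split => // A GA; have mA := Gm GA.
have := congr1 EFin (ZW A GA); rewrite /Rintegral !fineK//;
  apply: integrable_fin_num => //; exact: (integrableS measurableT).
Qed.

Lemma is_cond_exp_unique Z W W' :
  is_cond_exp P G Z W -> is_cond_exp P G Z W' -> {ae P, forall x, W x = W' x}.
Proof.
move=> hW hW'; have [mW iW _] := hW; have [mW' iW' _] := hW'.
apply: ae_eq_testing => // A GA.
by rewrite (cond_exp_Rintegral hW)// (cond_exp_Rintegral hW').
Qed.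

Lemma is_cond_exp_le Z W (M : R) : P.-integrable setT (EFin \o Z) ->
  is_cond_exp P G Z W ->
  {ae P, forall x, Z x <= M} -> {ae P, forall x, W x <= M}.
Proof.
move=> iZ hW ZM; have [mW iW _] := hW.
have mM : measurable_wrt G (cst M).
  by apply/measurable_wrtP => //; exact: measurable_cst.
have iM : P.-integrable setT (EFin \o cst M).
  exact: (@integrable_le_cst _ _ _ _ _ `|M|).
apply: (ae_le_testing (V := cst M)) => // A GA.
rewrite (cond_exp_Rintegral hW)//; have mA := Gm GA.
have mZ := integrable_real_measurable iZ.
(* The bound on [Z] holds almost surely while integrals are compared pointwise; the truncated
   function is below [M] everywhere. *)
rewrite (@ae_eq_Rintegral _ _ _ _ _ (fun x => Num.min (Z x) M))//.
- apply: le_Rintegral => //.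
  + apply: (integrableS measurableT) => //.
    apply: integrable_ae_eq iZ; first exact: measurable_minr.
    by apply: filterS ZM => x ZxM; rewrite min_l.
  + exact: (integrableS measurableT).
  + by move=> x _; rewrite ge_min lexx orbT.
- exact: measurable_minr.
- by apply: filterS ZM => x ZxM; rewrite min_l.
Qed.

Lemma is_cond_exp_normr_le Z W (M : R) : P.-integrable setT (EFin \o Z) ->
  is_cond_exp P G Z W ->
  {ae P, forall x, `|Z x| <= M} -> {ae P, forall x, `|W x| <= M}.
Proof.
move=> iZ hW ZM; have [mW iW _] := hW.
have H1 : {ae P, forall x, W x <= M}.
  by apply: is_cond_exp_le hW _ => //; apply: filterS ZM => x; rewrite ler_norml => /andP[].
have H2 : {ae P, forall x, - W x <= M}.
  have hN : is_cond_exp P G (fun x => - Z x) (fun x => - W x).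
    apply: is_cond_expP.
    - exact: integrableN iZ.
    - by apply/measurable_wrtP => //; apply: measurableT_comp => //; exact/measurable_wrtP.
    - exact: integrableN iW.
    - move=> A GA; have mA := Gm GA.
      rewrite (_ : (fun x => - W x) = (fun x => -1 * W x)); last first.
        by apply/funext => x; rewrite mulN1r.
      rewrite (_ : (fun x => - Z x) = (fun x => -1 * Z x)); last first.
        by apply/funext => x; rewrite mulN1r.
      rewrite !RintegralZl//; last 2 first.
        exact: integrableS iZ.
        exact: integrableS iW.
      by rewrite (cond_exp_Rintegral hW).
  apply: is_cond_exp_le hN _; first exact: integrableN iZ.
  by apply: filterS ZM => x; rewrite ler_norml lerNl => /andP[].
apply: filterS2 H1 H2 => x W1 W2; rewrite ler_norml W1 andbT; lra.
Qed.

End testing.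

(** * Conditional independence and conditional expectations *)

Section clamp.
Context (R : realType).

Definition clamp (M x : R) : R := Num.max (- M) (Num.min M x).

Lemma normr_clamp_le (M x : R) : 0 <= M -> `|clamp M x| <= M.
Proof.
by move=> M0; rewrite ler_norml /clamp /Num.max /Num.min; do 2 case: ifPn;
  rewrite -?leNgt => *; apply/andP; split; lra.
Qed.

Lemma clamp_id (M x : R) : `|x| <= M -> clamp M x = x.
Proof.
by rewrite ler_norml /clamp /Num.max /Num.min => /andP[? ?]; do 2 case: ifPn;
  rewrite -?leNgt => *; apply/eqP; rewrite eq_le; apply/andP; split; lra.
Qed.

Lemma measurable_clamp (M : R) (d : measure_display) (T : measurableType d)
    (f : T -> R) :
  measurable_fun setT f -> measurable_fun setT (fun x => clamp M (f x)).
Proof. by move=> mf; apply: measurable_maxr => //; exact: measurable_minr. Qed.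

Lemma measurable_wrt_clamp (M : R) (T : Type) (G : set (set T)) (f : T -> R) :
  measurable_wrt G f -> measurable_wrt G (fun x => clamp M (f x)).
Proof.
move=> mf B mB.
have mc : measurable_fun setT (clamp M) by exact: measurable_clamp.
have -> : (fun x => clamp M (f x)) @^-1` B = f @^-1` (clamp M @^-1` B) by [].
by apply: mf; rewrite -[X in measurable X]setTI; exact: mc.
Qed.

End clamp.

Section cond_exp_clamp.
Context (d : measure_display) (T : measurableType d) (R : realType).
Variables (P : probability T R) (G : set (set T)).
Hypotheses (Gsig : sigma_algebra setT G) (Gm : G `<=` measurable).

(** Testing asks for weights bounded everywhere, conditional expectations are bounded almost surely;
    clamping passes to a suitable version. *)
Lemma ae_eq_clamp (M : R) (f : T -> R) :
  {ae P, forall x, `|f x| <= M} -> {ae P, forall x, f x = clamp M (f x)}.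
Proof. by apply: filterS => x fx; rewrite clamp_id. Qed.

Lemma is_cond_exp_ae (Z Z' W W' : T -> R) :
  P.-integrable setT (EFin \o Z) -> measurable_fun setT Z' ->
  {ae P, forall x, Z x = Z' x} -> measurable_wrt G W' ->
  {ae P, forall x, W x = W' x} ->
  is_cond_exp P G Z W -> is_cond_exp P G Z' W'.
Proof.
move=> iZ mZ' ZZ' mW' WW' hW; have [mW iW _] := hW.
have mW'' := measurable_wrtW Gm mW'.
apply: is_cond_expP => //.
- exact: integrable_ae_eq iZ.
- exact: integrable_ae_eq iW.
- move=> A GA; have mA := Gm GA.
  rewrite -(@ae_eq_Rintegral _ _ _ _ W)//; last exact: measurable_wrtW mW.
  rewrite (cond_exp_Rintegral hW)//; apply: ae_eq_Rintegral => //.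
  exact: integrable_real_measurable iZ.
Qed.

End cond_exp_clamp.

Section conditional_independence.
Context (d : measure_display) (T : measurableType d) (R : realType).
Variables (P : probability T R) (G H K : set (set T)).
Hypotheses (Gsig : sigma_algebra setT G) (Gm : G `<=` measurable).
Hypotheses (Hsig : sigma_algebra setT H) (Hm : H `<=` measurable).
Hypotheses (Ksig : sigma_algebra setT K) (KG : K `<=` G).

Let Km : K `<=` measurable. Proof. exact: subset_trans Gm. Qed.

Let int_indic (A : set T) : measurable A ->
  P.-integrable setT (EFin \o (\1_A : T -> R)).
Proof.
by move=> mA; apply: (integrable_le_cst P (M := 1)) => //; exact: indic_le1.
Qed.

(** The hypothesis provides a version [h] of the conditional probability of [B] given the larger
    algebra [G] that is already measurable for [K]. Then [h] also serves given [K], and it can be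
    pulled out of the conditional probability of the intersection. The couplings constructed below
    come with such an [h]. *)
Lemma cond_indep_factor :
  (forall B, H B -> exists h : T -> R,
     [/\ measurable_wrt K h, forall x, `|h x| <= 1 &
         forall A, G A -> \int[P]_(x in A) h x = fine (P (A `&` B))]) ->
  cond_indep P G H K.
Proof.
move=> fact A B GA HB.
have mA := Gm GA; have mB := Hm HB.
have mAB : measurable (A `&` B) by exact: measurableI.
have [h [mh h1 hE]] := fact _ HB.
have mh' := measurable_wrtW Km mh.
have ih : P.-integrable setT (EFin \o h) by exact: (integrable_le_cst P _ _ h1).
have cA := cond_expP Ksig Km (int_indic mA).
have cB := cond_expP Ksig Km (int_indic mB).
have cAB := cond_expP Ksig Km (int_indic mAB).
move: cA cB cAB; set a := cond_exp _ _ \1_A; set b := cond_exp _ _ \1_B.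
set c := cond_exp _ _ _ => cA cB cAB.
have bh : {ae P, forall x, b x = h x}.
  apply: (is_cond_exp_unique Ksig Km cB).
  apply: is_cond_expP => //; first exact: int_indic.
  move=> C KC; rewrite hE; last exact: KG.
  by rewrite Rintegral_indic//; exact: Km.
have [ma ia _] := cA.
have ah : is_cond_exp P K (\1_(A `&` B)) (fun x => h x * a x).
  apply: is_cond_expP => //; first exact: int_indic.
  - apply/measurable_wrtP => //.
    by apply: measurable_funM; exact/measurable_wrtP.
  - exact: (integrable_mul_le_cst measurableT mh' h1).
  - move=> C KC; have mC := Km KC.
    pose g x := \1_C x * h x.
    have gh1 x : `|g x| <= 1.
      by rewrite /g normrM mulr_ile1//; exact: indic_le1.
    have mg : measurable_wrt K g.
      apply/measurable_wrtP => //; apply: measurable_funM; last exact/measurable_wrtP.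
      by apply: measurable_indic; exact/(measurable_wrt_set Ksig).
    have -> : \int[P]_(x in C) (h x * a x) = \int[P]_x (g x * a x).
      rewrite -[C in LHS]setTI -Rintegral_indicr.
      by apply: eq_Rintegral => x _; rewrite mulrA.
    rewrite (@Rintegral_testing _ _ _ _ _ Ksig Km a \1_A g 1 ia (int_indic mA))//.
    + transitivity (\int[P]_x (\1_(C `&` A) x * h x)).
        by apply: eq_Rintegral => x _; rewrite /g indicI/= mulrAC.
      rewrite Rintegral_indicr setTI hE; last first.
        apply/(measurable_wrt_set Gsig); apply: measurableI;
        apply/(measurable_wrt_set Gsig) => //; exact: KG.
      by rewrite Rintegral_indic// setIA.
    + by move=> D KD; exact: cond_exp_Rintegral cA KD.
have := is_cond_exp_unique Ksig Km cAB ah.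
by move=> e; apply: filterS2 e bh => x -> ->; rewrite mulrC.
Qed.

(** Testing reduces [Z'] to the indicator of a set [B] of [H]. By conditional independence the
    conditional probability [w] of [B] given [K] also serves given [G], so the indicator may be
    replaced by [w] in front of both [F] and [Z]; and [w], being measurable for [K], does not
    distinguish [F] from its conditional expectation. *)
Lemma cond_indep_Rintegral (F Z Z' : T -> R) (M : R) :
  cond_indep P G H K ->
  measurable_wrt G F -> (forall x, `|F x| <= M) ->
  is_cond_exp P K F Z -> (forall x, `|Z x| <= M) ->
  measurable_wrt H Z' -> (forall x, `|Z' x| <= M) ->
  \int[P]_x (Z' x * F x) = \int[P]_x (Z' x * Z x).
Proof.
move=> ind mF FM hZ ZM mZ' Z'M; have [mZ iZ _] := hZ.
have iF : P.-integrable setT (EFin \o F).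
  by apply: (integrable_le_cst P _ _ FM) => //; exact: measurable_wrtW mF.
apply: (Rintegral_testing Hsig Hm) Z'M => // B HB; have mB := Hm HB.
have cB := cond_expP Ksig Km (int_indic mB).
move: (ind^~ B); move: cB; set b := cond_exp _ _ \1_B => cB indB.
have [mb ib _] := cB.
pose w x := clamp 1 (b x).
have mw : measurable_wrt K w by exact: measurable_wrt_clamp.
have w1 x : `|w x| <= 1 by exact: normr_clamp_le.
have bw : {ae P, forall x, b x = w x}.
  apply: ae_eq_clamp; apply: (is_cond_exp_normr_le Ksig Km (int_indic mB) cB).
  by apply: aeW => x; exact: indic_le1.
have mw' := measurable_wrtW Km mw.
have iw : P.-integrable setT (EFin \o w) by exact: (integrable_le_cst P _ _ w1).
have Bw A : G A -> \int[P]_(x in A) \1_B x = \int[P]_(x in A) w x.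
  move=> GA; have mA := Gm GA.
  have cA := cond_expP Ksig Km (int_indic mA).
  have mAB : measurable (A `&` B) by exact: measurableI.
  have cAB := cond_expP Ksig Km (int_indic mAB).
  move: (indB A GA HB) cA cAB; set a := cond_exp _ _ \1_A.
  set c := cond_exp _ _ _ => abc cA cAB.
  have [ma ia _] := cA; have [mc ic _] := cAB.
  have KT : K setT by have [G0 GC _] := Ksig; rewrite -(setD0 setT); exact: GC.
  rewrite Rintegral_indic// -[X in P X]setTI -Rintegral_indic//.
  rewrite -(cond_exp_Rintegral cAB)//.
  transitivity (\int[P]_x (w x * a x)).
    apply: ae_eq_Rintegral => //.
    - exact: integrable_real_measurable ic.
    - by apply: measurable_funM => //; exact: integrable_real_measurable ia.
    - by apply: filterS2 abc bw => x -> ->; rewrite mulrC.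
  rewrite (@Rintegral_testing _ _ _ _ _ Ksig Km a \1_A w 1 ia (int_indic mA))//.
  - rewrite -[A in RHS]setTI -Rintegral_indicr.
    by apply: eq_Rintegral => x _; rewrite mulrC.
  - by move=> D KD; exact: cond_exp_Rintegral cA KD.
have FB f : measurable_wrt G f -> (forall x, `|f x| <= M) ->
    \int[P]_(x in B) f x = \int[P]_x (f x * w x).
  move=> mf fM; rewrite -(@Rintegral_testing _ _ _ _ _ Gsig Gm \1_B w f M)//.
    rewrite -[B in LHS]setTI -Rintegral_indicr.
    by apply: eq_Rintegral => x _; rewrite mulrC.
  exact: int_indic.
rewrite !FB//; last by move=> C mC; apply/KG/mZ.
transitivity (\int[P]_x (w x * F x)).
  by apply: eq_Rintegral => x _; rewrite mulrC.
rewrite (@Rintegral_testing _ _ _ _ _ Ksig Km F Z w 1)//.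
  by apply: eq_Rintegral => x _; rewrite mulrC.
by move=> C KC; rewrite (cond_exp_Rintegral hZ).
Qed.

End conditional_independence.

(** * Measurability of adapted functions *)

Section row_vectors.
Context (R : realType).

Lemma mx_ballP n (u v : 'rV[R]_n) (e : R) :
  0 < e -> ball u e v <-> forall j, `|u ord0 j - v ord0 j| < e.
Proof.
move=> e0; split=> [[_ uv] j|uv]; first exact: uv.
by split=> // i j; rewrite (ord1 i); exact: uv.
Qed.

Lemma bounded_fun_le n (phi : 'rV[R]_n -> R) :
  bounded_fun phi -> exists2 M, 0 <= M & forall x, `|phi x| <= M.
Proof.
move=> [M [_ HM]]; exists (`|M| + 1) => // x; apply: HM => //.
by rewrite (le_lt_trans (ler_norm _))// ltrDl.
Qed.

(** Boxes with rational centres and radii [k.+1%:R^-1] form a countable base, through which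
    measurability of a continuous function of a row is reduced to that of its entries. *)
Lemma open_rat_cover n (W : set 'rV[R]_n) (x : 'rV[R]_n) : open W -> W x ->
  exists (q : 'rV[rat]_n) (k : nat),
    ball (map_mx ratr q : 'rV[R]_n) k.+1%:R^-1 `<=` W /\
    ball (map_mx ratr q : 'rV[R]_n) k.+1%:R^-1 x.
Proof.
rewrite openE => oW Wx; have /nbhs_ballP[e /= e0 eW] := oW _ Wx.
have [k ke] : exists k, k.+1%:R^-1 < e / 2 :> R.
  exists (Num.truncn (2 / e)); rewrite invf_plt ?posrE ?divr_gt0// invf_div.
  by rewrite truncnS_gt.
have k0 : 0 < k.+1%:R^-1 :> R by rewrite invr_gt0.
have qP j : exists q : rat, `|ratr q - x ord0 j| < k.+1%:R^-1.
  have /rat_in_itvoo[q] : x ord0 j - k.+1%:R^-1 < x ord0 j + k.+1%:R^-1 by rewrite ltrBlDr -addrA ltrDl addr_gt0.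
  rewrite in_itv/= => /andP[q1 q2]; exists q.
  by rewrite ltr_distl q1 q2.
have [q qx] := choice qP.
exists (\row_j q j), k; split; last first.
  by apply/mx_ballP => // j; rewrite !mxE.
move=> y /mx_ballP => /(_ k0) qy; apply: eW; apply/mx_ballP => // j.
have := qy j; rewrite !mxE => qyj; have := qx j => qxj.
rewrite (splitr e) (le_lt_trans (ler_distD (ratr (q j)) _ _))//.
rewrite ltrD//; last exact: lt_trans ke.
by rewrite distrC; exact: lt_trans ke.
Qed.

Lemma measurable_open_row (d : measure_display) (T : measurableType d) n
    (U : 'I_n -> T -> R) (W : set 'rV[R]_n) :
  (forall i, measurable_fun setT (U i)) -> open W ->
  measurable [set x | W (\row_i U i x)].
Proof.
move=> mU oW.
pose F (qk : 'rV[rat]_n * nat) : set T :=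
  [set x | ball (map_mx ratr qk.1 : 'rV[R]_n) qk.2.+1%:R^-1 `<=` W /\
           ball (map_mx ratr qk.1 : 'rV[R]_n) qk.2.+1%:R^-1 (\row_i U i x)].
have -> : [set x | W (\row_i U i x)] = \bigcup_qk F qk.
  apply/seteqP; split=> [x /= Wx|x [[q k] _ [/= qW]]]; last exact: qW.
  by have [q [k [qW qx]]] := open_rat_cover oW Wx; exists (q, k).
apply: countable_bigcupT_measurable; first exact: countableP.
move=> [q k]; rewrite /F /=.
have [qW|qW] := pselect (ball (map_mx ratr q : 'rV[R]_n) k.+1%:R^-1 `<=` W); last first.
  by rewrite (_ : [set x | _] = set0)//; apply/seteqP; split=> x //= [].
rewrite (_ : [set x | _] =
    \bigcap_(j in [set: 'I_n]) (U j @^-1` ball (ratr (q ord0 j) : R) k.+1%:R^-1)).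
  apply: fin_bigcap_measurable => // j _.
  by rewrite -[X in measurable X]setTI; apply: mU => //; exact: measurable_ball.
apply/seteqP; split=> [x [_ /mx_ballP]|x /= Ux].
  by move=> + j _; rewrite invr_gt0 ltr0n => /(_ isT j); rewrite !mxE.
split=> //; apply/mx_ballP; first by rewrite invr_gt0.
by move=> j; rewrite !mxE; exact: Ux.
Qed.

Lemma measurable_continuous_row (d : measure_display) (T : measurableType d) n
    (phi : 'rV[R]_n -> R) (U : 'I_n -> T -> R) :
  continuous phi -> (forall i, measurable_fun setT (U i)) ->
  measurable_fun setT (fun x => phi (\row_i U i x)).
Proof.
move=> cphi mU.
apply: (measurability (@RGenOInfty.G R)) => [|/= _ [_] [r] -> <-].
  exact: RGenOInfty.measurableE.
rewrite setTI.
have -> : (fun x => phi (\row_i U i x)) @^-1` `]r, +oo[%classic =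
    [set x | (phi @^-1` `]r, +oo[%classic) (\row_i U i x)] by [].
apply: measurable_open_row => //.
by apply: open_comp => [x _|]; [exact: cphi|exact: interval_open].
Qed.

End row_vectors.

Section AF_regularity.
Context (R : realType) (N : nat).
Implicit Types (X : filtered_process R N) (f : AF R N).

Lemma fp_filt_last X t : fp_filt X t `<=` fp_filt X ord_max.
Proof. by apply: fp_filt_mono; rewrite -ltnS. Qed.

Lemma measurable_wrt_row X (t : 'I_N.+1) n (phi : 'rV[R]_n -> R)
    (U : 'I_n -> fp_space X -> R) :
  continuous phi -> (forall i, measurable_wrt (fp_filt X t) (U i)) ->
  measurable_wrt (fp_filt X t) (fun x => phi (\row_i U i x)).
Proof.
move=> cphi mU; have sX := @fp_filt_sigma _ _ X t.
apply/(measurable_wrtP sX).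
pose T : measurableType _ := g_sigma_algebraType (fp_filt X t).
apply: (@measurable_continuous_row _ _ T n phi U) => // i.
exact/(measurable_wrtP sX).
Qed.

(** The bound is chosen before the process, so one clamping level serves [X] and [Y] together. It
    holds only almost surely because [AF3] picks an arbitrary version. *)
Lemma AF_eval_regular f : exists2 M : R, 0 <= M & forall X,
  measurable_wrt (fp_filt X ord_max) (AF_eval X f) /\
  {ae fp_prob X, forall w, `|AF_eval X f w| <= M}.
Proof.
elim: f => [Phi cPhi bPhi|m phi cphi bphi fs ih|t g [M M0 ih]].
- have [M M0 hM] := bounded_fun_le bPhi; exists M => // X; split.
    apply: measurable_wrt_row => // i B mB.
    by apply: (@fp_filt_last _ i); exact: fp_adapted.
  by apply: aeW => w; exact: hM.
- have [M M0 hM] := bounded_fun_le bphi; exists M => // X; split.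
    apply: measurable_wrt_row => // i.
    by have [M' _ hM'] := ih i; have [] := hM' X.
  by apply: aeW => w; exact: hM.
- exists M => // X; have [mg gM] := ih X.
  have sX := @fp_filt_sigma _ _ X; have mX := @fp_filt_sub _ _ X.
  have mg' := measurable_wrtW (mX _) mg.
  have ig : (fp_prob X).-integrable setT (EFin \o AF_eval X g).
    apply: (@integrable_ae_eq _ _ _ _ (fun x => clamp M (AF_eval X g x))) => //.
      apply: filterS gM => x xM; rewrite clamp_id//.
    apply: (integrable_le_cst _ _ (M := M)) => //; first exact: measurable_clamp.
    by move=> x; exact: normr_clamp_le.
  have hW := cond_expP (sX t) (mX t) ig.
  split; last exact: is_cond_exp_normr_le hW gM.
  by have [mW _ _] := hW; move=> B mB; apply: (@fp_filt_last _ t); exact: mW.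
Qed.

Lemma AF_eval_integrable f X :
  (fp_prob X).-integrable setT (EFin \o AF_eval X f).
Proof.
have [M M0 /(_ X)[mf fM]] := AF_eval_regular f.
have mf' := measurable_wrtW (@fp_filt_sub _ _ X _) mf.
apply: (@integrable_ae_eq _ _ _ _ (fun x => clamp M (AF_eval X f x))) => //.
  by apply: filterS fM => x xM; rewrite clamp_id.
apply: (integrable_le_cst _ _ (M := M)) => //; first exact: measurable_clamp.
by move=> x; exact: normr_clamp_le.
Qed.

Lemma AF_eval_cond_exp g t X :
  is_cond_exp (fp_prob X) (fp_filt X t) (AF_eval X g) (AF_eval X (AF3 t g)).
Proof.
apply: cond_expP; first exact: fp_filt_sigma.
- exact: fp_filt_sub.
- exact: AF_eval_integrable.
Qed.

End AF_regularity.

(** * Stability of adapted functions under bicausal couplings *)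

Section bounded_measurable.
Context (d : measure_display) (T : measurableType d) (R : realType).
Variable P : probability T R.
Implicit Types f g h : T -> R.

Definition bounded_measurable f :=
  measurable_fun setT f /\ exists M, forall x, `|f x| <= M.

Lemma bounded_measurable_integrable f (A : set T) : measurable A ->
  bounded_measurable f -> P.-integrable A (EFin \o f).
Proof. by move=> mA [mf [M fM]]; exact: integrable_le_cst fM. Qed.

Lemma bounded_measurableB f g : bounded_measurable f -> bounded_measurable g ->
  bounded_measurable (fun x => f x - g x).
Proof.
move=> [mf [M fM]] [mg [M' gM]]; split; first exact: measurable_funB.
exists (M + M') => x; rewrite (le_trans (ler_normB _ _))// lerD//; exact: gM.
Qed.

Lemma bounded_measurableM f g : bounded_measurable f -> bounded_measurable g ->
  bounded_measurable (fun x => f x * g x).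
Proof.
move=> [mf [M fM]] [mg [M' gM]]; split; first exact: measurable_funM.
by exists (M * M') => x; rewrite normrM ler_pM.
Qed.

Lemma bounded_measurable_cst (c : R) : bounded_measurable (cst c).
Proof. by split=> //; exists `|c|. Qed.

Lemma RintegralBM f g h : bounded_measurable f -> bounded_measurable g ->
  bounded_measurable h ->
  \int[P]_x ((f x - g x) * h x) = \int[P]_x (f x * h x) - \int[P]_x (g x * h x).
Proof.
move=> bf bg bh; under eq_Rintegral do rewrite mulrBl.
by rewrite RintegralB//; apply: bounded_measurable_integrable => //;
  exact: bounded_measurableM.
Qed.

Lemma RintegralC f g : \int[P]_x (f x * g x) = \int[P]_x (g x * f x).
Proof. by apply: eq_Rintegral => x _; rewrite mulrC. Qed.

(** The difference of the two sides is the variance of [f]. *)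
Lemma sqr_Rintegral_le f : bounded_measurable f ->
  (\int[P]_x f x) ^+ 2 <= \int[P]_x (f x * f x).
Proof.
move=> bf; set m := \int[P]_x f x.
pose c : T -> R := cst m.
have bc : bounded_measurable c := bounded_measurable_cst m.
have bfc : bounded_measurable (fun x => f x - c x) by exact: bounded_measurableB.
have cM h : bounded_measurable h -> \int[P]_x (c x * h x) = m * \int[P]_x h x.
  by move=> bh; rewrite RintegralZl//; exact: bounded_measurable_integrable.
have : 0 <= \int[P]_x ((f x - c x) * (f x - c x)).
  by apply: Rintegral_ge0 => x _; rewrite -expr2 sqr_ge0.
rewrite RintegralBM// cM// (RintegralC f) RintegralBM// cM//.
rewrite RintegralB//; [|exact: bounded_measurable_integrable..].
have -> : \int[P]_x c x = m.
  have -> : \int[P]_x c x = m * fine (P setT) by exact: Rintegral_cst.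
  by rewrite probability_setT mulr1.
by rewrite -/m subrr mulr0 subr0 expr2 subr_ge0.
Qed.

(* Abstract Pythagoras: if [z - z'] is orthogonal to [(f - f') - (z - z')]
   then it is the shorter vector. *)
Lemma L2_contraction f f' z z' :
  bounded_measurable f -> bounded_measurable f' ->
  bounded_measurable z -> bounded_measurable z' ->
  \int[P]_x (z x * f x) = \int[P]_x (z x * z x) ->
  \int[P]_x (z' x * f x) = \int[P]_x (z' x * z x) ->
  \int[P]_x (z x * f' x) = \int[P]_x (z x * z' x) ->
  \int[P]_x (z' x * f' x) = \int[P]_x (z' x * z' x) ->
  \int[P]_x ((z x - z' x) * (z x - z' x)) <=
  \int[P]_x ((f x - f' x) * (f x - f' x)).
Proof.
move=> bf bf' bz bz' zf z'f zf' z'f'.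
pose a x := f x - f' x; pose b x := z x - z' x.
have ba : bounded_measurable a by exact: bounded_measurableB.
have bb : bounded_measurable b by exact: bounded_measurableB.
have ab : \int[P]_x (a x * b x) = \int[P]_x (b x * b x).
  rewrite (RintegralBM bf bf' bb) (RintegralC f) (RintegralC f').
  rewrite (RintegralBM bz bz' bf) (RintegralBM bz bz' bf').
  rewrite (RintegralBM bz bz' bb) (RintegralC z b) (RintegralC z' b).
  rewrite (RintegralBM bz bz' bz) (RintegralBM bz bz' bz').
  by rewrite zf z'f zf' z'f'.
have : 0 <= \int[P]_x ((a x - b x) * (a x - b x)).
  by apply: Rintegral_ge0 => x _; rewrite -expr2 sqr_ge0.
have bab : bounded_measurable (fun x => a x - b x) by exact: bounded_measurableB.
rewrite (RintegralBM ba bb bab) (RintegralC a) (RintegralC b).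
rewrite (RintegralBM ba bb ba) (RintegralBM ba bb bb) (RintegralC b a) ab.
by rewrite subrr subr0 subr_ge0.
Qed.

Lemma ge0_integral_le_indic (h : T -> R) (a b : R) (C : set T) :
  measurable_fun setT h -> (forall x, 0 <= h x) -> measurable C ->
  0 <= a -> 0 <= b ->
  (forall x, ~ C x -> h x <= a) -> (forall x, h x <= a + b) ->
  (\int[P]_x (h x)%:E <= a%:E + b%:E * P C)%E.
Proof.
move=> mh h0 mC a0 b0 hC hab.
apply: (@le_trans _ _ (\int[P]_x (a%:E + b%:E * (\1_C x)%:E))%E).
  apply: ge0_le_integral => //.
  - by move=> x _; rewrite lee_fin.
  - exact/measurable_EFinP.
  - by apply/measurable_EFinP/measurable_funD => //; exact: measurable_funM.
  - move=> x _; rewrite -EFinM -EFinD lee_fin indicE.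
    have [xC|xC] := boolP (x \in C); first by rewrite mulr1.
    by rewrite mulr0 addr0; apply: hC => Cx; rewrite mem_set in xC.
rewrite ge0_integralD//; last 2 first.
- by move=> x _; rewrite -EFinM lee_fin mulr_ge0.
- by apply/measurable_EFinP; exact: measurable_funM.
rewrite integral_cst// [X in (_ * X)%E]probability_setT mule1.
rewrite ge0_integralZl//; last exact/measurable_EFinP/measurable_indic.
by rewrite integral_indic// setIT.
Qed.

End bounded_measurable.

(** * Transfer along a measure-preserving map *)

Section pullback.
Context (d d' : measure_display) (T : measurableType d) (W : measurableType d').
Context (R : realType) (P : probability T R) (mu : probability W R).
Variables (g : W -> T) (mg : measurable_fun setT g).
Hypothesis gP : forall A, measurable A -> mu (g @^-1` A) = P A.

Lemma measurable_pullback A : measurable A -> measurable (g @^-1` A).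
Proof. by move=> mA; rewrite -[X in measurable X]setTI; exact: mg. Qed.

Lemma pullback_ge0_integral (f : T -> \bar R) (A : set T) : measurable A ->
  measurable_fun setT f -> (forall x, (0 <= f x)%E) ->
  (\int[mu]_(x in g @^-1` A) f (g x) = \int[P]_(x in A) f x)%E.
Proof.
move=> mA mf f0; rewrite [RHS](eq_measure_integral (pushforward mu g)); last first.
  by move=> B mB _; apply/esym; exact: gP.
by rewrite ge0_integral_pushforward//; exact: measurable_funTS.
Qed.

Lemma pullback_integrable (f : T -> R) : P.-integrable setT (EFin \o f) ->
  mu.-integrable setT (EFin \o (f \o g)).
Proof.
move=> /integrableP[mf fi]; apply/integrableP; split.
  exact: (measurableT_comp mf mg).
have := @pullback_ge0_integral (fun x => `|(f x)%:E|)%E setT measurableT.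
rewrite preimage_setT => -> //.
exact/measurableT_comp.
Qed.

Lemma pullback_Rintegral (f : T -> R) (A : set T) : measurable A ->
  P.-integrable setT (EFin \o f) ->
  \int[mu]_(x in g @^-1` A) f (g x) = \int[P]_(x in A) f x.
Proof.
move=> mA fi; congr fine; have [mf _] := integrableP _ _ _ fi.
rewrite [RHS](eq_measure_integral (pushforward mu g)); last first.
  by move=> B mB _; apply/esym; exact: gP.
rewrite integral_pushforward//.
apply: (integrableS measurableT) => //; first exact: measurable_pullback.
exact: pullback_integrable.
Qed.

Lemma pullback_ae (Q : T -> Prop) :
  {ae P, forall x, Q x} -> {ae mu, forall x, Q (g x)}.
Proof.
move=> [A [mA A0 QA]]; exists (g @^-1` A); split => [||x /= nQ].
- exact: measurable_pullback.
- by rewrite -A0; exact: gP.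
- exact: QA.
Qed.

Lemma pullback_cond_exp (F : set (set T)) (Z V : T -> R) :
  F `<=` measurable -> P.-integrable setT (EFin \o Z) ->
  is_cond_exp P F Z V ->
  is_cond_exp mu (preimage_set_system setT g F) (Z \o g) (V \o g).
Proof.
move=> Fm iZ hV; have [mV iV _] := hV.
have FW : preimage_set_system setT g F `<=` measurable.
  by move=> _ [A FA <-]; rewrite setTI; exact/measurable_pullback/Fm.
apply: is_cond_expP => //.
- exact: pullback_integrable.
- by move=> B mB; exists (V @^-1` B); [exact: mV|rewrite setTI].
- exact: pullback_integrable.
- move=> _ [A FA <-]; rewrite setTI !pullback_Rintegral//; try exact: Fm.
  exact: (cond_exp_Rintegral hV).
Qed.

End pullback.

Section stability.
Context (d : measure_display) (T : measurableType d) (R : realType).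
Variable P : probability T R.

(* No compactness is needed: the points where [phi] oscillates by more than [e]
   within distance [1/k] form open sets decreasing to the empty set. *)
Lemma continuous_row_stable n (phi : 'rV[R]_n -> R) (M : R) (U : 'I_n -> T -> R) (eps : R) :
  continuous phi -> (forall x, `|phi x| <= M) ->
  (forall i, measurable_fun setT (U i)) -> 0 < eps ->
  exists2 eta : R, 0 < eta &
  forall (d' : measure_display) (W : measurableType d') (mu : probability W R)
    (g : W -> T) (V : 'I_n -> W -> R),
  measurable_fun setT g ->
  (forall A, measurable A -> mu (g @^-1` A) = P A) ->
  (forall i, measurable_fun setT (V i)) ->
  (forall i, mu [set x | (eta <= `|U i (g x) - V i x|)%R] <= eta%:E)%E ->
  (\int[mu]_x ((phi (\row_i U i (g x)) - phi (\row_i V i x))%R ^+ 2)%:E <= eps%:E)%E.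
Proof.
move=> cphi phiM mU eps0.
have M0 : 0 <= M by exact: le_trans (phiM 0).
pose e := Num.sqrt (eps / 2).
have e0 : 0 < e by rewrite sqrtr_gt0 divr_gt0.
have e2 : e ^+ 2 = eps / 2 by rewrite sqr_sqrtr// divr_ge0// ltW.
pose O (k : nat) : set 'rV[R]_n :=
  \bigcup_y (ball y k.+1%:R^-1 `&` [set x | e < `|phi x - phi y|]).
have oO k : open (O k).
  apply: bigcup_open => y _.
  apply: openI; first exact: (@ball_open R 'rV[R]_n).
  have -> : [set x | e < `|phi x - phi y|] =
      (fun x => `|phi x - phi y|) @^-1` `]e, +oo[%classic.
    by apply/seteqP; split=> x /=; rewrite in_itv/= andbT.
  apply: open_comp => [x _|]; last exact: interval_open.
  have : phi z - phi y @[z --> x] --> phi x - phi y.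
    exact: (cvgB (cphi x) (cvg_cst _)).
  by move/cvg_norm.
pose B k : set T := [set x | O k (\row_i U i x)].
have mB k : measurable (B k) by exact: measurable_open_row.
have B0 : \bigcap_k B k = set0.
  apply/seteqP; split=> // x Bx; set u := \row_i U i x.
  have /cvgrPdist_lt/(_ e e0)/nbhs_ballP[r /= r0 rB] : phi @ u --> phi u by exact: cphi.
  have [k kr] : exists k, k.+1%:R^-1 < r :> R.
    exists (Num.truncn r^-1); rewrite invf_plt ?posrE//.
    by rewrite truncnS_gt.
  have [y _ [/ball_sym yu]] := Bx k I; rewrite /= -/u => ey.
  have := rB y (le_ball (ltW kr) yu).
  by rewrite ltNge (ltW ey).
have dB : nonincreasing_seq B.
  move=> k l kl; apply/subsetPset => x [y _ [yu ey]]; exists y => //; split=> //.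
  by apply: le_ball yu; rewrite lef_pV2 ?posrE// ler_nat.
have PB : P \o B @ \oo --> 0%E.
  rewrite -(measure0 P) -B0; apply: nonincreasing_cvg_mu => //.
  - by rewrite (le_lt_trans (probability_le1 P (mB 0%N)))// ltry.
  - by rewrite B0.
(* The exceptional set will have measure at most [2 * c], and the squared difference is at most
   [4 * M ^+ 2] on it: together at most [eps / 2]. Adding 1 keeps the denominator positive when [M]
   is zero. *)
pose c := eps / (16 * (M ^+ 2 + 1)).
have M21 : 0 < M ^+ 2 + 1 by rewrite ltr_wpDl// sqr_ge0.
have c0 : 0 < c by rewrite divr_gt0// mulr_gt0.
have [k Bk] : exists k, (P (B k) <= c%:E)%E.
  have /PB[k _ Pk] : nbhs (0%E : \bar R) [set y | (y < c%:E)%E].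
    exact: (@nbhs_open_ereal_lt _ 0 (fun=> c) c0).
  by exists k; apply/ltW; exact: (Pk k (leqnn k)).
have nc0 : 0 < c / n.+1%:R by rewrite divr_gt0.
(* The first term places the row of the [V i] within the radius used in [O k]; the second makes the
   [n] exceptional sets of the coordinates have total measure at most [c]. *)
exists (Num.min k.+1%:R^-1 (c / n.+1%:R)); first by rewrite lt_min nc0 invr_gt0 ltr0n.
set eta := Num.min _ _ => d' W mu g V mg gP mV UV.
pose C i : set W := [set x | eta <= `|U i (g x) - V i x|].
have mUV i : measurable_fun setT (fun x => `|U i (g x) - V i x|).
  by apply/measurableT_comp => //; apply: measurable_funB => //; exact: measurableT_comp.
have mC i : measurable (C i).
  have -> : C i = (fun x => `|U i (g x) - V i x|) @^-1` `[eta, +oo[%classic.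
    by apply/seteqP; split=> x /=; rewrite in_itv/= andbT.
  by rewrite -[X in measurable X]setTI; exact: mUV.
pose D := g @^-1` B k `|` \big[setU/set0]_(i < n) C i.
have mD : measurable D.
  by apply: measurableU; [exact: measurable_pullback|exact: bigsetU_measurable].
have muD : (mu D <= (c + c)%:E)%E.
  rewrite (le_trans (measureU2 _ _ _))//; [exact: measurable_pullback|exact: bigsetU_measurable|].
  rewrite EFinD leeD//; first by move: Bk; congr (_ <= _)%E; apply/esym; exact: gP.
  apply: (@le_trans _ _ (\sum_(i < n) (c / n.+1%:R)%:E)%E).
    have [_] : measurable (\big[setU/set0]_(i < n) C i) /\
        (mu (\big[setU/set0]_(i < n) C i) <= \sum_(i < n) mu (C i))%E.
      elim/big_ind2: _ => [|A x B' y [mA Ax] [mB' By]|i _]; last by split.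
      - by split => //; rewrite measure0.
      - split; first exact: measurableU.
        by rewrite (le_trans (measureU2 _ _ _))// leeD.
    move=> /le_trans; apply; apply: lee_sum => i _.
    by rewrite (le_trans (UV i))// lee_fin ge_min lexx orbT.
  rewrite sumEFin lee_fin sumr_const card_ord -[leLHS]mulr_natr -mulrA.
  apply: ler_piMr; first exact: ltW.
  by rewrite mulrC ler_pdivrMr ?ltr0n// mul1r ler_nat.
have mh : measurable_fun setT (fun x => (phi (\row_i U i (g x)) - phi (\row_i V i x)) ^+ 2).
  apply: measurable_funX; apply: measurable_funB.
    exact: (measurableT_comp (measurable_continuous_row cphi mU) mg).
  exact: measurable_continuous_row.
apply: (le_trans (@ge0_integral_le_indic _ _ _ mu _ (eps / 2) (4 * M ^+ 2) D mh _ mD _ _ _ _)).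
- by move=> x; exact: sqr_ge0.
- by rewrite divr_ge0// ltW.
- by rewrite mulr_ge0// sqr_ge0.
- move=> x nDx; rewrite -e2 -ler_sqrt ?sqr_ge0// !sqrtr_sqr (gtr0_norm e0).
  rewrite leNgt; apply/negP => ex; apply: nDx.
  have [nC|] := pselect (forall i, ~ C i x); last first.
    move=> /existsNP[i /contrapT Ci]; right; rewrite -bigcup_seq/=.
    by exists i => //=; rewrite mem_index_enum.
  left; exists (\row_i V i x) => //; split => //=.
  apply: ball_sym; apply/mx_ballP; first by rewrite invr_gt0.
  move=> i; rewrite !mxE ltNge; apply/negP => kx; apply: (nC i).
  by rewrite /C/= (le_trans _ kx)// ge_min lexx.
- move=> x; apply: (@le_trans _ _ (4 * M ^+ 2)); last by rewrite lerDr divr_ge0// ltW.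
  have := phiM (\row_i U i (g x)); have := phiM (\row_i V i x).
  by rewrite !ler_norml => /andP[? ?] /andP[? ?]; nra.
rewrite (le_trans (leeD2l _ (lee_wpmul2l _ muD)))//.
  by rewrite lee_fin mulr_ge0// sqr_ge0.
rewrite -EFinM -EFinD lee_fin [leRHS](splitr eps) lerD2l.
rewrite (_ : c + c = eps / 8 / (M ^+ 2 + 1)); last by rewrite /c; field; rewrite gt_eqF.
rewrite mulrA ler_pdivrMr//; nra.
Qed.

End stability.

Section chebyshev.
Context (d : measure_display) (T : measurableType d) (R : realType).
Variable P : probability T R.

Lemma ge0_markov (h : T -> R) (c : R) : measurable_fun setT h ->
  (forall x, 0 <= h x) -> 0 < c ->
  (c%:E * P [set x | (c <= h x)%R] <= \int[P]_x (h x)%:E)%E.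
Proof.
move=> mh h0 c0.
have -> : (\int[P]_x (h x)%:E = \int[P]_x `|(EFin \o h) x|)%E.
  by apply: eq_integral => x _ /=; rewrite ger0_norm.
rewrite (_ : [set x | (c <= h x)%R] =
    setT `&` [set x | (c%:E <= `|(EFin \o h) x|)%E]).
  by apply: le_integral_abse => //; exact/measurable_EFinP.
by rewrite setTI; apply/seteqP; split=> x /=; rewrite lee_fin ger0_norm.
Qed.

Lemma ae_eq_sqr_integral (f f' : T -> R) : measurable_fun setT f ->
  measurable_fun setT f' -> {ae P, forall x, f x = f' x} ->
  (\int[P]_x (f x ^+ 2)%:E = \int[P]_x (f' x ^+ 2)%:E)%E.
Proof.
move=> mf mf' ff'; apply: ge0_ae_eq_integral => //.
- exact/measurable_EFinP/measurable_funX.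
- exact/measurable_EFinP/measurable_funX.
- by move=> x _; rewrite lee_fin sqr_ge0.
- by move=> x _; rewrite lee_fin sqr_ge0.
- by apply: filterS ff' => x ->.
Qed.

End chebyshev.

Section bicausal_stability.
Context (R : realType) (N : nat).
Variables X Y : filtered_process R N.
Local Notation XY := (fp_space X * fp_space Y)%type.

Lemma measurable_AF_eval (Z : filtered_process R N) f :
  measurable_fun setT (AF_eval Z f).
Proof.
by have [M _ /(_ Z)[mf _]] := AF_eval_regular f;
  exact: measurable_wrtW (@fp_filt_sub _ _ Z _) mf.
Qed.

Lemma measurable_fp_proc (Z : filtered_process R N) t :
  measurable_fun setT (fp_proc Z t).
Proof. exact: measurable_wrtW (@fp_filt_sub _ _ Z _) (@fp_adapted _ _ Z t). Qed.

Lemma measurable_preimage_filt (d : measure_display) (W : measurableType d)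
    (Z : filtered_process R N) (g : W -> fp_space Z) t : measurable_fun setT g ->
  preimage_set_system setT g (fp_filt Z t) `<=` measurable.
Proof.
move=> mg _ [A FA <-]; rewrite setTI; apply: measurable_pullback => //.
exact: fp_filt_sub FA.
Qed.

Lemma sigma_algebra_preimage_filt (W : Type)
    (Z : filtered_process R N) (g : W -> fp_space Z) t :
  sigma_algebra setT (preimage_set_system setT g (fp_filt Z t)).
Proof. exact/sigma_algebra_preimage/fp_filt_sigma. Qed.

Lemma preimage_filt_last (W : Type) (Z : filtered_process R N)
    (g : W -> fp_space Z) t :
  preimage_set_system setT g (fp_filt Z t) `<=`
  preimage_set_system setT g (fp_filt Z ord_max).
Proof. by move=> _ [A FA <-]; exists A => //; exact: fp_filt_last FA. Qed.

Lemma measurable_wrt_preimage (W T : Type) (g : W -> T) (F : set (set T))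
    (f : T -> R) :
  measurable_wrt F f -> measurable_wrt (preimage_set_system setT g F) (f \o g).
Proof. by move=> mf B mB; exists (f @^-1` B); [exact: mf|rewrite setTI]. Qed.

(* One half of the bicausality of [mu], seen through the two projections
   [g] and [g'] from an abstract space. *)
Lemma causal_Rintegral (d : measure_display) (W : measurableType d)
    (mu : probability W R) (Z Z' : filtered_process R N)
    (g : W -> fp_space Z) (g' : W -> fp_space Z') t (f z : fp_space Z -> R)
    (z' : fp_space Z' -> R) (M : R) :
  measurable_fun setT g -> measurable_fun setT g' ->
  (forall A, measurable A -> mu (g @^-1` A) = fp_prob Z A) ->
  cond_indep mu (preimage_set_system setT g (fp_filt Z ord_max))
    (preimage_set_system setT g' (fp_filt Z' t))
    (preimage_set_system setT g (fp_filt Z t)) ->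
  measurable_wrt (fp_filt Z ord_max) f -> (forall x, `|f x| <= M) ->
  is_cond_exp (fp_prob Z) (fp_filt Z t) f z -> (forall x, `|z x| <= M) ->
  measurable_wrt (fp_filt Z' t) z' -> (forall x, `|z' x| <= M) ->
  \int[mu]_w (z' (g' w) * f (g w)) = \int[mu]_w (z' (g' w) * z (g w)) /\
  \int[mu]_w (z (g w) * f (g w)) = \int[mu]_w (z (g w) * z (g w)).
Proof.
move=> mg mg' gP ci mf fM hz zM mz' z'M; have [mz iz _] := hz.
have mf' := measurable_wrtW (@fp_filt_sub _ _ Z _) mf.
have fi : (fp_prob Z).-integrable setT (EFin \o f).
  exact: (integrable_le_cst _ _ _ fM).
have hzg : is_cond_exp mu (preimage_set_system setT g (fp_filt Z t)) (f \o g) (z \o g).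
  by apply: (pullback_cond_exp mg gP) => //; exact: fp_filt_sub.
have sig := sigma_algebra_preimage_filt.
split.
  apply: (cond_indep_Rintegral (sig _ _ g ord_max) _ (sig _ _ g' t) _ (sig _ _ g t) _
            ci (M := M) (F := f \o g) (Z := z \o g) (Z' := z' \o g')) => //.
  - exact: measurable_preimage_filt.
  - exact: measurable_preimage_filt.
  - exact: preimage_filt_last.
  - exact: measurable_wrt_preimage.
  - by move=> x; exact: fM.
  - by move=> x; exact: zM.
  - exact: measurable_wrt_preimage.
  - by move=> x; exact: z'M.
apply: (Rintegral_testing (sig _ _ g t) _ (U := f \o g) (V := z \o g) (M := M)
          (h := z \o g)).
- exact: measurable_preimage_filt.
- exact: pullback_integrable fi.
- exact: pullback_integrable iz.
- by move=> A FA; rewrite (cond_exp_Rintegral hzg).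
- exact: measurable_wrt_preimage.
- by move=> x; exact: zM.
Qed.

Lemma bicausal_AF3_contraction (pi : probability XY R) (t : 'I_N.+1) (f : AF R N) :
  Cpl_bc pi ->
  (\int[pi]_w ((AF_eval X (AF3 t f) w.1 - AF_eval Y (AF3 t f) w.2) ^+ 2)%:E <=
   \int[pi]_w ((AF_eval X f w.1 - AF_eval Y f w.2) ^+ 2)%:E)%E.
Proof.
move=> [[piX piY] cau acau].
have [M M0 fM] := AF_eval_regular f.
pose c (Z : filtered_process R N) h w := clamp M (AF_eval Z h w).
have AFM Z : {ae fp_prob Z, forall w, `|AF_eval Z f w| <= M} by have [] := fM Z.
have AFM3 Z : {ae fp_prob Z, forall w, `|AF_eval Z (AF3 t f) w| <= M}.
  apply: (@is_cond_exp_normr_le _ _ _ _ (fp_filt Z t) _ _ (AF_eval Z f)) => //.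
  - exact: fp_filt_sigma.
  - exact: fp_filt_sub.
  - exact: AF_eval_integrable.
  - exact: AF_eval_cond_exp.
have mc Z h : measurable_fun setT (c Z h).
  exact/measurable_clamp/measurable_AF_eval.
have ci Z : is_cond_exp (fp_prob Z) (fp_filt Z t) (c Z f) (c Z (AF3 t f)).
  have [mW iW _] := AF_eval_cond_exp f t Z.
  apply: (is_cond_exp_ae _ _ _ _ _ _ (AF_eval_cond_exp f t Z)).
  - exact: fp_filt_sub.
  - exact: AF_eval_integrable.
  - exact: mc.
  - exact: ae_eq_clamp.
  - exact: measurable_wrt_clamp mW.
  - exact: ae_eq_clamp.
have cM Z h w : `|c Z h w| <= M by exact: normr_clamp_le.
have mcf Z : measurable_wrt (fp_filt Z ord_max) (c Z f).
  by have [mf _] := fM Z; exact: measurable_wrt_clamp mf.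
have mcz Z : measurable_wrt (fp_filt Z t) (c Z (AF3 t f)) by have [] := ci Z.
(* Causality gives [zf1] and anticausality [zf3], the two mixed orthogonality relations; [zf2] and
   [zf4] are the projection property of each conditional expectation alone. *)
have [zf1 zf2] := causal_Rintegral measurable_fst measurable_snd piX (cau t)
  (mcf X) (cM X f) (ci X) (cM X _) (mcz Y) (cM Y _).
have [zf3 zf4] := causal_Rintegral measurable_snd measurable_fst piY (acau t)
  (mcf Y) (cM Y f) (ci Y) (cM Y _) (mcz X) (cM X _).
have bX h : bounded_measurable (fun w : XY => c X h w.1).
  split; last by exists M => w; exact: cM.
  exact: (measurableT_comp (mc X h) measurable_fst).
have bY h : bounded_measurable (fun w : XY => c Y h w.2).
  split; last by exists M => w; exact: cM.
  exact: (measurableT_comp (mc Y h) measurable_snd).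
have := L2_contraction (bX f) (bY f) (bX (AF3 t f)) (bY (AF3 t f)) zf2 zf1 zf3 zf4.
have cE h : {ae fp_prob X, forall w, `|AF_eval X h w| <= M} ->
    {ae fp_prob Y, forall w, `|AF_eval Y h w| <= M} ->
    (\int[pi]_w ((AF_eval X h w.1 - AF_eval Y h w.2) ^+ 2)%:E =
    (\int[pi]_w ((c X h w.1 - c Y h w.2) * (c X h w.1 - c Y h w.2)))%R%:E)%E.
  move=> hX hY; rewrite fineK; last first.
    apply: integrable_fin_num => //; apply: bounded_measurable_integrable => //.
    by apply: bounded_measurableM; exact: bounded_measurableB.
  rewrite (@ae_eq_sqr_integral _ _ _ pi _ (fun w => c X h w.1 - c Y h w.2)).
  - by apply: eq_integral => w _; rewrite expr2.
  - apply: measurable_funB.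
    + exact: (measurableT_comp (@measurable_AF_eval X h) measurable_fst).
    + exact: (measurableT_comp (@measurable_AF_eval Y h) measurable_snd).
  - by have [] := bounded_measurableB (bX h) (bY h).
  - have /= h1 := pullback_ae measurable_fst piX (ae_eq_clamp hX).
    have /= h2 := pullback_ae measurable_snd piY (ae_eq_clamp hY).
    by apply: filterS2 h1 h2 => w -> ->; rewrite /c.
by rewrite !cE// lee_fin.
Qed.

(** Closeness of the processes is measured in probability, the kind of input that
    [continuous_row_stable] takes, while the output is in squared L2 norm, the quantity that
    conditioning contracts; Markov's inequality converts between the two in the [AF2] case. *)
Lemma bicausal_AF_stable (f : AF R N) (eps : R) : 0 < eps ->
  exists2 delta : R, 0 < delta & forall pi : probability XY R, Cpl_bc pi ->
    (forall t, pi [set w | (delta <= `|fp_proc X t w.1 - fp_proc Y t w.2|)%R] <= delta%:E)%E ->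
    (\int[pi]_w ((AF_eval X f w.1 - AF_eval Y f w.2) ^+ 2)%:E <= eps%:E)%E.
Proof.
elim: f eps => [Phi cPhi bPhi|m phi cphi bphi fs ih|t g ih] eps eps0.
- have [M M0 hM] := bounded_fun_le bPhi.
  have [eta eta0 H] := continuous_row_stable (fp_prob X) cPhi hM
    (@measurable_fp_proc X) eps0.
  exists eta => // pi [[piX piY] _ _] bad.
  apply: (H _ _ pi fst (fun i w => fp_proc Y i w.2) measurable_fst piX _ bad) => i.
  exact: (measurableT_comp (@measurable_fp_proc Y i) measurable_snd).
- have [M M0 hM] := bounded_fun_le bphi.
  have [eta eta0 H] := continuous_row_stable (fp_prob X) cphi hM
    (fun i => @measurable_AF_eval X (fs i)) eps0.
  (* By Markov's inequality for the square, an error of this size leaves probability at most [eta]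
     for a deviation of at least [eta], as [H] demands. *)
  have eta3 : 0 < eta ^+ 2 * eta by rewrite mulr_gt0// exprn_gt0.
  have hex i : exists delta : R, 0 < delta /\
      forall pi : probability XY R, Cpl_bc pi ->
    (forall t, pi [set w | (delta <= `|fp_proc X t w.1 - fp_proc Y t w.2|)%R] <= delta%:E)%E ->
    (\int[pi]_w ((AF_eval X (fs i) w.1 - AF_eval Y (fs i) w.2) ^+ 2)%:E <= (eta ^+ 2 * eta)%:E)%E.
    by have [x x0 hx] := ih i _ eta3; exists x.
  have [delta hdelta] := choice hex.
  pose dmin := \big[Num.min/1]_i delta i.
  have dmin_le i : dmin <= delta i by exact: bigmin_le_cond.
  exists dmin.
    by apply/bigmin_gtP; split=> // i _; have [] := hdelta i.
  move=> pi bc bad; have [[piX piY] _ _] := bc.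
  have mV i : measurable_fun setT (fun w : XY => AF_eval Y (fs i) w.2).
    exact: (measurableT_comp (@measurable_AF_eval Y (fs i)) measurable_snd).
  have mU i : measurable_fun setT (fun w : XY => AF_eval X (fs i) w.1).
    exact: (measurableT_comp (@measurable_AF_eval X (fs i)) measurable_fst).
  apply: (H _ _ pi fst (fun i w => AF_eval Y (fs i) w.2) measurable_fst piX mV) => i.
  have [di0 /(_ pi bc) hi] := hdelta i.
  have {}hi : (\int[pi]_w ((AF_eval X (fs i) w.1 - AF_eval Y (fs i) w.2) ^+ 2)%:E <= (eta ^+ 2 * eta)%:E)%E.
    apply: hi => t; apply: le_trans (le_trans (bad t) _); last by rewrite lee_fin.
    have mD : measurable_fun setT (fun w : XY => `|fp_proc X t w.1 - fp_proc Y t w.2|).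
      apply/measurableT_comp => //; apply: measurable_funB.
        exact: (measurableT_comp (@measurable_fp_proc X t) measurable_fst).
      exact: (measurableT_comp (@measurable_fp_proc Y t) measurable_snd).
    have mS r : measurable [set w : XY | (r <= `|fp_proc X t w.1 - fp_proc Y t w.2|)%R].
      have -> : [set w : XY | (r <= `|fp_proc X t w.1 - fp_proc Y t w.2|)%R] =
        (fun w : XY => `|fp_proc X t w.1 - fp_proc Y t w.2|) @^-1` `[r, +oo[%classic.
        by apply/seteqP; split=> w /=; rewrite in_itv/= andbT.
      by rewrite -[X in measurable X]setTI; exact: mD.
    apply: le_measure; rewrite ?inE//.
    by move=> w /=; apply: le_trans; exact: dmin_le.
  have sq0 : 0 < eta ^+ 2 by rewrite exprn_gt0.
  have mh : measurable_fun setT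
      (fun w : XY => (AF_eval X (fs i) w.1 - AF_eval Y (fs i) w.2) ^+ 2).
    by apply: measurable_funX; exact: measurable_funB.
  have := le_trans (ge0_markov pi mh (fun w => sqr_ge0 _) sq0) hi.
  rewrite (EFinM (eta ^+ 2) eta) lee_pmul2l//.
  rewrite (_ : [set x | _] =
    [set x : XY | eta <= `|AF_eval X (fs i) x.1 - AF_eval Y (fs i) x.2|])//.
  have e2 (r : R) : (eta ^+ 2 <= r ^+ 2) = (eta <= `|r|).
    by rewrite -[X in _ <= X]real_normK ?num_real// ler_sqr// nnegrE ltW.
  by apply/seteqP; split=> w /=; rewrite e2.
- have [delta delta0 H] := ih _ eps0.
  exists delta => // pi bc bad; apply: le_trans (H _ bc bad).
  exact: bicausal_AF3_contraction.
Qed.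

End bicausal_stability.

(** * The transport cost and vanishing of the adapted distance *)

Section transport_cost.
Context (R : realType) (N : nat) (p : R).
Hypothesis p0 : 0 < p.
Variables X Y : filtered_process R N.
Local Notation XY := (fp_space X * fp_space Y)%type.

Definition transport_cost (w : XY) : R :=
  \sum_(t < N.+1) `|fp_proc X t w.1 - fp_proc Y t w.2| `^ p.

Lemma measurable_proc_dist t :
  measurable_fun setT (fun w : XY => `|fp_proc X t w.1 - fp_proc Y t w.2|).
Proof.
apply/measurableT_comp => //; apply: measurable_funB.
  exact: (measurableT_comp (@measurable_fp_proc _ _ X t) measurable_fst).
exact: (measurableT_comp (@measurable_fp_proc _ _ Y t) measurable_snd).
Qed.

Lemma measurable_proc_dist_ge t (r : R) :
  measurable [set w : XY | (r <= `|fp_proc X t w.1 - fp_proc Y t w.2|)%R].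
Proof.
have -> : [set w : XY | (r <= `|fp_proc X t w.1 - fp_proc Y t w.2|)%R] =
  (fun w : XY => `|fp_proc X t w.1 - fp_proc Y t w.2|) @^-1` `[r, +oo[%classic.
  by apply/seteqP; split=> w /=; rewrite in_itv/= andbT.
by rewrite -[X in measurable X]setTI; exact: measurable_proc_dist.
Qed.

Lemma measurable_transport_cost : measurable_fun setT transport_cost.
Proof.
apply: measurable_sum => t.
exact: (measurableT_comp (measurable_powR p) (measurable_proc_dist t)).
Qed.

Lemma transport_cost_ge0 w : 0 <= transport_cost w.
Proof. by apply: sumr_ge0 => t _; exact: powR_ge0. Qed.

Lemma transport_cost_bad (pi : probability XY R) (delta : R) t : 0 < delta ->
  (\int[pi]_w (transport_cost w)%:E <= (delta `^ p * delta)%:E)%E ->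
  (pi [set w | (delta <= `|fp_proc X t w.1 - fp_proc Y t w.2|)%R] <= delta%:E)%E.
Proof.
move=> d0 cost; have dp0 : 0 < delta `^ p by exact: powR_gt0.
have := le_trans (ge0_markov pi measurable_transport_cost transport_cost_ge0 dp0) cost.
rewrite (EFinM (delta `^ p) delta) lee_pmul2l//; apply: le_trans.
apply: le_measure; rewrite ?inE//; first exact: measurable_proc_dist_ge.
  have -> : [set w | (delta `^ p <= transport_cost w)%R] =
    transport_cost @^-1` `[delta `^ p, +oo[%classic.
    by apply/seteqP; split=> w /=; rewrite in_itv/= andbT.
  by rewrite -[X in measurable X]setTI; exact: measurable_transport_cost.
move=> w /= dw; rewrite /transport_cost (bigD1 t)//=.
rewrite (@le_trans _ _ (`|fp_proc X t w.1 - fp_proc Y t w.2| `^ p))//.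
  by apply: ge0_ler_powR; rewrite ?nnegrE//; exact: ltW.
by rewrite lerDl; apply: sumr_ge0 => i _; exact: powR_ge0.
Qed.

Lemma AW_pow_ge0 : (0 <= AW_pow X Y p)%E.
Proof.
apply/ereal_infP => _ [pi _ <-]; rewrite unlock.
by apply: integral_ge0 => w _; rewrite lee_fin; exact: transport_cost_ge0.
Qed.

Lemma AW_eq0P : AW X Y p = 0%E <->
  forall e : R, 0 < e -> exists2 pi : probability XY R, Cpl_bc pi &
    (\int[pi]_w (transport_cost w)%:E <= e%:E)%E.
Proof.
split=> [AW0 e e0|H].
  have AWp0 : AW_pow X Y p = 0%E := poweR_eq0_eq0 AW_pow_ge0 AW0.
  have : (AW_pow X Y p < e%:E)%E by rewrite AWp0 lte_fin.
  move=> /ereal_inf_lt[_ [pi bc <-]]; rewrite unlock => /ltW cost.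
  by exists pi.
rewrite /AW (_ : AW_pow X Y p = 0%E) ?poweR0r ?gt_eqF ?invr_gt0//.
apply/eqP; rewrite eq_le AW_pow_ge0 andbT; apply/lee_addgt0Pr => e e0.
have [pi bc cost] := H _ e0; rewrite add0e; apply: le_trans cost.
by apply: ereal_inf_lbound; exists pi => //; rewrite unlock.
Qed.

End transport_cost.

Section AW_to_equiv.
Context (R : realType) (N : nat) (p : R).
Hypothesis p0 : 0 < p.

(** Under a coupling the difference of the two expectations is the integral of one function, so its
    square is at most the squared L2 distance, which stability brings below any [e]. *)
Lemma AW_eq0_adapted_equiv (X Y : filtered_process R N) :
  AW X Y p = 0%E -> adapted_equiv X Y.
Proof.
move=> /(AW_eq0P p0) H f; rewrite unlock.
have iX := AF_eval_integrable f X; have iY := AF_eval_integrable f Y.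
suff : \int[fp_prob X]_w AF_eval X f w = \int[fp_prob Y]_w AF_eval Y f w.
  by move=> e; have := congr1 EFin e; rewrite /Rintegral !fineK//; exact: integrable_fin_num.
apply/eqP; rewrite -subr_eq0 -sqrf_eq0 eq_le sqr_ge0 andbT.
apply/ler_addgt0Pr => e e0; rewrite add0r.
have [delta d0 st] := bicausal_AF_stable X Y f e0.
have [pi bc cost] := H (delta `^ p * delta) (mulr_gt0 (powR_gt0 p d0) d0).
have {}st := st pi bc (fun t => transport_cost_bad p0 t d0 cost).
have [[piX piY] _ _] := bc.
have [M M0 fM] := AF_eval_regular f.
pose c Z w := clamp M (AF_eval Z f w).
have mc Z : measurable_fun setT (c Z) by exact/measurable_clamp/measurable_AF_eval.
have cM Z w : `|c Z w| <= M by exact: normr_clamp_le.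
have aec Z : {ae fp_prob Z, forall w, AF_eval Z f w = c Z w}.
  by apply: ae_eq_clamp; have [] := fM Z.
rewrite (ae_eq_Rintegral _ (measurable_AF_eval f) (mc X) (aec X))//.
rewrite (ae_eq_Rintegral _ (measurable_AF_eval f) (mc Y) (aec Y))//.
have ic Z : (fp_prob Z).-integrable setT (EFin \o c Z).
  exact: (integrable_le_cst _ _ _ (cM Z)).
rewrite -(pullback_Rintegral measurable_fst piX measurableT (ic X)).
rewrite -(pullback_Rintegral measurable_snd piY measurableT (ic Y)).
rewrite !preimage_setT.
have bX : bounded_measurable (fun w : fp_space X * fp_space Y => c X w.1).
  split; last by exists M => w; exact: cM.
  exact: (measurableT_comp (mc X) measurable_fst).
have bY : bounded_measurable (fun w : fp_space X * fp_space Y => c Y w.2).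
  split; last by exists M => w; exact: cM.
  exact: (measurableT_comp (mc Y) measurable_snd).
rewrite -RintegralB//; last 2 first.
- exact: bounded_measurable_integrable.
- exact: bounded_measurable_integrable.
have bXY := bounded_measurableB bX bY.
apply: le_trans (sqr_Rintegral_le pi bXY) _.
rewrite -lee_fin; apply: le_trans st.
rewrite /Rintegral fineK; last first.
  by apply: integrable_fin_num => //; apply: bounded_measurable_integrable => //;
    exact: bounded_measurableM.
rewrite le_eqVlt; apply/orP; left; apply/eqP; apply/esym.
rewrite (@ae_eq_sqr_integral _ _ _ pi _ (fun w => c X w.1 - c Y w.2)).
- by apply: eq_integral => w _; rewrite expr2.
- apply: measurable_funB.
  + exact: (measurableT_comp (@measurable_AF_eval _ _ X f) measurable_fst).
  + exact: (measurableT_comp (@measurable_AF_eval _ _ Y f) measurable_snd).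
- by have [] := bXY.
- have /= h1 := pullback_ae measurable_fst piX (aec X).
  have /= h2 := pullback_ae measurable_snd piY (aec Y).
  by apply: filterS2 h1 h2 => w -> ->.
Qed.

End AW_to_equiv.

(** * Uniform integrability of the cost *)

Section uniform_integrability.
Context (R : realType).

(** The excess over [K] tends to zero pointwise and is dominated by [f]. Working with an excess, not
    with a restriction to a level set, gives the additive bound of [f] by [K] plus its excess. *)
Lemma integral_tail (d : measure_display) (T : measurableType d)
    (P : probability T R) (f : T -> R) (c : R) :
  (forall x, 0 <= f x) -> P.-integrable setT (EFin \o f) -> 0 < c ->
  exists2 K : R, 0 <= K & (\int[P]_x (Num.max (f x - K) 0)%:E <= c%:E)%E.
Proof.
move=> f0 intf c0; have mf := integrable_real_measurable intf.
pose g (n : nat) x : \bar R := (Num.max (f x - n%:R) 0)%:E.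
have mg n : measurable_fun setT (g n).
  by apply/measurable_EFinP/measurable_maxr => //; exact: measurable_funB.
have g0 : {ae P, forall x, setT x -> g ^~ x @ \oo --> (cst 0%E : T -> \bar R) x}.
  apply: aeW => x _; apply: cvg_near_cst; near=> n.
  rewrite /g max_r// subr_le0; near: n.
  exact: nbhs_infty_ger.
have gf : {ae P, forall x n, setT x -> (`|g n x| <= (EFin \o f) x)%E}.
  apply: aeW => x n _; rewrite /g/= lee_fin ger0_norm; last by rewrite le_max lexx orbT.
  by rewrite ge_max f0 andbT lerBlDr lerDl.
have [_ _] := dominated_convergence measurableT mg (measurable_cst _) g0 intf gf.
rewrite integral0 => /(_ _ (@nbhs_open_ereal_lt _ 0 (fun=> c) c0))[n _ Hn].
by exists n%:R => //; apply/ltW; exact: (Hn n (leqnn n)).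
Unshelve. all: by end_near. Qed.

Context (N : nat) (p : R).
Hypothesis p1 : 1 <= p.

Let p0 : 0 < p. Proof. exact: lt_le_trans p1. Qed.

Definition moment (Z : filtered_process R N) (w : fp_space Z) : R :=
  \sum_(t < N.+1) `|fp_proc Z t w| `^ p.

Lemma moment_ge0 (Z : filtered_process R N) (w : fp_space Z) : 0 <= moment w.
Proof. by apply: sumr_ge0 => t _; exact: powR_ge0. Qed.

Lemma measurable_moment (Z : filtered_process R N) :
  measurable_fun setT (@moment Z).
Proof.
apply: measurable_sum => t.
apply: (measurableT_comp (measurable_powR p)); apply: measurableT_comp => //.
exact: measurable_fp_proc.
Qed.

Lemma moment_integrable (Z : filtered_process R N) : in_FP p Z ->
  (fp_prob Z).-integrable setT (EFin \o @moment Z).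
Proof.
rewrite /in_FP unlock => fin; apply/integrableP; split.
  exact/measurable_EFinP/measurable_moment.
under eq_integral => w _ do rewrite /= ger0_norm ?moment_ge0//.
exact: fin.
Qed.

Lemma moment_large (Z : filtered_process R N) (c : R) : in_FP p Z -> 0 < c ->
  exists2 K : R, 1 <= K &
    (fp_prob Z [set w | exists t, (K <= `|fp_proc Z t w|)%R] <= c%:E)%E.
Proof.
move=> hZ c0; have im := moment_integrable hZ.
set I := \int[fp_prob Z]_w moment w.
have I0 : 0 <= I by apply: Rintegral_ge0 => w _; exact: moment_ge0.
(* Since [K] is at least 1 it is at most its power of exponent [p], so being above [I / c] is enough
   for Markov's bound to be at most [c]. *)
pose K := Num.max 1 (I / c).
have K1 : 1 <= K by rewrite le_max lexx.
have Kp : K <= K `^ p.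
  exact: le1r_powR.
exists K => //.
have Kp0 : 0 < K `^ p by rewrite powR_gt0// (lt_le_trans _ K1).
have := ge0_markov (fp_prob Z) (@measurable_moment Z) (@moment_ge0 Z) Kp0.
have -> : (\int[fp_prob Z]_w (moment w)%:E = I%:E)%E.
  by rewrite /I/Rintegral fineK//; exact: integrable_fin_num.
move=> H; have {}H : ((K `^ p)%:E * fp_prob Z [set x | (K `^ p <= moment x)%R] <= (K `^ p)%:E * c%:E)%E.
  apply: le_trans H _; rewrite -EFinM lee_fin.
  rewrite -ler_pdivrMr// (le_trans _ Kp)// /K le_max lexx orbT//.
move: H; rewrite lee_pmul2l//; apply: le_trans.
apply: le_measure; rewrite ?inE.
- rewrite (_ : [set w | _] = \bigcup_(t in [set: 'I_N.+1])
      ((fun w => `|fp_proc Z t w|) @^-1` `[K, +oo[%classic)).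
    apply: fin_bigcup_measurable => // t _.
    rewrite -[X in measurable X]setTI; apply: (measurableT_comp _ (@measurable_fp_proc _ _ Z t)) => //.
  apply/seteqP; split=> [w [t Kt]|w [t _]] /=.
    by exists t => //=; rewrite in_itv/= andbT.
  by rewrite in_itv/= andbT => Kt; exists t.
- have -> : [set x | (K `^ p <= @moment Z x)%R] = @moment Z @^-1` `[K `^ p, +oo[%classic.
    by apply/seteqP; split=> w /=; rewrite in_itv/= andbT.
  by rewrite -[X in measurable X]setTI; exact: measurable_moment.
move=> w [t Kt] /=; rewrite /moment (bigD1 t)//=.
rewrite (@le_trans _ _ (`|fp_proc Z t w| `^ p))//.
  apply: ge0_ler_powR; rewrite ?nnegrE//; first exact: ltW.
  by rewrite (le_trans _ K1).
by rewrite lerDl; apply: sumr_ge0 => i _; exact: powR_ge0.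
Qed.

Lemma powR_dist_le (a b : R) : `|a - b| `^ p <= 2 `^ p * (`|a| `^ p + `|b| `^ p).
Proof.
wlog ab : a b / `|a| <= `|b|.
  move=> H; have [/H//|/ltW/H] := leP `|a| `|b|.
  by rewrite distrC (addrC (`|b| `^ p)).
apply: (@le_trans _ _ ((2 * `|b|) `^ p)).
  apply: ge0_ler_powR; rewrite ?nnegrE ?mulr_ge0//; first exact: ltW.
  by rewrite (le_trans (ler_normB _ _))// mulr_natl mulr2n lerD2r.
by rewrite powRM// ler_wpM2l ?powR_ge0// lerDr powR_ge0.
Qed.

Variables X Y : filtered_process R N.
Local Notation XY := (fp_space X * fp_space Y)%type.

Lemma transport_cost_le_moment (w : XY) :
  transport_cost p w <= 2 `^ p * (moment w.1 + moment w.2).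
Proof.
by rewrite /moment -big_split mulr_sumr; apply: ler_sum => t _; exact: powR_dist_le.
Qed.

Definition bad_set (r : R) : set XY :=
  [set w | exists t, (r <= `|fp_proc X t w.1 - fp_proc Y t w.2|)%R].

Lemma measurable_bad_set r : measurable (bad_set r).
Proof.
rewrite (_ : bad_set r = \bigcup_(t in [set: 'I_N.+1])
    [set w : XY | (r <= `|fp_proc X t w.1 - fp_proc Y t w.2|)%R]).
  by apply: fin_bigcup_measurable => // t _; exact: measurable_proc_dist_ge.
by apply/seteqP; split=> [w [t]|w [t _]] wt; exists t.
Qed.

(** On the bad set the cost is dominated by the two moments, that is by constants plus excesses. The
    excesses depend on one coordinate each, so their integrals are fixed by the marginals and do not
    see [pi]; this gives a [delta] uniform over all couplings. *)
Lemma coupling_cost_small (eps : R) : in_FP p X -> in_FP p Y -> 0 < eps ->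
  exists2 delta : R, 0 < delta & forall pi : probability XY R, coupling pi ->
    (pi (bad_set delta) <= delta%:E)%E ->
    (\int[pi]_w (transport_cost p w)%:E <= eps%:E)%E.
Proof.
move=> hX hY eps0.
have q0 : 0 < 2 `^ p :> R by rewrite powR_gt0.
pose c := eps / (4 * 2 `^ p).
have c0 : 0 < c by rewrite divr_gt0// mulr_gt0.
have [KX KX0 tX] := integral_tail (@moment_ge0 X) (moment_integrable hX) c0.
have [KY KY0 tY] := integral_tail (@moment_ge0 Y) (moment_integrable hY) c0.
(* [B] below integrates to at most [C * delta], hence to at most [eps / 2], and each of the two
   excess terms contributes at most [eps / 4]. *)
pose C := N.+1%:R + 2 `^ p * (KX + KY).
have C1 : 0 < C.
  by rewrite ltr_pwDl ?ltr0n// mulr_ge0 ?addr_ge0// ltW.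
pose delta := Num.min 1 (eps / (2 * C)).
have d0 : 0 < delta by rewrite lt_min ltr01 divr_gt0// mulr_gt0.
have d1 : delta <= 1 by rewrite ge_min lexx.
have dp : delta `^ p <= delta.
  by apply: ge1r_powR => //; apply/andP.
exists delta => // pi [piX piY] bad.
pose TX (w : XY) := Num.max (moment w.1 - KX) 0.
pose TY (w : XY) := Num.max (moment w.2 - KY) 0.
have mTX : measurable_fun setT TX.
  apply: measurable_maxr => //; apply: measurable_funB => //.
  exact: (measurableT_comp (@measurable_moment X) measurable_fst).
have mTY : measurable_fun setT TY.
  apply: measurable_maxr => //; apply: measurable_funB => //.
  exact: (measurableT_comp (@measurable_moment Y) measurable_snd).
have TX0 w : 0 <= TX w by rewrite le_max lexx orbT.
have TY0 w : 0 <= TY w by rewrite le_max lexx orbT.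
pose B w : R := N.+1%:R * delta + 2 `^ p * (KX + KY) * \1_(bad_set delta) w.
have B0 w : 0 <= B w.
  rewrite addr_ge0// ?mulr_ge0// ?addr_ge0// ltW//.
have mB : measurable_fun setT B.
  apply: measurable_funD => //; apply: measurable_funM => //.
  by apply: measurable_indic; exact: measurable_bad_set.
have bound w : transport_cost p w <= 2 `^ p * TX w + (2 `^ p * TY w + B w).
  rewrite /B indicE; have [wb|wb] := boolP (w \in bad_set delta).
    rewrite mulr1 (le_trans (transport_cost_le_moment w))//.
    have hx : moment w.1 <= TX w + KX by rewrite -lerBlDr le_max lexx.
    have hy : moment w.2 <= TY w + KY by rewrite -lerBlDr le_max lexx.
    apply: (@le_trans _ _ (2 `^ p * ((TX w + KX) + (TY w + KY)))).
      by rewrite ler_pM2l// lerD.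
    have : 0 <= N.+1%:R * delta by rewrite mulr_ge0// ltW.
    set q := 2 `^ p; set z := N.+1%:R * delta; lra.
  rewrite mulr0 addr0 addrA ler_wpDl//.
    by rewrite addr_ge0// mulr_ge0// ltW.
  rewrite /transport_cost mulr_natl -[X in _ *+ X](card_ord N.+1) -sumr_const; apply: ler_sum => t _.
  apply: le_trans dp; apply: ge0_ler_powR; rewrite ?nnegrE//; [exact: ltW..|].
  apply/ltW; rewrite ltNge; apply/negP => wt; move/negP: wb; apply.
  by rewrite inE; exists t.
have q0' := ltW q0.
apply: (@le_trans _ _ (\int[pi]_w ((2 `^ p)%:E * (TX w)%:E + ((2 `^ p)%:E * (TY w)%:E + (B w)%:E)))%E).
  apply: ge0_le_integral => //.
  - by move=> w _; rewrite lee_fin; exact: transport_cost_ge0.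
  - by apply/measurable_EFinP; apply: measurable_transport_cost.
  - apply/measurable_EFinP/measurable_funD; first exact: measurable_funM.
    by apply: measurable_funD => //; exact: measurable_funM.
  - by move=> w _; rewrite lee_fin; exact: bound.
rewrite ge0_integralD//; last 4 first.
- by move=> w _; rewrite -EFinM lee_fin mulr_ge0.
- by apply/measurable_EFinP; exact: measurable_funM.
- by move=> w _; rewrite -EFinM -EFinD lee_fin addr_ge0// mulr_ge0.
- by apply/measurable_EFinP/measurable_funD => //; exact: measurable_funM.
rewrite ge0_integralD//; last 4 first.
- by move=> w _; rewrite -EFinM lee_fin mulr_ge0.
- by apply/measurable_EFinP; exact: measurable_funM.
- by move=> w _; rewrite lee_fin.
- exact/measurable_EFinP.
have iT (Z : filtered_process R N) (g : XY -> fp_space Z) K :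
    measurable_fun setT g -> (forall A, measurable A -> pi (g @^-1` A) = fp_prob Z A) ->
    (\int[fp_prob Z]_x (Num.max (moment x - K) 0)%:E <= c%:E)%E ->
    (\int[pi]_w ((2 `^ p)%:E * (Num.max (moment (g w) - K) 0)%:E) <= (eps / 4)%:E)%E.
  move=> mg gP tZ.
  have mm : measurable_fun setT (fun x : fp_space Z => (Num.max (moment x - K) 0)).
    by apply: measurable_maxr => //; apply: measurable_funB => //; exact: measurable_moment.
  rewrite ge0_integralZl//; last 2 first.
  - by apply/measurable_EFinP; exact: (measurableT_comp mm mg).
  - by move=> w _; rewrite lee_fin le_max lexx orbT.
  have := pullback_ge0_integral mg gP measurableT (f := fun x : fp_space Z => (Num.max (moment x - K) 0)%:E).
  rewrite preimage_setT => ->; [|exact/measurable_EFinP|by move=> x; rewrite lee_fin le_max lexx orbT].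
  rewrite (le_trans (lee_wpmul2l _ tZ)) ?lee_fin//.
  have -> : eps / 4 = 2 `^ p * c by rewrite /c; field; rewrite gt_eqF.
  by [].
have iB : (\int[pi]_w (B w)%:E <= (eps / 2)%:E)%E.
  apply: (@le_trans _ _ ((N.+1%:R * delta)%:E + (2 `^ p * (KX + KY))%:E * pi (bad_set delta))%E).
    apply: ge0_integral_le_indic => //.
    - exact: measurable_bad_set.
    - by rewrite mulr_ge0// ltW.
    - by rewrite mulr_ge0// addr_ge0.
    - by move=> w nw; rewrite /B indicE memNset// mulr0 addr0.
    - move=> w; rewrite /B lerD2l; apply: ler_piMr.
        by rewrite mulr_ge0// addr_ge0.
      by rewrite indicE lern1 leq_b1.
  rewrite (le_trans (leeD2l _ (lee_wpmul2l _ bad))) ?lee_fin ?mulr_ge0 ?addr_ge0//.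
  rewrite -mulrDl -/C.
  have : delta <= eps / (2 * C) by rewrite ge_min lexx orbT.
  by rewrite invfM mulrA ler_pdivlMr// mulrC.
have h1 := iT X fst KX measurable_fst piX tX.
have h2 := iT Y snd KY measurable_snd piY tY.
apply: le_trans (leeD h1 (leeD h2 iB)) _.
by rewrite -!EFinD lee_fin; lra.
Qed.

(** If [b] were cut off, its clamped value would be [M] or [- M], at distance at least 1 from [a];
    so nothing is cut off. *)
Lemma clamp_close (M eta a b : R) : eta <= 1 -> `|a| <= M - 1 ->
  `|clamp M a - clamp M b| < eta -> `|a - b| < eta.
Proof.
move=> eta1 aM; rewrite clamp_id; last by lra.
move: aM; rewrite ler_norml => /andP[a1 a2].
rewrite ltr_norml => /andP[]; rewrite ltr_norml /clamp.
case: (leP M b) => h1; case: (leP (- M)) => h2 h3 h4;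
  apply/andP; split; lra.
Qed.

Definition clamped_bad_set (M r : R) : set XY :=
  [set w | exists t, (r <= `|clamp M (fp_proc X t w.1) - clamp M (fp_proc Y t w.2)|)%R].

Lemma measurable_clamped_bad_set M r : measurable (clamped_bad_set M r).
Proof.
rewrite (_ : clamped_bad_set M r = \bigcup_(t in [set: 'I_N.+1])
    ((fun w : XY => `|clamp M (fp_proc X t w.1) - clamp M (fp_proc Y t w.2)|)
      @^-1` `[r, +oo[%classic)).
  apply: fin_bigcup_measurable => // t _.
  rewrite -[X in measurable X]setTI; apply: measurableT_comp => //.
  apply: measurable_funB; apply: measurable_clamp.
    exact: (measurableT_comp (@measurable_fp_proc _ _ X t) measurable_fst).
  exact: (measurableT_comp (@measurable_fp_proc _ _ Y t) measurable_snd).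
apply/seteqP; split=> [w [t wt]|w [t _]] /=.
  by exists t => //=; rewrite in_itv/= andbT.
by rewrite in_itv/= andbT => wt; exists t.
Qed.

(** Labels see a process only through a clamp. Tightness of [X] alone removes it: where its values
    stay below [K], clamping at [K + 1] leaves the margin 1 of [clamp_close]. *)
Lemma AW_eq0_of_clamped : in_FP p X -> in_FP p Y ->
  (forall M eta : R, 1 <= M -> 0 < eta -> exists2 pi : probability XY R,
     Cpl_bc pi & (pi (clamped_bad_set M eta) <= eta%:E)%E) ->
  AW X Y p = 0%E.
Proof.
move=> hX hY H; apply/AW_eq0P => // e e0.
have [delta d0 Hd] := coupling_cost_small hX hY e0.
have d20 : 0 < delta / 2 by rewrite divr_gt0.
have [K K1 PK] := moment_large hX d20.
pose eta := Num.min 1 (delta / 2).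
have eta0 : 0 < eta by rewrite lt_min ltr01.
have M1 : 1 <= K + 1 by rewrite lerDr (le_trans _ K1).
have [pi bc bad] := H _ _ M1 eta0; exists pi => //.
have [cpl _ _] := bc; apply: Hd => //; have [piX _] := cpl.
pose L := [set w | exists t, (K <= `|fp_proc X t w|)%R].
have mL : measurable L.
  rewrite (_ : L = \bigcup_(t in [set: 'I_N.+1])
      ((fun w => `|fp_proc X t w|) @^-1` `[K, +oo[%classic)).
    apply: fin_bigcup_measurable => // t _.
    rewrite -[X in measurable X]setTI.
    by apply: (measurableT_comp _ (@measurable_fp_proc _ _ X t)).
  apply/seteqP; split=> [w [t Kt]|w [t _]] /=.
    by exists t => //=; rewrite in_itv/= andbT.
  by rewrite in_itv/= andbT => Kt; exists t.
have mfL : measurable ((fst : XY -> _) @^-1` L) by apply: measurable_pullback.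
have sub : bad_set delta `<=` clamped_bad_set (K + 1) eta `|` fst @^-1` L.
  move=> w [t dt]; have [Lw|nLw] := pselect (L w.1); [by right|left; exists t].
  rewrite leNgt; apply/negP => close; move: dt; apply/negP; rewrite -ltNge.
  have := clamp_close _ _ close; rewrite addrK.
  move=> /(_ _ _)/lt_le_trans; apply.
  - by rewrite ge_min lexx.
  - by apply/ltW; rewrite ltNge; apply/negP => Kt; apply: nLw; exists t.
  - by rewrite (@le_trans _ _ (delta / 2))// ?ge_min ?lexx ?orbT//; lra.
apply: (@le_trans _ _ (pi (clamped_bad_set (K + 1) eta `|` fst @^-1` L))).
  apply: le_measure; rewrite ?inE//; first exact: measurable_bad_set.
  by apply: measurableU => //; exact: measurable_clamped_bad_set.
rewrite (le_trans (measureU2 _ _ _))//; first exact: measurable_clamped_bad_set.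
rewrite [X in (_ <= X%:E)%E](splitr delta) EFinD leeD//.
  by rewrite (le_trans bad)// lee_fin ge_min lexx orbT.
by move: PK; congr (_ <= _)%E; apply/esym; exact: piX.
Qed.

End uniform_integrability.

(** * Couplings of random labels through a density *)

Section overlap_coupling.
Context (R : realType).
Implicit Types a b : nat -> R.

Definition overlap a b l : R := Num.min (a l) (b l).

(* The maximal coupling of the probability vectors [a] and [b], as a density
   with respect to their product. The value [1] where a marginal vanishes makes
   the marginal identities below hold everywhere and not only almost surely. *)
Definition rho (k : nat) a b (i j : nat) : R :=
  if (a i == 0) || (b j == 0) then 1
  else ((i == j)%:R * overlap a b i +
        (a i - overlap a b i) * (b j - overlap a b j) /
        (1 - \sum_(l < k) overlap a b l)) / (a i * b j).

Lemma overlapC a b l : overlap a b l = overlap b a l.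
Proof. exact: minC. Qed.

Lemma rhoC k a b i j : rho k a b i j = rho k b a j i.
Proof.
have S : \sum_(l < k) overlap b a l = \sum_(l < k) overlap a b l.
  by apply: eq_bigr => l _; exact: overlapC.
rewrite /rho S !(overlapC b a) orbC (eq_sym j) [b j * a i]mulrC.
rewrite [(b j - _) * _]mulrC.
suff -> : (i == j)%:R * overlap a b i = (i == j)%:R * overlap a b j by [].
by case: (i =P j) => [->//|_]; rewrite !mul0r.
Qed.

Section probability_vectors.
Variables (k : nat) (a b : nat -> R).
Hypotheses (a0 : forall i, 0 <= a i) (b0 : forall i, 0 <= b i).
Hypotheses (a1 : \sum_(i < k) a i = 1) (b1 : \sum_(i < k) b i = 1).

Let m := overlap a b.
Let r := 1 - \sum_(l < k) m l.

Let ma i : m i <= a i. Proof. by rewrite /m /overlap ge_min lexx. Qed.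
Let mb i : m i <= b i. Proof. by rewrite /m /overlap ge_min lexx orbT. Qed.
Let m0 i : 0 <= m i. Proof. by rewrite /m /overlap le_min a0 b0. Qed.

Let rE : r = \sum_(l < k) (a l - m l).
Proof. by rewrite /r sumrB a1. Qed.

Let r0 : 0 <= r.
Proof. by rewrite rE; apply: sumr_ge0 => l _; rewrite subr_ge0. Qed.

Lemma rho_ge0 i j : 0 <= rho k a b i j.
Proof.
rewrite /rho; case: ifP => // _; rewrite divr_ge0 ?mulr_ge0// addr_ge0//.
  by rewrite mulr_ge0//; exact: m0.
rewrite divr_ge0//.
by rewrite mulr_ge0// subr_ge0; [exact: ma|exact: mb].
Qed.

(** The diagonal contributes [m i] and the residual product contributes [a i - m i], because the
    residual masses of [b] also sum to [r]. When [r] is zero, [a] equals the overlap and the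
    residual numerator vanishes, so division by zero is harmless. *)
Lemma rho_row (i : 'I_k) : \sum_(j < k) rho k a b i j * b j = 1.
Proof.
have [ai|ai] := eqVneq (a i) 0.
  by rewrite -[RHS]b1; apply: eq_bigr => j _; rewrite /rho ai eqxx mul1r.
transitivity (\sum_(j < k) ((i == j :> nat)%:R * m i +
    (a i - m i) / r * (b j - m j)) / a i).
  apply: eq_bigr => j _; rewrite /rho (negbTE ai)/=.
  have [bj|bj] := eqVneq (b j) 0; last first.
    by rewrite invfM mulrA divfK// mulrAC.
  have mj : m j = 0 by apply/eqP; rewrite eq_le m0 andbT -bj mb.
  rewrite bj mj subrr !mulr0 addr0; have [<-|] := eqVneq (j : nat) i.
    by rewrite mj mulr0 mul0r.
  by move=> _; rewrite !mul0r.
rewrite -mulr_suml big_split/= -mulr_suml -mulr_sumr sumrB b1 -/r.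
rewrite (bigD1 i)//= eqxx big1 ?addr0; last first.
  by move=> j; rewrite -val_eqE/= eq_sym => /negbTE ->.
rewrite mul1r; have [re|re] := eqVneq r 0.
  have : a i - m i = 0.
    move: re; rewrite rE => /eqP; rewrite psumr_eq0 => [/allP/(_ i)|l _].
      by rewrite mem_index_enum => /(_ isT)/= /eqP.
    by rewrite subr_ge0.
  move=> aim; have am : a i = m i by apply/eqP; rewrite -subr_eq0 aim.
  by rewrite aim !mul0r addr0 -am divff.
by rewrite divfK// addrC subrK divff.
Qed.

Lemma rho_diag i : m i <= rho k a b i i * (a i * b i).
Proof.
rewrite /rho; have [ai|ai] := eqVneq (a i) 0.
  by rewrite /= ai mul0r mulr0 -ai ma.
have [bi|bi] := eqVneq (b i) 0; first by rewrite bi /= !mulr0 -bi mb.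
rewrite /= divfK ?mulf_neq0// eqxx mul1r lerDl divr_ge0//.
by rewrite mulr_ge0// subr_ge0; [exact: ma|exact: mb].
Qed.

(** Each term of the overlap loses at most [c] against [a i]. This loss, linear in the number of
    labels, is what dictates the tolerance in [label_systems_exist]. *)
Lemma overlap_sum_ge (c : R) : (forall i, (i < k)%N -> `|a i - b i| <= c) ->
  1 - k%:R * c <= \sum_(i < k) m i.
Proof.
move=> ab.
have -> : k%:R * c = \sum_(i < k) c by rewrite sumr_const card_ord mulr_natl.
rewrite -[X in X - _]a1 lerBlDr -big_split/=; apply: ler_sum => i _.
have := ab i (ltn_ord i); rewrite ler_norml => /andP[? ?].
by rewrite /m /overlap; case: (leP (a i) (b i)) => ?; lra.
Qed.

End probability_vectors.

Lemma measurable_inv : measurable_fun [set: R] (fun x : R => x^-1).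
Proof.
have -> : (fun x : R => x^-1) =
    (fun x : R => if x < 0 then - ((- x) `^ (-1)) else x `^ (-1)).
  apply/funext => x; case: ltP => [x0|x0]; last by rewrite powR_inv1.
  by rewrite powR_inv1 ?oppr_ge0 ?ltW// invrN opprK.
apply: measurable_fun_ifT => //; first exact: measurable_fun_ltr.
apply: measurableT_comp => //.
by apply: (measurableT_comp (measurable_powR (-1))).
Qed.

Lemma measurable_rho (d : measure_display) (T : measurableType d) k
    (a b : nat -> T -> R) i j :
  (forall i, measurable_fun setT (a i)) -> (forall i, measurable_fun setT (b i)) ->
  measurable_fun setT (fun z => rho k (a^~ z) (b^~ z) i j).
Proof.
move=> ma mb; rewrite /rho /overlap.
have mm l : measurable_fun setT (fun z => Num.min (a l z) (b l z)).
  exact: measurable_minr.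
have mV (f : T -> R) : measurable_fun setT f -> measurable_fun setT (fun z => (f z)^-1).
  by move=> mf; exact: (measurableT_comp measurable_inv mf).
apply: measurable_fun_ifT => //.
  by apply: measurable_or; exact: measurable_fun_eqr.
apply: measurable_funM; last by apply: mV; exact: measurable_funM.
apply: measurable_funD; first exact: measurable_funM.
apply: measurable_funM.
  by apply: measurable_funM; exact: measurable_funB.
by apply: mV; apply: measurable_funB => //; exact: measurable_sum.
Qed.

End overlap_coupling.

Section density_probability.
Context (d : measure_display) (T : measurableType d) (R : realType).
Local Open Scope ereal_scope.

Lemma density_probability (mu : {measure set T -> \bar R}) (D : T -> R) :
  measurable_fun setT D -> (forall x, 0 <= D x)%R ->
  \int[mu]_x (D x)%:E = 1 ->
  exists pi : probability T R, forall A, measurable A ->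
    pi A = \int[mu]_(x in A) (D x)%:E.
Proof.
move=> mD D0 D1.
pose m (A : set T) : \bar R := \int[mu]_(x in A) (D x)%:E.
have m0 : m set0 = 0 by rewrite /m integral_set0.
have mge0 A : 0 <= m A by apply: integral_ge0 => x _; rewrite lee_fin.
have msig : semi_sigma_additive m.
  move=> A mA tA mUA; rewrite /m ge0_integral_bigcup//.
  - by apply: is_cvg_ereal_nneg_natsum_cond => n _ _; exact: mge0.
  - by apply/measurable_EFinP; exact: measurable_funTS.
  - by move=> x _; rewrite lee_fin.
pose mM := isMeasure.Build _ T R m m0 mge0 msig.
pose nu : {measure set T -> \bar R} := HB.pack m mM.
pose pM := Measure_isProbability.Build _ T R nu D1.
pose pi : probability T R := HB.pack m mM pM.
by exists pi.
Qed.

End density_probability.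

(** * Soft labellings and integration of the coupling density *)

Section soft_labellings.
Context (R : realType).

(* At time [s] a point [x] carries the random label [i] with probability
   [f s i x]; [kappa s i] is the conditional probability of that label
   given the information [G s] available just before time [s]. *)
Record soft_labelling (d : measure_display) (T : measurableType d)
    (P : probability T R) (k : nat -> nat) (G : nat -> set (set T))
    (f kappa : nat -> nat -> T -> R) : Prop := SoftLabelling {
  sl_sigma : forall s, sigma_algebra setT (G s);
  sl_sub : forall s, G s `<=` measurable;
  sl_mono : forall s, G s `<=` G s.+1;
  sl_lab_ge0 : forall s i x, 0 <= f s i x;
  sl_lab_sum : forall s x, \sum_(i < k s) f s i x = 1;
  sl_lab_meas : forall s i, measurable_wrt (G s.+1) (f s i);
  sl_ker_ge0 : forall s i x, 0 <= kappa s i x;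
  sl_ker_sum : forall s x, \sum_(i < k s) kappa s i x = 1;
  sl_ker_meas : forall s i, measurable_wrt (G s) (kappa s i);
  sl_ker : forall s i A, (i < k s)%N -> G s A ->
    (\int[P]_(x in A) (f s i x)%:E = \int[P]_(x in A) (kappa s i x)%:E)%E }.

(** The labels are integrated out: [c] and [c'] are the label probabilities at the two points, [a]
    and [b] the conditional laws that [rho] couples. The coupling thus lives on the product of the
    original spaces, not on an extension carrying the labels. *)
Definition step_density (k : nat) (c a c' b : nat -> R) : R :=
  \sum_(i < k) \sum_(j < k) c i * c' j * rho k a b i j.

Definition diag_density (k : nat) (c a c' b : nat -> R) : R :=
  \sum_(i < k) c i * c' i * rho k a b i i.

Lemma step_densityC k c a c' b :
  step_density k c a c' b = step_density k c' b c a.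
Proof.
rewrite /step_density exchange_big; apply: eq_bigr => j _.
by apply: eq_bigr => i _; rewrite rhoC (mulrC (c i)).
Qed.

Lemma measurable_step_density (d : measure_display) (T : measurableType d) k
    (c a c' b : nat -> T -> R) :
  (forall i, measurable_fun setT (c i)) -> (forall i, measurable_fun setT (a i)) ->
  (forall i, measurable_fun setT (c' i)) -> (forall i, measurable_fun setT (b i)) ->
  measurable_fun setT (fun z => step_density k (c^~ z) (a^~ z) (c'^~ z) (b^~ z)).
Proof.
move=> mc ma mc' mb; apply: measurable_sum => i; apply: measurable_sum => j.
by apply: measurable_funM; [exact: measurable_funM|exact: measurable_rho].
Qed.

Lemma measurable_diag_density (d : measure_display) (T : measurableType d) k
    (c a c' b : nat -> T -> R) :
  (forall i, measurable_fun setT (c i)) -> (forall i, measurable_fun setT (a i)) ->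
  (forall i, measurable_fun setT (c' i)) -> (forall i, measurable_fun setT (b i)) ->
  measurable_fun setT (fun z => diag_density k (c^~ z) (a^~ z) (c'^~ z) (b^~ z)).
Proof.
move=> mc ma mc' mb; apply: measurable_sum => i.
by apply: measurable_funM; [exact: measurable_funM|exact: measurable_rho].
Qed.

Lemma measurable_bigprod (d : measure_display) (T : measurableType d) n
    (h : nat -> T -> R) : (forall s, (s < n)%N -> measurable_fun setT (h s)) ->
  measurable_fun setT (fun z => \prod_(s < n) h s z).
Proof.
elim: n => [|n ih] mh.
  by under eq_fun do rewrite big_ord0; exact: measurable_cst.
under eq_fun do rewrite big_ord_recr/=; apply: measurable_funM.
  by apply: ih => s sn; apply: mh; exact: ltnW.
exact: mh.
Qed.

Section one_space.
Context (d : measure_display) (T : measurableType d) (P : probability T R).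
Variables (k : nat -> nat) (G : nat -> set (set T)) (f kappa : nat -> nat -> T -> R).
Hypothesis L : soft_labelling P k G f kappa.

Lemma sl_mono_le s t : (s <= t)%N -> G s `<=` G t.
Proof.
elim: t => [|t ih]; first by rewrite leqn0 => /eqP ->.
rewrite leq_eqVlt ltnS => /predU1P[->//|/ih st].
exact: subset_trans st (sl_mono L (s := t)).
Qed.

Lemma sl_lab_measurable s t i : (s < t)%N ->
  measurable_fun [set: g_sigma_algebraType (G t)] (f s i).
Proof.
move=> st; apply/(measurable_wrtP (sl_sigma L t)) => B mB.
by apply: (sl_mono_le st); exact: sl_lab_meas L _ _ _ mB.
Qed.

Lemma sl_ker_measurable s t i : (s <= t)%N ->
  measurable_fun [set: g_sigma_algebraType (G t)] (kappa s i).
Proof.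
move=> st; apply/(measurable_wrtP (sl_sigma L t)) => B mB.
by apply: (sl_mono_le st); exact: sl_ker_meas L _ _ _ mB.
Qed.

Lemma sl_lab_measurableT s i : measurable_fun setT (f s i).
Proof. exact: measurable_wrtW (@sl_sub _ _ _ _ _ _ _ L _) (sl_lab_meas L s i). Qed.

Lemma sl_ker_measurableT s i : measurable_fun setT (kappa s i).
Proof. exact: measurable_wrtW (@sl_sub _ _ _ _ _ _ _ L _) (sl_ker_meas L s i). Qed.

Lemma sl_testing s i (h : T -> R) : (i < k s)%N ->
  measurable_wrt (G s) h -> (forall x, 0 <= h x) ->
  (\int[P]_x (h x * f s i x)%:E = \int[P]_x (h x * kappa s i x)%:E)%E.
Proof.
move=> ik mh h0; apply: (ge0_integral_testing (sl_sigma L s)) => //.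
- exact: sl_sub L s.
- exact: sl_lab_measurableT.
- exact: sl_ker_measurableT.
- exact: sl_lab_ge0 L s i.
- exact: sl_ker_ge0 L s i.
- by move=> A GA; exact: sl_ker L _ _ _ ik GA.
Qed.

Section peel.
Variables (c a : nat -> nat -> R).
Hypotheses (c0 : forall s i, 0 <= c s i) (c1 : forall s, \sum_(i < k s) c s i = 1).
Hypotheses (a0 : forall s i, 0 <= a s i) (a1 : forall s, \sum_(i < k s) a s i = 1).

(** One point of the product is frozen and enters only through the numbers [c] and [a]; the other
    point is integrated. *)
Definition partial_density n (y : T) : R :=
  \prod_(s < n) step_density (k s) (c s) (a s) ((f s)^~ y) ((kappa s)^~ y).

Lemma step_density_ge0 s y :
  0 <= step_density (k s) (c s) (a s) ((f s)^~ y) ((kappa s)^~ y).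
Proof.
apply: sumr_ge0 => i _; apply: sumr_ge0 => j _.
rewrite mulr_ge0 ?mulr_ge0 ?(sl_lab_ge0 L)//.
by apply: rho_ge0 => // l; exact: sl_ker_ge0 L _ _ _.
Qed.

Lemma partial_density_ge0 n y : 0 <= partial_density n y.
Proof. by apply: prodr_ge0 => s _; exact: step_density_ge0. Qed.

Lemma partial_density_measurable n : measurable_wrt (G n) (partial_density n).
Proof.
apply/(measurable_wrtP (sl_sigma L n)).
pose T' : measurableType _ := g_sigma_algebraType (G n).
apply: (@measurable_bigprod _ T' n
  (fun s y => step_density (k s) (c s) (a s) ((f s)^~ y) ((kappa s)^~ y))) => s sn.
apply: (@measurable_step_density _ T' (k s) (fun i _ => c s i) (fun i _ => a s i)
  (f s) (kappa s)) => // i.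
  exact: sl_lab_measurable.
by apply: sl_ker_measurable; exact: ltnW.
Qed.

(** The weight and [rho] are measurable for [G s], so testing replaces the labels [f s j] by their
    kernels [kappa s j]; then [rho_row] and the total mass of [c s] collapse the double sum to 1. *)
Lemma peel_step s (h : T -> R) : measurable_wrt (G s) h -> (forall y, 0 <= h y) ->
  (\int[P]_y (h y * step_density (k s) (c s) (a s) ((f s)^~ y) ((kappa s)^~ y))%:E =
   \int[P]_y (h y)%:E)%E.
Proof.
move=> mh h0; have sG := sl_sigma L s.
pose r i j y := rho (k s) (a s) ((kappa s)^~ y) i j.
have r0 i j y : 0 <= r i j y.
  by apply: rho_ge0 => // l; exact: sl_ker_ge0 L _ _ _.
have mr i j : measurable_wrt (G s) (r i j).
  apply/(measurable_wrtP sG).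
  pose T' : measurableType _ := g_sigma_algebraType (G s).
  apply: (@measurable_rho _ _ T' (k s) (fun i _ => a s i) (kappa s)) => // l.
  exact: sl_ker_measurable.
have mhr i j : measurable_wrt (G s) (fun y => h y * c s i * r i j y).
  apply/(measurable_wrtP sG); apply: measurable_funM; last exact/(measurable_wrtP sG).
  by apply: measurable_funM => //; exact/(measurable_wrtP sG).
have hr0 i j y : 0 <= h y * c s i * r i j y by rewrite mulr_ge0 ?mulr_ge0.
have mT (g : T -> R) : measurable_wrt (G s) g -> measurable_fun setT g.
  exact: measurable_wrtW (@sl_sub _ _ _ _ _ _ _ L s).
have swap (g : nat -> T -> R) : (forall j, measurable_fun setT (g j)) ->
    (forall j y, 0 <= g j y) ->
    (\int[P]_y (\sum_(i < k s) \sum_(j < k s) h y * c s i * r i j y * g j y)%:E =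
     \sum_(i < k s) \sum_(j < k s) \int[P]_y (h y * c s i * r i j y * g j y)%:E)%E.
  move=> mg g0.
  have mhg i j : measurable_fun setT (fun y => (h y * c s i * r i j y * g j y)).
    by apply: measurable_funM => //; exact: mT.
  under eq_integral do rewrite -sumEFin.
  rewrite ge0_integral_sum//; last 2 first.
  - by move=> i; apply/measurable_EFinP/measurable_sum.
  - by move=> i y _; rewrite lee_fin; apply: sumr_ge0 => j _; rewrite mulr_ge0.
  apply: eq_bigr => i _; under eq_integral do rewrite -sumEFin.
  rewrite ge0_integral_sum//; first by move=> j; exact/measurable_EFinP.
  by move=> j y _; rewrite lee_fin mulr_ge0.
transitivity (\int[P]_y (\sum_(i < k s) \sum_(j < k s) h y * c s i * r i j y * f s j y)%:E)%E.
  apply: eq_integral => y _; rewrite /step_density mulr_sumr; congr EFin.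
  apply: eq_bigr => i _; rewrite mulr_sumr; apply: eq_bigr => j _.
  by rewrite -/(r i j y) !mulrA [RHS]mulrAC.
rewrite swap; last 2 first.
- by move=> j; exact: sl_lab_measurableT.
- by move=> j y; exact: sl_lab_ge0 L _ _ _.
transitivity (\int[P]_y (\sum_(i < k s) \sum_(j < k s) h y * c s i * r i j y * kappa s j y)%:E)%E.
  rewrite swap; last 2 first.
  - by move=> j; exact: sl_ker_measurableT.
  - by move=> j y; exact: sl_ker_ge0 L _ _ _.
  apply: eq_bigr => i _; apply: eq_bigr => j _.
  exact: sl_testing.
apply: eq_integral => y _; congr EFin.
under eq_bigr => i _.
  under eq_bigr do rewrite -mulrA.
  rewrite -mulr_sumr rho_row ?mulr1//; last 2 first.
  - by move=> l; exact: sl_ker_ge0 L _ _ _.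
  - exact: sl_ker_sum L _ _.
  over.
by rewrite -mulr_sumr c1 mulr1.
Qed.

(** Factors are removed from the last one on, the earlier ones joining the weight, for which they
    are measurable. *)
Lemma peel n t (h : T -> R) : (t <= n)%N ->
  measurable_wrt (G t) h -> (forall y, 0 <= h y) ->
  (\int[P]_y (h y * partial_density n y)%:E =
   \int[P]_y (h y * partial_density t y)%:E)%E.
Proof.
elim: n => [|n ih]; first by rewrite leqn0 => /eqP ->.
rewrite leq_eqVlt ltnS => /predU1P[->//|tn] mh h0.
rewrite -ih//.
under eq_integral do rewrite /partial_density big_ord_recr/= mulrA.
rewrite peel_step//; last by move=> y; rewrite mulr_ge0//; exact: partial_density_ge0.
have sG := sl_sigma L n; apply/(measurable_wrtP sG); apply: measurable_funM.
  by apply/(measurable_wrtP sG) => B mB; apply: (sl_mono_le tn); exact: mh.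
by apply/(measurable_wrtP sG); exact: partial_density_measurable.
Qed.

Lemma peel1 n : (\int[P]_y (partial_density n y)%:E = 1)%E.
Proof.
have mc : measurable_wrt (G 0) (cst 1 : T -> R).
  by apply/(measurable_wrtP (sl_sigma L 0)); exact: measurable_cst.
have := @peel n 0 (cst 1) (leq0n n) mc (fun=> ler01).
under eq_integral do rewrite /= mul1r.
move=> ->; under eq_integral do rewrite /partial_density big_ord0.
transitivity (\int[P]_y (cst 1 y : \bar R))%E; first by apply: eq_integral => y _; rewrite mulr1.
by rewrite integral_cst// mul1e; exact: probability_setT.
Qed.

Lemma peel_indic n t (B : set T) : (t <= n)%N -> G t B ->
  (\int[P]_(y in B) (partial_density n y)%:E =
   \int[P]_(y in B) (partial_density t y)%:E)%E.
Proof.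
move=> tn GB; have sG := sl_sigma L t.
have e m : (\int[P]_(y in B) (partial_density m y)%:E =
    \int[P]_y (\1_B y * partial_density m y)%:E)%E.
  rewrite integral_mkcond; apply: eq_integral => y _.
  by rewrite patchE indicE; case: ifPn => _; rewrite ?mul1r ?mul0r.
rewrite !e; apply: peel => //; apply/(measurable_wrtP sG).
by apply: measurable_indic; exact/(measurable_wrt_set sG).
Qed.

End peel.
End one_space.
End soft_labellings.

Section product_integrals.
Context (d1 d2 : measure_display) (T1 : measurableType d1) (T2 : measurableType d2).
Context (R : realType) (P : probability T1 R) (Q : probability T2 R).
Implicit Types F : T1 * T2 -> R.
Local Open Scope ereal_scope.

Lemma integral_indicM (d : measure_display) (T : measurableType d)
    (mu : {measure set T -> \bar R}) (A : set T) (f : T -> R) :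
  \int[mu]_(x in A) (f x)%:E = \int[mu]_x (\1_A x * f x)%:E.
Proof.
rewrite integral_mkcond; apply: eq_integral => x _.
by rewrite patchE indicE; case: ifPn => _; rewrite ?mul1r ?mul0r.
Qed.

Lemma indic_rectangle (A : set T1) (B : set T2) x y :
  \1_(fst @^-1` A `&` snd @^-1` B) (x, y) = (\1_A x * \1_B y)%R :> R.
Proof.
rewrite indicI/= !indicE.
by congr (_%:R * _%:R)%R; congr nat_of_bool; apply/idP/idP; rewrite !inE.
Qed.

Lemma integral_rectangle1 F (A : set T1) (B : set T2) :
  measurable_fun setT F -> (forall z, 0 <= F z)%R ->
  measurable A -> measurable B ->
  \int[P \x Q]_(z in fst @^-1` A `&` snd @^-1` B) (F z)%:E =
  \int[P]_(x in A) \int[Q]_(y in B) (F (x, y))%:E.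
Proof.
move=> mF F0 mA mB; rewrite integral_indicM.
have mAB : measurable (fst @^-1` A `&` snd @^-1` B : set (T1 * T2)).
  by apply: measurableI; apply: measurable_pullback.
rewrite fubini_tonelli1//=; last 2 first.
- by apply/measurable_EFinP/measurable_funM => //; exact: measurable_indic.
- by move=> z; rewrite lee_fin mulr_ge0.
rewrite [RHS]integral_mkcond; apply: eq_integral => x _.
rewrite /fubini_F patchE; case: ifPn => xA; last first.
  by apply: integral0_eq => y _; rewrite indic_rectangle !indicE (negbTE xA) !mul0r.
rewrite [RHS]integral_indicM; apply: eq_integral => y _.
by rewrite indic_rectangle [X in (X * _ * _)%R]indicE xA mul1r.
Qed.

Lemma integral_rectangle2 F (A : set T1) (B : set T2) :
  measurable_fun setT F -> (forall z, 0 <= F z)%R ->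
  measurable A -> measurable B ->
  \int[P \x Q]_(z in fst @^-1` A `&` snd @^-1` B) (F z)%:E =
  \int[Q]_(y in B) \int[P]_(x in A) (F (x, y))%:E.
Proof.
move=> mF F0 mA mB; rewrite integral_indicM.
have mAB : measurable (fst @^-1` A `&` snd @^-1` B : set (T1 * T2)).
  by apply: measurableI; apply: measurable_pullback.
rewrite fubini_tonelli2//=; last 2 first.
- by apply/measurable_EFinP/measurable_funM => //; exact: measurable_indic.
- by move=> z; rewrite lee_fin mulr_ge0.
rewrite [RHS]integral_mkcond; apply: eq_integral => y _.
rewrite /fubini_G patchE; case: ifPn => yB; last first.
  by apply: integral0_eq => x _; rewrite indic_rectangle !indicE (negbTE yB) mulr0 mul0r.
rewrite [RHS]integral_indicM; apply: eq_integral => x _.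
by rewrite indic_rectangle [X in (_ * X * _)%R]indicE yB mulr1.
Qed.

End product_integrals.

Section two_labellings.
Context (d1 d2 : measure_display) (T1 : measurableType d1) (T2 : measurableType d2).
Context (R : realType) (P : probability T1 R) (Q : probability T2 R).
Variables (k : nat -> nat) (G : nat -> set (set T1)) (G' : nat -> set (set T2)).
Variables (f kappa : nat -> nat -> T1 -> R) (f' kappa' : nat -> nat -> T2 -> R).
Hypotheses (L : soft_labelling P k G f kappa) (L' : soft_labelling Q k G' f' kappa').

Definition coupling_density n (z : T1 * T2) : R :=
  partial_density k f' kappa' (fun s i => f s i z.1) (fun s i => kappa s i z.1) n z.2.

(** Exchanging the coordinates turns every fact about one marginal or one causal direction into its
    mirror image. *)
Lemma coupling_densityC n x y : coupling_density n (x, y) =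
  partial_density k f kappa (fun s i => f' s i y) (fun s i => kappa' s i y) n x.
Proof. by apply: eq_bigr => s _; exact: step_densityC. Qed.

Lemma coupling_density_ge0 n z : 0 <= coupling_density n z.
Proof.
by apply: (partial_density_ge0 L') => s *; [exact: sl_lab_ge0 L _ _ _|
  exact: sl_ker_ge0 L _ _ _|exact: sl_ker_sum L _ _].
Qed.

Lemma measurable_coupling_density n : measurable_fun setT (coupling_density n).
Proof.
apply: (@measurable_bigprod _ _ _ n (fun s (z : T1 * T2) =>
  step_density (k s) ((f s)^~ z.1) ((kappa s)^~ z.1) ((f' s)^~ z.2) ((kappa' s)^~ z.2))) => s _.
apply: (@measurable_step_density _ _ (T1 * T2)%type (k s)
  (fun i z => f s i z.1) (fun i z => kappa s i z.1)
  (fun i z => f' s i z.2) (fun i z => kappa' s i z.2)) => i.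
- exact: (measurableT_comp (sl_lab_measurableT L s i) measurable_fst).
- exact: (measurableT_comp (sl_ker_measurableT L s i) measurable_fst).
- exact: (measurableT_comp (sl_lab_measurableT L' s i) measurable_snd).
- exact: (measurableT_comp (sl_ker_measurableT L' s i) measurable_snd).
Qed.

Lemma coupling_density_fiber n t (B : set T2) x : (t <= n)%N -> G' t B ->
  (\int[Q]_(y in B) (coupling_density n (x, y))%:E =
   \int[Q]_(y in B) (coupling_density t (x, y))%:E)%E.
Proof.
move=> tn GB; apply: (peel_indic L' (c := fun s i => f s i x)
  (a := fun s i => kappa s i x) _ _ _ _ tn GB) => s *.
- exact: sl_lab_ge0 L _ _ _.
- exact: sl_lab_sum L _ _.
- exact: sl_ker_ge0 L _ _ _.
- exact: sl_ker_sum L _ _.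
Qed.

Lemma coupling_density_mass n x : (\int[Q]_y (coupling_density n (x, y))%:E = 1)%E.
Proof.
apply: (peel1 L' (c := fun s i => f s i x) (a := fun s i => kappa s i x)) => s *.
- exact: sl_lab_ge0 L _ _ _.
- exact: sl_lab_sum L _ _.
- exact: sl_ker_ge0 L _ _ _.
- exact: sl_ker_sum L _ _.
Qed.

(** Here [h] is the conditional probability of [B] given the whole first coordinate. On a set of
    [G' t] the factors from [t] on integrate to 1, and the remaining ones see the first coordinate
    only through [G t]: this is causality. *)
Lemma coupling_density_factor t (B : set T2) : G' t B ->
  exists h : T1 -> R, [/\ measurable_wrt (G t) h, forall x, `|h x| <= 1 &
    forall n x, (t <= n)%N ->
      (\int[Q]_(y in B) (coupling_density n (x, y))%:E = (h x)%:E)%E].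
Proof.
move=> GB; have mB : measurable B := sl_sub L' GB.
pose H x := (\int[Q]_(y in B) (coupling_density t (x, y))%:E)%E.
have mD x : measurable_fun setT (fun y => coupling_density t (x, y)).
  exact: (measurableT_comp (measurable_coupling_density t) (pair1_measurable x)).
have H0 x : (0 <= H x)%E.
  by apply: integral_ge0 => y _; rewrite lee_fin coupling_density_ge0.
have H1 x : (H x <= 1)%E.
  rewrite -(coupling_density_mass t x); apply: ge0_subset_integral => //.
    exact/measurable_EFinP.
  by move=> y _; rewrite lee_fin coupling_density_ge0.
have Hfin x : H x \is a fin_num.
  by rewrite ge0_fin_numE// (le_lt_trans (H1 x))// ltry.
exists (fine \o H); split.
- apply/(measurable_wrtP (sl_sigma L t)).
  (* With the smaller algebra put on the first factor of the product, measurability of the partial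
     integral for [G t] is part of Tonelli's theorem. *)
  pose T1' : measurableType _ := g_sigma_algebraType (G t).
  apply: (measurableT_comp (@fine_measurable _ _ measurableT)).
  have mj : measurable_fun [set: (T1' * T2)%type]
      (fun z => (\1_B z.2 * coupling_density t z)%:E).
    apply/measurable_EFinP/measurable_funM.
      by apply: (measurableT_comp _ measurable_snd); exact: measurable_indic.
    apply: (@measurable_bigprod _ _ (T1' * T2)%type t (fun s z =>
      step_density (k s) ((f s)^~ z.1) ((kappa s)^~ z.1) ((f' s)^~ z.2) ((kappa' s)^~ z.2))) => s st.
    apply: (@measurable_step_density _ _ (T1' * T2)%type (k s)
      (fun i z => f s i z.1) (fun i z => kappa s i z.1)
      (fun i z => f' s i z.2) (fun i z => kappa' s i z.2)) => i.
    + exact: (measurableT_comp (@sl_lab_measurable _ _ _ _ _ _ _ _ L _ t i st) measurable_fst).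
    + exact: (measurableT_comp (@sl_ker_measurable _ _ _ _ _ _ _ _ L _ t i (ltnW st)) measurable_fst).
    + exact: (measurableT_comp (sl_lab_measurableT L' s i) measurable_snd).
    + exact: (measurableT_comp (sl_ker_measurableT L' s i) measurable_snd).
  have mF := @measurable_fun_fubini_tonelli_F _ _ T1' T2 R Q _ mj.
  rewrite (_ : H = fubini_F Q (fun z => (\1_B z.2 * coupling_density t z)%:E)).
    by apply: mF => z; rewrite lee_fin mulr_ge0// coupling_density_ge0.
  by apply/funext => x; rewrite /H integral_indicM.
- move=> x /=; rewrite ger0_norm ?fine_ge0//.
  by rewrite -lee_fin fineK.
- by move=> n x tn; rewrite (coupling_density_fiber x tn GB)/= fineK.
Qed.

End two_labellings.

Section coupling_of_labellings.
Context (d1 d2 : measure_display) (T1 : measurableType d1) (T2 : measurableType d2).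
Context (R : realType) (P : probability T1 R) (Q : probability T2 R).
Variables (k : nat -> nat) (G : nat -> set (set T1)) (G' : nat -> set (set T2)).
Variables (f kappa : nat -> nat -> T1 -> R) (f' kappa' : nat -> nat -> T2 -> R).
Hypotheses (L : soft_labelling P k G f kappa) (L' : soft_labelling Q k G' f' kappa').

Let r s i (z : T1 * T2) := rho (k s) ((kappa s)^~ z.1) ((kappa' s)^~ z.2) i i.

Let r0 s i z : 0 <= r s i z.
Proof.
by apply: rho_ge0 => [l|l|]; [exact: sl_ker_ge0 L _ _ _|
  exact: sl_ker_ge0 L' _ _ _|exact: sl_ker_sum L _ _].
Qed.

Definition diag_step s (z : T1 * T2) : R :=
  diag_density (k s) ((f s)^~ z.1) ((kappa s)^~ z.1) ((f' s)^~ z.2) ((kappa' s)^~ z.2).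

(* The part of the coupling density carried by the event that the two labels
   have agreed at every time before [n]. *)
Definition agreement n z : R := \prod_(s < n) diag_step s z.

Lemma diag_step_ge0 s z : 0 <= diag_step s z.
Proof.
apply: sumr_ge0 => i _; rewrite mulr_ge0 ?mulr_ge0//; last exact: r0.
  exact: sl_lab_ge0 L _ _ _.
exact: sl_lab_ge0 L' _ _ _.
Qed.

Lemma agreement_ge0 n z : 0 <= agreement n z.
Proof. by apply: prodr_ge0 => s _; exact: diag_step_ge0. Qed.

Lemma agreement_le_density n z : agreement n z <= coupling_density k f kappa f' kappa' n z.
Proof.
apply: ler_prod => s _; rewrite diag_step_ge0/=.
apply: ler_sum => i _; rewrite (bigD1 i)//= lerDl; apply: sumr_ge0 => j _.
rewrite mulr_ge0 ?mulr_ge0//; [exact: sl_lab_ge0 L _ _ _|exact: sl_lab_ge0 L' _ _ _|].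
by apply: rho_ge0 => [l|l|]; [exact: sl_ker_ge0 L _ _ _|
  exact: sl_ker_ge0 L' _ _ _|exact: sl_ker_sum L _ _].
Qed.

Lemma measurable_agreement_wrt n : measurable_fun
  [set: (g_sigma_algebraType (G n) * g_sigma_algebraType (G' n))%type] (agreement n).
Proof.
pose T1' : measurableType _ := g_sigma_algebraType (G n).
pose T2' : measurableType _ := g_sigma_algebraType (G' n).
apply: (@measurable_bigprod _ _ (T1' * T2')%type n diag_step) => s sn.
apply: (@measurable_diag_density _ _ (T1' * T2')%type (k s)
  (fun i z => f s i z.1) (fun i z => kappa s i z.1)
  (fun i z => f' s i z.2) (fun i z => kappa' s i z.2)) => i.
- exact: (measurableT_comp (@sl_lab_measurable _ _ _ _ _ _ _ _ L _ n i sn) measurable_fst).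
- exact: (measurableT_comp (@sl_ker_measurable _ _ _ _ _ _ _ _ L _ n i (ltnW sn)) measurable_fst).
- exact: (measurableT_comp (@sl_lab_measurable _ _ _ _ _ _ _ _ L' _ n i sn) measurable_snd).
- exact: (measurableT_comp (@sl_ker_measurable _ _ _ _ _ _ _ _ L' _ n i (ltnW sn)) measurable_snd).
Qed.

Lemma measurable_overlap_ratio_wrt n i : measurable_fun
  [set: (g_sigma_algebraType (G n) * g_sigma_algebraType (G' n))%type] (r n i).
Proof.
pose T1' : measurableType _ := g_sigma_algebraType (G n).
pose T2' : measurableType _ := g_sigma_algebraType (G' n).
apply: (@measurable_rho _ _ (T1' * T2')%type (k n)
  (fun i z => kappa n i z.1) (fun i z => kappa' n i z.2)) => l.
- exact: (measurableT_comp (@sl_ker_measurable _ _ _ _ _ _ _ _ L _ n l (leqnn n)) measurable_fst).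
- exact: (measurableT_comp (@sl_ker_measurable _ _ _ _ _ _ _ _ L' _ n l (leqnn n)) measurable_snd).
Qed.

Let mid1 n : measurable_fun [set: T1] (idfun : T1 -> g_sigma_algebraType (G n)).
Proof.
move=> _ B mB; rewrite setTI; apply: (sl_sub L (s := n)).
exact/(measurable_wrt_set (sl_sigma L n)).
Qed.

Let mid2 n : measurable_fun [set: T2] (idfun : T2 -> g_sigma_algebraType (G' n)).
Proof.
move=> _ B mB; rewrite setTI; apply: (sl_sub L' (s := n)).
exact/(measurable_wrt_set (sl_sigma L' n)).
Qed.

Lemma measurable_wrt_product n (F : T1 * T2 -> R) : measurable_fun
    [set: (g_sigma_algebraType (G n) * g_sigma_algebraType (G' n))%type] F ->
  [/\ measurable_fun setT F,
      forall x, measurable_wrt (G' n) (fun y => F (x, y)) &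
      forall y, measurable_wrt (G n) (fun x => F (x, y))].
Proof.
move=> mF; split.
- pose T1' : measurableType _ := g_sigma_algebraType (G n).
  pose T2' : measurableType _ := g_sigma_algebraType (G' n).
  have m1 : @measurable_fun _ _ (T1 * T2)%type T1' setT (fun z => z.1).
    move=> _ B mB; apply: (@measurable_fst _ _ T1 T2 measurableT B).
    by have := mid1 measurableT mB; rewrite setTI.
  have m2 : @measurable_fun _ _ (T1 * T2)%type T2' setT (fun z => z.2).
    move=> _ B mB; apply: (@measurable_snd _ _ T1 T2 measurableT B).
    by have := mid2 measurableT mB; rewrite setTI.
  have mj := @measurable_fun_pair _ _ _ (T1 * T2)%type T1' T2' _ _ m1 m2.
  have := measurableT_comp mF mj.
  by congr (measurable_fun _ _); apply/funext => -[].
- move=> x; apply/(measurable_wrtP (sl_sigma L' n)).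
  exact: (measurableT_comp mF (@pair1_measurable _ _ (g_sigma_algebraType (G n)) _ x)).
- move=> y; apply/(measurable_wrtP (sl_sigma L n)).
  exact: (measurableT_comp mF (@pair2_measurable _ _ _ (g_sigma_algebraType (G' n)) y)).
Qed.

Local Open Scope ereal_scope.

(** Agreement before [n] is measurable for both pasts, so testing first in the second and then in
    the first coordinate replaces both label probabilities by kernels. By [rho_diag] the diagonal
    terms then dominate the overlap, and its lower bound is needed only where the agreement is
    positive. *)
Lemma agreement_step n (eps : R) :
  (forall z, 0 < agreement n z ->
     1 - eps <= \sum_(i < k n) overlap ((kappa n)^~ z.1) ((kappa' n)^~ z.2) i)%R ->
  (eps <= 1)%R ->
  (1 - eps)%:E * \int[P \x Q]_z (agreement n z)%:E <=
  \int[P \x Q]_z (agreement n.+1 z)%:E.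
Proof.
move=> close eps1.
have [mA mA2 mA1] := measurable_wrt_product (@measurable_agreement_wrt n).
have A0 := agreement_ge0 n.
have mr i := measurable_wrt_product (@measurable_overlap_ratio_wrt n i).
have mf i : measurable_fun setT (fun z : T1 * T2 => f n i z.1).
  exact: (measurableT_comp (sl_lab_measurableT L n i) measurable_fst).
have mf' i : measurable_fun setT (fun z : T1 * T2 => f' n i z.2).
  exact: (measurableT_comp (sl_lab_measurableT L' n i) measurable_snd).
have mk i : measurable_fun setT (fun z : T1 * T2 => kappa n i z.1).
  exact: (measurableT_comp (sl_ker_measurableT L n i) measurable_fst).
have mk' i : measurable_fun setT (fun z : T1 * T2 => kappa' n i z.2).
  exact: (measurableT_comp (sl_ker_measurableT L' n i) measurable_snd).
have f0 i x := sl_lab_ge0 L n i x; have f'0 i x := sl_lab_ge0 L' n i x.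
have k0 i x := sl_ker_ge0 L n i x; have k'0 i x := sl_ker_ge0 L' n i x.
have mAr i : measurable_fun setT (fun z => agreement n z * r n i z)%R.
  by have [m _ _] := mr i; exact: measurable_funM.
have sum_int (F : nat -> T1 * T2 -> R) : (forall i, measurable_fun setT (F i)) ->
    (forall i z, 0 <= F i z)%R ->
    \int[P \x Q]_z (\sum_(i < k n) F i z)%:E =
    \sum_(i < k n) \int[P \x Q]_z (F i z)%:E.
  move=> mF F0; under eq_integral do rewrite -sumEFin.
  rewrite ge0_integral_sum//; first by move=> i; exact/measurable_EFinP.
  by move=> i z _; rewrite lee_fin.
have -> : \int[P \x Q]_z (agreement n.+1 z)%:E =
    \int[P \x Q]_z (\sum_(i < k n) agreement n z * r n i z * f n i z.1 * f' n i z.2)%:E.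
  apply: eq_integral => z _; rewrite /agreement big_ord_recr/= mulr_sumr.
  by congr EFin; apply: eq_bigr => i _; rewrite -/(r n i z); ring.
have -> : \int[P \x Q]_z (\sum_(i < k n) agreement n z * r n i z * f n i z.1 * f' n i z.2)%:E =
    \int[P \x Q]_z (\sum_(i < k n) agreement n z * (r n i z * (kappa n i z.1 * kappa' n i z.2)))%:E.
  rewrite (sum_int (fun i z => agreement n z * r n i z * f n i z.1 * f' n i z.2)%R);
    last 2 first.
  - by move=> i; have [m _ _] := mr i; do 3 apply: measurable_funM => //.
  - by move=> i z; rewrite !mulr_ge0.
  rewrite (sum_int (fun i z =>
    agreement n z * (r n i z * (kappa n i z.1 * kappa' n i z.2)))%R); last 2 first.
  - by move=> i; have [m _ _] := mr i; do 3 apply: measurable_funM => //.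
  - by move=> i z; rewrite !mulr_ge0.
  apply: eq_bigr => i _; have [_ mr2 mr1] := mr i.
  transitivity (\int[P \x Q]_z (agreement n z * r n i z * f n i z.1 * kappa' n i z.2)%:E).
    rewrite !fubini_tonelli1//=; last 4 first.
    - by apply/measurable_EFinP; do 2 apply: measurable_funM => //.
    - by move=> z; rewrite lee_fin !mulr_ge0.
    - by apply/measurable_EFinP; do 2 apply: measurable_funM => //.
    - by move=> z; rewrite lee_fin !mulr_ge0.
    apply: eq_integral => x _; rewrite /fubini_F/=.
    apply: (sl_testing L') => //; last by move=> y; rewrite !mulr_ge0.
    apply/(measurable_wrtP (sl_sigma L' n)); apply: measurable_funM => //.
    by apply: measurable_funM; exact/(measurable_wrtP (sl_sigma L' n)).
  transitivity (\int[P \x Q]_z (agreement n z * r n i z * kappa' n i z.2 * f n i z.1)%:E).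
    by apply: eq_integral => z _; rewrite mulrAC.
  transitivity (\int[P \x Q]_z (agreement n z * r n i z * kappa' n i z.2 * kappa n i z.1)%:E); last first.
    by apply: eq_integral => z _; congr EFin; ring.
  rewrite !fubini_tonelli2//=; last 4 first.
  - by apply/measurable_EFinP; do 2 apply: measurable_funM => //.
  - by move=> z; rewrite lee_fin !mulr_ge0.
  - by apply/measurable_EFinP; do 2 apply: measurable_funM => //.
  - by move=> z; rewrite lee_fin !mulr_ge0.
  apply: eq_integral => y _; rewrite /fubini_G/=.
  apply: (sl_testing L) => //; last by move=> x; rewrite !mulr_ge0.
  apply/(measurable_wrtP (sl_sigma L n)); apply: measurable_funM => //.
  by apply: measurable_funM; exact/(measurable_wrtP (sl_sigma L n)).
rewrite -ge0_integralZl//; last 3 first.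
- exact/measurable_EFinP.
- by move=> z _; rewrite lee_fin.
- by rewrite lee_fin subr_ge0.
apply: ge0_le_integral => //.
- by move=> z _; rewrite -EFinM lee_fin mulr_ge0// subr_ge0.
- by apply/measurable_EFinP; exact: measurable_funM.
- apply/measurable_EFinP/measurable_sum => i; have [m _ _] := mr i.
  by apply: measurable_funM => //; apply: measurable_funM => //; exact: measurable_funM.
move=> z _; rewrite -EFinM lee_fin -mulr_sumr mulrC.
have := A0 z; rewrite le_eqVlt => /predU1P[<-|Az]; first by rewrite !mul0r.
rewrite ler_pM2l// (le_trans (close _ Az))//; apply: ler_sum => i _.
by apply: rho_diag; exact: sl_ker_sum L _ _.
Qed.

(** Bernoulli's inequality makes the loss of successive factors [1 - eps] linear in [n]. *)
Lemma agreement_mass n (eps : R) : (0 <= eps <= 1)%R ->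
  (forall s z, (s < n)%N -> 0 < agreement s z ->
     1 - eps <= \sum_(i < k s) overlap ((kappa s)^~ z.1) ((kappa' s)^~ z.2) i)%R ->
  (1 - n%:R * eps)%:E <= \int[P \x Q]_z (agreement n z)%:E.
Proof.
move=> /andP[e0 e1]; elim: n => [|n ih] close.
  under eq_integral do rewrite /agreement big_ord0.
  have : \int[P]_(x in setT) \int[Q]_(y in setT) (1%:E : \bar R) = 1.
    have -> : \int[Q]_(y in setT) (1%:E : \bar R) = 1.
      by rewrite integral_cst// mul1e; exact: probability_setT.
    by rewrite integral_cst// mul1e; exact: probability_setT.
  have := @integral_rectangle1 _ _ _ _ R P Q (cst 1%R) setT setT.
  rewrite !preimage_setT setTI => -> //.
  by move=> ->; rewrite mul0r subr0.
apply: le_trans (agreement_step _ e1); last by move=> z; exact: close.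
have {}ih := ih (fun s z sn => close s z (ltnW sn)).
apply: (@le_trans _ _ ((1 - eps)%:E * (1 - n%:R * eps)%:E)).
  rewrite -EFinM lee_fin -natr1.
  have : (0 <= n%:R * eps * eps)%R by rewrite !mulr_ge0.
  lra.
by apply: lee_wpmul2l => //; rewrite lee_fin subr_ge0.
Qed.

Lemma soft_coupling n (eps : R) : (0 <= eps <= 1)%R ->
  (forall s z, (s < n)%N -> 0 < agreement s z ->
     1 - eps <= \sum_(i < k s) overlap ((kappa s)^~ z.1) ((kappa' s)^~ z.2) i)%R ->
  exists pi : probability (T1 * T2)%type R,
  [/\ forall A, measurable A -> pi (fst @^-1` A) = P A,
      forall B, measurable B -> pi (snd @^-1` B) = Q B,
      forall t B, (t <= n)%N -> G' t B -> exists h : T1 -> R,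
        [/\ measurable_wrt (G t) h, forall x, (`|h x| <= 1)%R &
         forall A, measurable A ->
           \int[P]_(x in A) (h x)%:E = pi (fst @^-1` A `&` snd @^-1` B)],
      forall t A, (t <= n)%N -> G t A -> exists h : T2 -> R,
        [/\ measurable_wrt (G' t) h, forall y, (`|h y| <= 1)%R &
         forall B, measurable B ->
           \int[Q]_(y in B) (h y)%:E = pi (fst @^-1` A `&` snd @^-1` B)] &
      forall C, measurable C -> (forall z, C z -> agreement n z = 0%R) ->
        pi C <= (n%:R * eps)%:E].
Proof.
move=> e01 close.
pose D := coupling_density k f kappa f' kappa' n.
have mD : measurable_fun setT D := measurable_coupling_density L L' n.
have D0 z : (0 <= D z)%R := coupling_density_ge0 L L' n z.
have rect1 := integral_rectangle1 P Q mD D0.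
have rect2 := integral_rectangle2 P Q mD D0.
have mass1 x : \int[Q]_y (D (x, y))%:E = 1 := coupling_density_mass L L' n x.
have mass2 y : \int[P]_x (D (x, y))%:E = 1.
  have := coupling_density_mass L' L n y.
  by under eq_integral do rewrite (coupling_densityC k f' kappa' f kappa).
have D1 : \int[P \x Q]_z (D z)%:E = 1.
  have := rect1 setT setT measurableT measurableT.
  rewrite !preimage_setT setTI => ->.
  under eq_integral do rewrite mass1.
  by rewrite integral_cst// mul1e; exact: probability_setT.
have [pi piE] := density_probability mD D0 D1.
have piR A B : measurable A -> measurable B ->
    pi (fst @^-1` A `&` snd @^-1` B) =
    \int[P \x Q]_(z in fst @^-1` A `&` snd @^-1` B) (D z)%:E.
  by move=> mA mB; apply: piE; apply: measurableI; exact: measurable_pullback.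
exists pi; split.
- move=> A mA; have := piR A setT mA measurableT.
  rewrite preimage_setT setIT => ->; rewrite -[in LHS](setIT (fst @^-1` A)).
  rewrite -(preimage_setT (snd : T1 * T2 -> T2)) rect1//.
  under eq_integral do rewrite mass1.
  by rewrite integral_cst// mul1e.
- move=> B mB; have := piR setT B measurableT mB.
  rewrite preimage_setT setTI => ->; rewrite -[in LHS](setTI (snd @^-1` B)).
  rewrite -(preimage_setT (fst : T1 * T2 -> T1)) rect2//.
  under eq_integral do rewrite mass2.
  by rewrite integral_cst// mul1e.
- move=> t B tn GB; have [h [mh h1 hE]] := coupling_density_factor L L' GB.
  have mB : measurable B := sl_sub L' GB.
  exists h; split => // A mA; rewrite piR// rect1//.
  by apply: eq_integral => x _; rewrite hE.
- move=> t A tn GA; have [h [mh h1 hE]] := coupling_density_factor L' L GA.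
  have mA : measurable A := sl_sub L GA.
  exists h; split => // B mB; rewrite piR// rect2//.
  apply: eq_integral => y _; rewrite -(hE n)//; apply: eq_integral => x _.
  by rewrite (coupling_densityC k f' kappa' f kappa).
- move=> C mC C0; have mass := agreement_mass e01 close.
  have [mA _ _] := measurable_wrt_product (@measurable_agreement_wrt n).
  (* The agreement vanishes on [C] and lies below the density elsewhere, so both masses fit into the
     total mass of the density. *)
  have : pi C + \int[P \x Q]_z (agreement n z)%:E <= 1.
    rewrite piE// integral_indicM -ge0_integralD//; last 4 first.
    + by move=> z _; rewrite lee_fin mulr_ge0.
    + by apply/measurable_EFinP/measurable_funM => //; exact: measurable_indic.
    + by move=> z _; rewrite lee_fin agreement_ge0.
    + exact/measurable_EFinP.
    rewrite -D1; apply: ge0_le_integral => //.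
    + by move=> z _; rewrite adde_ge0// lee_fin ?mulr_ge0// agreement_ge0.
    + apply: emeasurable_funD; apply/measurable_EFinP => //.
      by apply: measurable_funM => //; exact: measurable_indic.
    + exact/measurable_EFinP.
    move=> z _; rewrite -EFinD lee_fin indicE.
    have [zC|zC] := boolP (z \in C).
      by rewrite mul1r C0 ?addr0//; rewrite inE in zC.
    by rewrite mul0r add0r; exact: agreement_le_density.
  move=> H; have {}H := le_trans (leeD2l _ mass) H.
  have fpi : pi C \is a fin_num by exact: fin_num_measure.
  move: H; rewrite -(fineK fpi) -EFinD !lee_fin; lra.
Qed.

End coupling_of_labellings.

(** * Labels built from adapted functions *)

Section continuity.
Context (R : realType) (T : topologicalType).
Implicit Types f g : T -> R.

Lemma fun_continuous_cst (c : R) : continuous (fun _ : T => c).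
Proof. by move=> v; exact: cvg_cst. Qed.

Lemma fun_continuousD f g : continuous f -> continuous g ->
  continuous (fun v => f v + g v).
Proof. by move=> cf cg v; exact: (cvgD (cf v) (cg v)). Qed.

Lemma fun_continuousB f g : continuous f -> continuous g ->
  continuous (fun v => f v - g v).
Proof. by move=> cf cg v; exact: (cvgB (cf v) (cg v)). Qed.

Lemma fun_continuousM f g : continuous f -> continuous g ->
  continuous (fun v => f v * g v).
Proof. by move=> cf cg v; exact: (cvgM (cf v) (cg v)). Qed.

Lemma fun_continuousV f : continuous f -> (forall v, f v != 0) ->
  continuous (fun v => (f v)^-1).
Proof. by move=> cf f0 v; exact: (cvgV (f0 v) (cf v)). Qed.

Lemma fun_continuous_max f g : continuous f -> continuous g ->
  continuous (fun v => Num.max (f v) (g v)).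
Proof. by move=> cf cg v; exact: (continuous_max (cf v) (cg v)). Qed.

Lemma fun_continuous_min f g : continuous f -> continuous g ->
  continuous (fun v => Num.min (f v) (g v)).
Proof. by move=> cf cg v; exact: (continuous_min (cf v) (cg v)). Qed.

Lemma fun_continuous_sum (I : Type) (r : seq I) (F : I -> T -> R) :
  (forall i, continuous (F i)) -> continuous (fun v => \sum_(i <- r) F i v).
Proof.
move=> cF; elim: r => [|a r ih].
  by under eq_fun do rewrite big_nil; exact: fun_continuous_cst.
by under eq_fun do rewrite big_cons; exact: fun_continuousD.
Qed.

Lemma fun_continuous_prod (I : Type) (r : seq I) (F : I -> T -> R) :
  (forall i, continuous (F i)) -> continuous (fun v => \prod_(i <- r) F i v).
Proof.
move=> cF; elim: r => [|a r ih].
  by under eq_fun do rewrite big_nil; exact: fun_continuous_cst.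
by under eq_fun do rewrite big_cons; exact: fun_continuousM.
Qed.

Lemma fun_continuous_clamp (M : R) f : continuous f -> continuous (fun v => clamp M (f v)).
Proof.
move=> cf; apply: fun_continuous_max; first exact: fun_continuous_cst.
by apply: fun_continuous_min => //; exact: fun_continuous_cst.
Qed.

End continuity.

Section tents.
Context (R : realType).
Variables (M c : R).
Hypotheses (M0 : 0 <= M) (c0 : 0 < c).

(* The differences of consecutive ramps [ramp g], [ramp g.+1] form a partition
   of unity of [-M, M], each supported on an interval of length at most [2c]. *)
Definition ramp (g : nat) (x : R) : R :=
  Num.max 0 (Num.min 1 ((clamp M x + M) / c - g%:R + 1)).

Definition tent g x := ramp g x - ramp g.+1 x.

(** Large enough for the ramp of index [tent_count.+1] to vanish everywhere, so that the telescoping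
    sum of tents is exactly 1. *)
Definition tent_count : nat := (Num.truncn (2 * M / c)).+1.

Let u x := (clamp M x + M) / c.

Let u_ge0 x : 0 <= u x.
Proof.
rewrite divr_ge0 ?(ltW c0)//.
by have := normr_clamp_le x M0; rewrite ler_norml => /andP[]; lra.
Qed.

Let u_lt x : u x < tent_count%:R.
Proof.
apply: le_lt_trans (truncnS_gt (2 * M / c)).
rewrite ler_pM2r ?invr_gt0//.
by have := normr_clamp_le x M0; rewrite ler_norml => /andP[]; lra.
Qed.

Let ramp_ge0 g x : 0 <= ramp g x. Proof. by rewrite le_max lexx. Qed.

Let ramp_le1 g x : ramp g x <= 1.
Proof. by rewrite ge_max ler01 ge_min lexx. Qed.

Lemma tent_ge0 g x : 0 <= tent g x.
Proof.
rewrite /tent subr_ge0 /ramp ge_max !le_max lexx/=; apply/orP; right.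
rewrite le_min ge_min lexx/= ge_min; apply/orP; right.
by rewrite lerD2r lerD2l lerN2 ler_nat.
Qed.

Lemma tent_le1 g x : tent g x <= 1.
Proof.
by rewrite /tent lerBlDr (le_trans (ramp_le1 g x))// lerDl.
Qed.

Lemma tent_sum x : \sum_(g < tent_count.+1) tent g x = 1.
Proof.
have -> n : \sum_(g < n) tent g x = ramp 0 x - ramp n x.
  elim: n => [|n ih]; first by rewrite big_ord0 subrr.
  by rewrite big_ord_recr/= ih /tent; lra.
have u0 := u_ge0 x; have u1 := u_lt x.
have -> : ramp 0 x = 1 by rewrite /ramp -/(u x) subr0 min_l ?max_r//; lra.
have -> : ramp tent_count.+1 x = 0; last by rewrite subr0.
by rewrite /ramp max_l// ge_min -natr1 -/(u x); apply/orP; right; lra.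
Qed.

Lemma tent_close g x y : 0 < tent g x -> 0 < tent g y ->
  `|clamp M x - clamp M y| <= 2 * c.
Proof.
have tentP z : 0 < tent g z -> `|u z - g%:R| <= 1.
  move=> tz; have h1 : 0 < ramp g z.
    by rewrite (lt_le_trans tz)// /tent lerBlDr lerDl.
  have h2 : ramp g.+1 z < 1.
    by have := ramp_le1 g z; move: tz; rewrite /tent; lra.
  move: h1; rewrite /ramp lt_max ltxx/= lt_min => /andP[_ h1].
  move: h2; rewrite /ramp gt_max gt_min ltxx/= -natr1 => /andP[_ h2].
  rewrite -/(u z) in h1 h2; rewrite ler_norml; apply/andP; split; lra.
move=> /tentP hx /tentP hy.
have -> : clamp M x - clamp M y = (u x - u y) * c.
  by rewrite /u -mulrBl divfK ?gt_eqF//; lra.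
rewrite normrM (gtr0_norm c0) ler_pM2r//.
move: hx hy; rewrite !ler_norml => /andP[? ?] /andP[? ?]; apply/andP; split; lra.
Qed.

Lemma continuous_tent (T : topologicalType) g (f : T -> R) :
  continuous f -> continuous (fun v => tent g (f v)).
Proof.
move=> cf; have cr h : continuous (fun v => ramp h (f v)).
  apply: fun_continuous_max; first exact: fun_continuous_cst.
  apply: fun_continuous_min; first exact: fun_continuous_cst.
  apply: fun_continuousD; last exact: fun_continuous_cst.
  apply: fun_continuousB; last exact: fun_continuous_cst.
  apply: fun_continuousM; last exact: fun_continuous_cst.
  apply: fun_continuousD; last exact: fun_continuous_cst.
  exact: fun_continuous_clamp.
exact: fun_continuousB.
Qed.

End tents.

Section normalisation.
Context (R : realType).
Variable (K : nat).
Implicit Types x : nat -> R.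

(* A continuous retraction onto the probability vectors of length [K]. *)
Definition possum x : R := \sum_(j < K) Num.max 0 (x j).

Definition nrm x (i : nat) : R :=
  (Num.max 0 (x i) + Num.max 0 (1 - possum x) / K%:R) / Num.max 1 (possum x).

Let max1 x : 0 < Num.max 1 (possum x).
Proof. by rewrite lt_max ltr01. Qed.

Lemma nrm_ge0 x i : 0 <= nrm x i.
Proof.
by rewrite divr_ge0 ?(ltW (max1 x))// addr_ge0 ?divr_ge0// le_max lexx.
Qed.

(** At most one correction is active: a deficit of mass is spread uniformly over the [K] entries, an
    excess is divided out. *)
Lemma nrm_sum x : (0 < K)%N -> \sum_(i < K) nrm x i = 1.
Proof.
move=> K0; have KR : K%:R != 0 :> R by rewrite pnatr_eq0 -lt0n.
rewrite -mulr_suml big_split/= sumr_const card_ord -/(possum x).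
rewrite -mulrnAl -mulr_natr mulfK//.
have [h|h] := leP 1 (possum x).
  by rewrite max_l ?subr_le0// addr0 divff// gt_eqF// (lt_le_trans ltr01).
by rewrite max_r ?subr_ge0 ?(ltW h)// divr1 addrC subrK.
Qed.

Lemma nrm_id x i : (i < K)%N -> (forall j, (j < K)%N -> 0 <= x j) ->
  \sum_(j < K) x j = 1 -> nrm x i = x i.
Proof.
move=> iK x0 x1; have S : possum x = 1.
  by rewrite -x1; apply: eq_bigr => j _; rewrite max_r ?x0.
by rewrite /nrm S subrr !maxxx mul0r addr0 divr1 max_r ?x0.
Qed.

Lemma nrm_bounded x i : (0 < K)%N -> (i < K)%N -> `|nrm x i| <= 1.
Proof.
move=> K0 iK; rewrite ger0_norm ?nrm_ge0// -(nrm_sum x K0).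
by rewrite (bigD1 (Ordinal iK))//= lerDl; apply: sumr_ge0 => j _; exact: nrm_ge0.
Qed.

Lemma continuous_nrm (T : topologicalType) (f : nat -> T -> R) i :
  (forall j, (j < K)%N -> continuous (f j)) -> (i < K)%N ->
  continuous (fun v => nrm (f^~ v) i).
Proof.
move=> cf iK.
have cs : continuous (fun v => possum (f^~ v)).
  apply: fun_continuous_sum => j; apply: fun_continuous_max; first exact: fun_continuous_cst.
  exact: cf.
apply: fun_continuousM; last first.
  apply: fun_continuousV; last by move=> v; rewrite gt_eqF.
  by apply: fun_continuous_max => //; exact: fun_continuous_cst.
apply: fun_continuousD.
  by apply: fun_continuous_max; [exact: fun_continuous_cst|exact: cf].
apply: fun_continuousM; last exact: fun_continuous_cst.
apply: fun_continuous_max; first exact: fun_continuous_cst.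
by apply: fun_continuousB => //; exact: fun_continuous_cst.
Qed.

End normalisation.

Section adapted_labels.
Context (R : realType) (N : nat).
Implicit Types (Z : filtered_process R N) (g f : nat -> AF R N).

(** The conditional law of the next label, normalised to be a probability vector at every [w]
    whatever versions were chosen. The normalisation is continuous, so the result is again an
    adapted function. *)
Definition nker Z (t : 'I_N.+1) (K : nat) g (j : nat) (w : fp_space Z) : R :=
  nrm K (fun l => AF_eval Z (AF3 t (g l)) w) j.

(** Quantifying over all processes lets one formal family of adapted functions label [X] and [Y]
    alike. *)
Record label_system (t : 'I_N.+1) (K : nat) f : Prop := LabelSystem {
  ls_pos : (0 < K)%N;
  ls_ge0 : forall Z i w, 0 <= AF_eval Z (f i) w;
  ls_sum : forall Z w, \sum_(i < K) AF_eval Z (f i) w = 1;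
  ls_meas : forall Z i, measurable_wrt (fp_filt Z t) (AF_eval Z (f i)) }.

(* A common label at time [t] locates both the value of the process and the
   conditional law of the next label up to [r]. *)
Definition labels_locate (M r : R) (t : 'I_N.+1) (K : nat) g (K' : nat) f :=
  forall Z Z' i w w', (i < K')%N ->
    0 < AF_eval Z (f i) w -> 0 < AF_eval Z' (f i) w' ->
    `|clamp M (fp_proc Z t w) - clamp M (fp_proc Z' t w')| <= r /\
    forall j, (j < K)%N -> `|nker t K g j w - nker t K g j w'| <= r.

Lemma le_bounded_fun n (phi : 'rV[R]_n -> R) (M : R) :
  (forall v, `|phi v| <= M) -> bounded_fun phi.
Proof.
move=> phiM; exists M; split; first exact: num_real.
by move=> y My x _ /=; exact: le_trans (phiM x) (ltW My).
Qed.

Section one_step.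
Variables (t : 'I_N.+1) (K : nat) (g : nat -> AF R N) (M c : R).
Hypotheses (K0 : (0 < K)%N) (M1 : 1 <= M) (c0 : 0 < c).

Let M0 : 0 <= M. Proof. exact: le_trans M1. Qed.

(** Index [K] holds the clamped value, the indices below it the conditional law of the next label.
    As [M] is at least 1 all features lie in [-M, M], and one family of tents serves them all. *)
Definition feature Z (j : nat) (w : fp_space Z) : R :=
  if (j < K)%N then nker t K g j w else clamp M (fp_proc Z t w).

Lemma feature_AF (j : nat) : exists a : AF R N, forall Z,
  AF_eval Z a = feature j /\ measurable_wrt (fp_filt Z t) (AF_eval Z a).
Proof.
rewrite /feature; have [jK|jK] := ltnP j K.
  pose phi (v : 'rV[R]_K.+1) := nrm K (fun l => v ord0 (inord l)) j.
  have cphi : continuous phi.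
    apply: (@continuous_nrm R K _ (fun l (v : 'rV[R]_K.+1) => v ord0 (inord l))) => // l _.
    exact: coord_continuous.
  have bphi : bounded_fun phi.
    by apply: (@le_bounded_fun _ _ 1) => v; exact: nrm_bounded.
  exists (AF2 cphi bphi (fun l : 'I_K.+1 => AF3 t (g l))) => Z; split.
    apply/funext => w /=; rewrite /phi /nker /nrm /possum !mxE.
    under eq_bigr do rewrite !mxE inordK ?ltnS// ?(ltnW (ltn_ord _))//.
    by rewrite inordK// ltnS ltnW.
  apply: measurable_wrt_row => // l.
  by have [] := AF_eval_cond_exp (g l) t Z.
pose phi (v : 'rV[R]_N.+1) := clamp M (v ord0 t).
have cphi : continuous phi by apply: fun_continuous_clamp; exact: coord_continuous.
have bphi : bounded_fun phi.
  by apply: (@le_bounded_fun _ _ M) => v; exact: normr_clamp_le.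
exists (AF1 cphi bphi) => Z.
have e : AF_eval Z (AF1 cphi bphi) = (fun w => clamp M (fp_proc Z t w)).
  by apply/funext => w /=; rewrite /phi mxE.
split => //; rewrite e; apply: measurable_wrt_clamp.
exact: fp_adapted.
Qed.

Let n := tent_count M c.
(** A label chooses one tent for each feature; expanding the product of the partitions of unity over
    these choices shows that the label probabilities sum to 1. *)
Let H := {ffun 'I_K.+1 -> 'I_n.+1}.
Let h0 : H := [ffun=> ord0].
Let pick (i : nat) : H := nth h0 (enum H) i.

Lemma label_AF (i : nat) : exists a : AF R N, forall Z,
  (forall w, AF_eval Z a w = \prod_(j < K.+1) tent M c (pick i j) (feature j w)) /\
  measurable_wrt (fp_filt Z t) (AF_eval Z a).
Proof.
have [a aP] := choice feature_AF.
pose phi (v : 'rV[R]_K.+1) := \prod_(j < K.+1) tent M c (pick i j) (v ord0 j).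
have cphi : continuous phi.
  apply: fun_continuous_prod => j; apply: continuous_tent; exact: coord_continuous.
have bphi : bounded_fun phi.
  apply: (@le_bounded_fun _ _ 1) => v.
  rewrite ger0_norm; last by apply: prodr_ge0 => j _; exact: tent_ge0.
  by apply: prodr_ile1 => j _; rewrite tent_ge0//= tent_le1.
exists (AF2 cphi bphi (fun j : 'I_K.+1 => a j)) => Z; split.
  by move=> w /=; apply: eq_bigr => j _; rewrite mxE (aP j Z).1.
by apply: measurable_wrt_row => // j; exact: (aP j Z).2.
Qed.

Lemma label_system_exists : exists (K' : nat) f,
  label_system t K' f /\ labels_locate M (2 * c) t K g K' f.
Proof.
have [f fP] := choice label_AF.
have fE Z i w : AF_eval Z (f i) w = \prod_(j < K.+1) tent M c (pick i j) (feature j w).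
  exact: (fP i Z).1.
exists (size (enum H)), f; split.
  split.
  - by rewrite -cardE; apply/card_gt0P; exists h0.
  - by move=> Z i w; rewrite fE; apply: prodr_ge0 => j _; exact: tent_ge0.
  - move=> Z w; transitivity (\sum_(h : H) \prod_(j < K.+1) tent M c (h j) (feature j w)).
      transitivity (\sum_(h <- enum H) \prod_(j < K.+1) tent M c (h j) (feature j w)).
        by rewrite (big_nth h0) big_mkord; apply: eq_bigr => i _; exact: fE.
      by rewrite big_enum.
    rewrite -(bigA_distr_bigA (fun (j : 'I_K.+1) (l : 'I_n.+1) => tent M c l (feature j w))).
    by apply: big1 => j _; exact: tent_sum.
  - by move=> Z i; exact: (fP i Z).2.
move=> Z Z' i w w' _; rewrite !fE => fw fw'.
have pos (y : 'I_K.+1 -> R) : 0 < \prod_(j < K.+1) tent M c (pick i j) (y j) ->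
    forall j, 0 < tent M c (pick i j) (y j).
  move=> + j; rewrite (bigD1 j)//= => yj.
  rewrite lt_neqAle tent_ge0// andbT; apply/eqP => e.
  by move: yj; rewrite -e mul0r ltxx.
have close j := tent_close c0 (pos _ fw j) (pos _ fw' j).
split.
  have := close ord_max; rewrite /feature/= ltnn.
  by rewrite !(@clamp_id _ M (clamp _ _))// normr_clamp_le.
move=> j jK; have := close (inord j).
rewrite /feature inordK ?jK; last by rewrite ltnS ltnW.
by rewrite !clamp_id// (le_trans (nrm_bounded _ K0 jK)).
Qed.

End one_step.

(** Labellings are indexed by all natural numbers, so the time stays at its last value after [N]. *)
Definition time (s : nat) : 'I_N.+1 := inord (minn s N).

Lemma time_ord (t : 'I_N.+1) : time t = t.
Proof.
by apply: val_inj; rewrite /= inordK ?ltnS ?geq_minr//; apply/minn_idPl; rewrite -ltnS.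
Qed.

Lemma time_le s t : (s <= t)%N -> (time s <= time t)%N.
Proof.
by move=> st; rewrite /time !inordK ?ltnS ?geq_minr// leq_min geq_minr andbT geq_min st.
Qed.

Lemma label_systems_exist (M eps : R) : 1 <= M -> 0 < eps ->
  exists (k : nat -> nat) (f : nat -> nat -> AF R N),
    (forall s, label_system (time s) (k s) (f s)) /\
    forall s, (s <= N)%N ->
      labels_locate M (eps / (k s.+1).+1%:R) (time s) (k s.+1) (f s.+1) (k s) (f s).
Proof.
move=> M1 eps0.
(* [r] counts, backwards from the last time, the times whose labels already locate. The recursion
   starts from a single sure label everywhere, which also plays the next label after time [N]. *)
suff H r : (r <= N.+1)%N -> exists (k : nat -> nat) (f : nat -> nat -> AF R N),
    (forall s, label_system (time s) (k s) (f s)) /\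
    forall s, (N.+1 - r <= s <= N)%N ->
      labels_locate M (eps / (k s.+1).+1%:R) (time s) (k s.+1) (f s.+1) (k s) (f s).
  have [k [f [kf1 kf2]]] := H _ (leqnn N.+1).
  by exists k, f; split => // s sN; apply: kf2; rewrite subnn.
elim: r => [_|r ih rN].
  have cst_AF (c : R) : exists a : AF R N, forall Z, AF_eval Z a = cst c.
    have cc : continuous (fun _ : 'rV[R]_N.+1 => c) by exact: fun_continuous_cst.
    have bc : bounded_fun (fun _ : 'rV[R]_N.+1 => c) by exact: (@le_bounded_fun _ _ `|c|).
    by exists (AF1 cc bc).
  have [a aP] := cst_AF 1.
  exists (fun=> 1%N), (fun _ _ => a); split; last first.
    by move=> s; rewrite subn0 => /andP[/leq_trans h /h]; rewrite ltnn.
  move=> s; split => //.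
  - by move=> Z i w; rewrite aP.
  - by move=> Z w; rewrite big_ord1 aP.
  - move=> Z i; rewrite aP; apply/(measurable_wrtP (@fp_filt_sigma _ _ Z _)).
    exact: measurable_cst.
have [k [f [sys loc]]] := ih (ltnW rN).
pose s0 := (N - r)%N.
(* Labels built from tents of mesh [c] locate up to [2 * c]. *)
pose c := eps / (k s0.+1).+1%:R / 2.
have c0 : 0 < c by rewrite !divr_gt0.
have [K' [f' [sys' loc']]] :=
  label_system_exists (time s0) (f s0.+1) (ls_pos (sys s0.+1)) M1 c0.
pose k2 s := if s == s0 then K' else k s.
pose f2 s := if s == s0 then f' else f s.
exists k2, f2; split.
  by move=> s; rewrite /k2 /f2; case: eqP => [->|_].
move=> s /andP[s1 s2]; rewrite /k2 /f2.
have s0s : (s0 <= s)%N by rewrite /s0 -subSS.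
rewrite (gtn_eqF (_ : (s0 < s.+1)%N))//.
case: (eqVneq s s0) => [->|ss0]; first by rewrite mulrCA divff ?mulr1 in loc'.
apply: loc; rewrite s2 andbT subSn; last by rewrite -ltnS.
by rewrite ltn_neqAle eq_sym ss0.
Qed.

End adapted_labels.

(** * Processes as soft labellings *)

Section process_labelling.
Context (R : realType) (N : nat).
Variables (k : nat -> nat) (f : nat -> nat -> AF R N).
Hypothesis sys : forall s, label_system (@time N s) (k s) (f s).
Implicit Types Z : filtered_process R N.

(** Shifted by one: position [s.+1] holds the filtration at time [s], and position 0 the trivial
    sigma-algebra, so that the kernel of the first label is its expectation. *)
Definition past Z (s : nat) : set (set (fp_space Z)) :=
  if s is s'.+1 then fp_filt Z (time N s') else [set A | A = set0 \/ A = setT].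

Definition label_kernel Z (s i : nat) (w : fp_space Z) : R :=
  if s is s'.+1 then nker (time N s') (k s) (f s) i w
  else \int[fp_prob Z]_x AF_eval Z (f 0 i) x.

Arguments label_kernel : clear implicits.
Arguments past : clear implicits.

Lemma sigma_algebra_trivial (T : Type) :
  sigma_algebra setT [set A : set T | A = set0 \/ A = setT].
Proof.
split; first by left.
- by move=> A [->|->]; [right; rewrite setD0|left; rewrite setDv].
- move=> F HF; have [[n Fn]|/forallNP nF] := pselect (exists n, F n = setT).
    by right; apply/seteqP; split=> // x _; exists n => //; rewrite Fn.
  left; apply/seteqP; split=> // x [n _].
  by have [->|/(nF n)] := HF n.
Qed.

Lemma label_kernel_ge0 Z s i w : 0 <= label_kernel Z s i w.
Proof.
case: s => [|s]; last exact: nrm_ge0.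
by apply: Rintegral_ge0 => x _; exact: (ls_ge0 (sys 0) i x).
Qed.

Let label_int Z s i (A : set (fp_space Z)) : measurable A ->
  (fp_prob Z).-integrable A (EFin \o AF_eval Z (f s i)).
Proof.
move=> mA; apply: integrableS (AF_eval_integrable (f s i) Z) => //.
Qed.

(** Consequently [nrm] modifies the chosen versions only on a null set, and [nker] is still a
    version of the conditional label probabilities. *)
Lemma cond_exp_label_ae Z s :
  {ae fp_prob Z, forall w,
    (forall l, (l < k s.+1)%N -> 0 <= AF_eval Z (AF3 (time N s) (f s.+1 l)) w) /\
    \sum_(l < k s.+1) AF_eval Z (AF3 (time N s) (f s.+1 l)) w = 1}.
Proof.
set t := time N s; set K := k s.+1.
pose E l := AF_eval Z (AF3 t (f s.+1 l)).
have hE l : is_cond_exp (fp_prob Z) (fp_filt Z t) (AF_eval Z (f s.+1 l)) (E l).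
  exact: AF_eval_cond_exp.
have sF := @fp_filt_sigma _ _ Z t; have mF := @fp_filt_sub _ _ Z t.
have mc (a : R) : measurable_wrt (fp_filt Z t) (cst a).
  by apply/(measurable_wrtP sF); exact: measurable_cst.
have ic (a : R) : (fp_prob Z).-integrable setT (EFin \o cst a).
  exact: (@integrable_le_cst _ _ _ _ _ `|a|).
have mE l : measurable_wrt (fp_filt Z t) (E l) by have [] := hE l.
have iE l : (fp_prob Z).-integrable setT (EFin \o E l) by have [] := hE l.
have ge0 : {ae fp_prob Z, forall w, forall l : 'I_K, 0 <= E l w}.
  apply: filter_forall => l.
  apply: (ae_le_testing sF mF (U := cst 0)) => // A FA.
  rewrite (cond_exp_Rintegral (hE l))//.
  rewrite (_ : \int[fp_prob Z]_(x in A) cst 0 x = 0); last first.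
    by rewrite [LHS]Rintegral_cst ?mul0r//; exact: mF.
  by apply: Rintegral_ge0 => x _; exact: (ls_ge0 (sys s.+1) l x).
have sum1 : {ae fp_prob Z, forall w, \sum_(l < K) E l w = cst 1 w}.
  apply: (ae_eq_testing sF mF) => //.
  - by apply/(measurable_wrtP sF); apply: measurable_sum => l; exact/(measurable_wrtP sF).
  - by have [] := Rintegral_ord_sum K measurableT iE.
  - move=> A FA; have mA := mF _ FA.
    have iEA l : (fp_prob Z).-integrable A (EFin \o E l) by exact: integrableS (iE l).
    have [-> _] := Rintegral_ord_sum K mA iEA.
    under eq_bigr do rewrite (cond_exp_Rintegral (hE _))//.
    have [<- _] := Rintegral_ord_sum (h := fun i => AF_eval Z (f s.+1 i)) K mA
      (fun l => label_int s.+1 l mA).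
    by apply: eq_Rintegral => x _; exact: (ls_sum (sys s.+1) x).
apply: filterS2 ge0 sum1 => w h1 h2; split => // l lK.
exact: h1 (Ordinal lK).
Qed.

Lemma process_soft_labelling Z :
  soft_labelling (fp_prob Z) k (past Z) (fun s i => AF_eval Z (f s i)) (label_kernel Z).
Proof.
have sG s : sigma_algebra setT (past Z s).
  by case: s => [|s]; [exact: sigma_algebra_trivial|exact: fp_filt_sigma].
have subG s : past Z s `<=` measurable.
  by case: s => [A [->|->]//|s]; exact: fp_filt_sub.
have mk s i : measurable_wrt (past Z s) (label_kernel Z s i).
  case: s => [|s].
    by apply/(measurable_wrtP (sG 0)); exact: measurable_cst.
  have mE l : measurable_fun [set: g_sigma_algebraType (past Z s.+1)]
      (AF_eval Z (AF3 (time N s) (f s.+1 l))).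
    apply/(measurable_wrtP (sG s.+1)).
    by have [] := AF_eval_cond_exp (f s.+1 l) (time N s) Z.
  apply/(measurable_wrtP (sG s.+1)); rewrite /label_kernel /nker /nrm /possum.
  have m0 l : measurable_fun [set: g_sigma_algebraType (past Z s.+1)]
      (fun w => Num.max 0 (AF_eval Z (AF3 (time N s) (f s.+1 l)) w)).
    exact: measurable_maxr.
  have mS : measurable_fun [set: g_sigma_algebraType (past Z s.+1)]
      (fun w => \sum_(j < k s.+1) Num.max 0 (AF_eval Z (AF3 (time N s) (f s.+1 j)) w)).
    exact: measurable_sum.
  apply: measurable_funM.
    apply: measurable_funD => //; apply: measurable_funM => //.
    by apply: measurable_maxr => //; exact: measurable_funB.
  apply: (measurableT_comp (@measurable_inv R)).
  exact: measurable_maxr.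
split => //.
- case=> [A [->|->]|s]; try by case: (sG 1%N) => G0 GC _ //.
    by case: (sG 1%N) => G0 GC _; rewrite -(setD0 setT); exact: GC.
  by apply: fp_filt_mono; exact: time_le.
- by move=> s i x; exact: (ls_ge0 (sys s) i x).
- by move=> s x; exact: (ls_sum (sys s) x).
- by move=> s i; apply: (ls_meas (sys s)).
- by move=> s i x; exact: label_kernel_ge0.
- case=> [|s] x; last exact: nrm_sum (ls_pos (sys s.+1)).
  have [e _] := Rintegral_ord_sum (h := fun i => AF_eval Z (f 0 i)) (k 0)
    measurableT (fun l => label_int 0 l measurableT).
  apply: etrans (esym e) _.
  under eq_Rintegral do rewrite (ls_sum (sys 0)).
  rewrite (_ : Rintegral _ _ _ = 1 * fine (fp_prob Z setT)); last exact: Rintegral_cst.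
  by rewrite probability_setT mul1r.
- case=> [|s] i A ik.
    case=> ->; first by rewrite !integral_set0.
    pose c : R := \int[fp_prob Z]_x AF_eval Z (f 0 i) x.
    have -> : (\int[fp_prob Z]_x (label_kernel Z 0 i x)%:E = c%:E * fp_prob Z setT)%E.
      exact: (integral_cst (fp_prob Z) measurableT c%:E).
    rewrite probability_setT mule1 /c /Rintegral fineK//.
    apply: integrable_fin_num => //; exact: label_int.
  move=> FA; have mA := subG _ _ FA.
  have hE := AF_eval_cond_exp (f s.+1 i) (time N s) Z.
  have [mE iE EE] := hE.
  rewrite -EE//; apply: ae_eq_integral => //.
  + exact: measurable_funTS (measurable_int _ iE).
  + apply/measurable_EFinP/measurable_funTS.
    exact: measurable_wrtW (subG s.+1) (mk s.+1 i).
  + apply: filterS (cond_exp_label_ae Z s) => w [h1 h2] _ /=.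
    by rewrite /nker nrm_id.
Qed.

End process_labelling.
Arguments label_kernel {R N} k f Z s i w.
Arguments past {R N} Z s _.

(** * Bicausal couplings of equivalent processes *)

Section equiv_to_AW.
Context (R : realType) (N : nat).
Variables X Y : filtered_process R N.
Local Notation XY := (fp_space X * fp_space Y)%type.

Lemma cond_indep_of_kernel (d : measure_display) (W : measurableType d)
    (mu : probability W R) (Z Z' : filtered_process R N)
    (g : W -> fp_space Z) (g' : W -> fp_space Z') (t : 'I_N.+1) :
  measurable_fun setT g -> measurable_fun setT g' ->
  (forall A, measurable A -> mu (g @^-1` A) = fp_prob Z A) ->
  (forall B, fp_filt Z' t B -> exists h : fp_space Z -> R,
     [/\ measurable_wrt (fp_filt Z t) h, forall x, `|h x| <= 1 &
      forall A, measurable A ->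
        (\int[fp_prob Z]_(x in A) (h x)%:E = mu (g @^-1` A `&` g' @^-1` B))%E]) ->
  cond_indep mu (preimage_set_system setT g (fp_filt Z ord_max))
    (preimage_set_system setT g' (fp_filt Z' t))
    (preimage_set_system setT g (fp_filt Z t)).
Proof.
move=> mg mg' gP ker; apply: cond_indep_factor.
- exact: sigma_algebra_preimage_filt.
- exact: measurable_preimage_filt.
- exact: measurable_preimage_filt.
- exact: sigma_algebra_preimage_filt.
- exact: preimage_filt_last.
move=> _ [B FB <-]; have [h [mh h1 hE]] := ker B FB.
exists (h \o g); split; [exact: measurable_wrt_preimage|by move=> x; exact: h1|].
move=> _ [A FA <-]; rewrite !setTI; have mA := @fp_filt_sub _ _ Z _ _ FA.
rewrite (pullback_Rintegral mg gP mA); first by rewrite /Rintegral hE.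
apply: (integrable_le_cst _ _ _ h1) => //.
exact: measurable_wrtW (@fp_filt_sub _ _ Z t) mh.
Qed.

Lemma adapted_equiv_coupling (M eta : R) : adapted_equiv X Y -> 1 <= M -> 0 < eta ->
  exists2 pi : probability XY R, Cpl_bc pi &
    (pi (clamped_bad_set M eta) <= eta%:E)%E.
Proof.
move=> XeqY M1 eta0.
(* The [N.+1] steps lose at most [N.+1%:R * eps]. Dividing by [N.+2] moreover makes [eps] strictly
   smaller than [eta], even when [N] is 0, as the final contradiction on the bad set requires. *)
pose eps := Num.min 1 (eta / N.+2%:R).
have e0 : 0 < eps by rewrite lt_min ltr01 divr_gt0.
have e1 : eps <= 1 by rewrite ge_min lexx.
have eN : N.+2%:R * eps <= eta.
  by rewrite mulrC -ler_pdivlMr// ge_min lexx orbT.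
have e_eta : eps < eta.
  by apply: lt_le_trans eN; rewrite ltr_pMl// ltr1n.
have [k [f [sys loc]]] := label_systems_exist N M1 e0.
have LX := process_soft_labelling sys X; have LY := process_soft_labelling sys Y.
pose diag := diag_step k (fun s i => AF_eval X (f s i)) (label_kernel k f X)
  (fun s i => AF_eval Y (f s i)) (label_kernel k f Y).
have common s z : 0 < diag s z ->
    exists2 i, (i < k s)%N & 0 < AF_eval X (f s i) z.1 /\ 0 < AF_eval Y (f s i) z.2.
  rewrite lt_neqAle => /andP[/eqP nz _].
  have [//|H] := pselect (exists2 i, (i < k s)%N &
    0 < AF_eval X (f s i) z.1 /\ 0 < AF_eval Y (f s i) z.2).
  exfalso; apply: nz; apply/esym; apply: big1 => i _.
  have := ls_ge0 (sys s) i z.1; rewrite le_eqVlt => /predU1P[<-|fX].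
    by rewrite !mul0r.
  have := ls_ge0 (sys s) i z.2; rewrite le_eqVlt => /predU1P[<-|fY].
    by rewrite mulr0 mul0r.
  by exfalso; apply: H; exists i.
have factors n z : 0 < agreement k (fun s i => AF_eval X (f s i)) (label_kernel k f X)
    (fun s i => AF_eval Y (f s i)) (label_kernel k f Y) n z ->
    forall s, (s < n)%N -> 0 < diag s z.
  move=> + s sn; rewrite /agreement (bigD1 (Ordinal sn))//= => pz.
  rewrite lt_neqAle (diag_step_ge0 LX LY) andbT; apply/eqP => e.
  by move: pz; rewrite -/(diag s z) -e mul0r ltxx.
have close s z : (s < N.+1)%N -> 0 < agreement k (fun s i => AF_eval X (f s i))
    (label_kernel k f X) (fun s i => AF_eval Y (f s i)) (label_kernel k f Y) s z ->
    1 - eps <= \sum_(i < k s) overlap ((label_kernel k f X s)^~ z.1)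
      ((label_kernel k f Y s)^~ z.2) i.
  case: s => [_ _|s sN az].
    rewrite (@le_trans _ _ 1)//; first by rewrite lerBlDr lerDl ltW.
    rewrite -(sl_ker_sum LX 0 z.1); apply: ler_sum => i _.
    rewrite /overlap le_min lexx/=.
    (* The hypothesis on [X] and [Y] enters only here; all later conditional laws are compared
       through a common previous label. *)
    have := XeqY (f 0 i); rewrite unlock /label_kernel /Rintegral => ->.
    by [].
  have [i ik [fX fY]] := common _ _ (factors _ _ az s (ltnSn s)).
  have [_ ker] := loc s (ltnW sN) X Y i _ _ ik fX fY.
  apply: le_trans (overlap_sum_ge (sl_ker_sum LX s.+1 z.1)
    (b := (label_kernel k f Y s.+1)^~ z.2) ker).
  rewrite lerD2l lerN2 mulrCA; apply: ler_piMr; first exact: ltW.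
  by rewrite ler_pdivrMr ?ltr0n// mul1r ler_nat.
have e01 : 0 <= eps <= 1 by rewrite (ltW e0).
have [pi [piX piY kerX kerY bad]] := soft_coupling LX LY e01 close.
exists pi.
  split => // t.
  - apply: (cond_indep_of_kernel measurable_fst measurable_snd piX) => B FB.
    (* The sigma-algebra at time [t] is the past at position [t.+1], within reach because the
       density has [N.+1] factors. *)
    have := kerX (nat_of_ord t).+1 B (ltn_ord t).
    by rewrite /past time_ord => /(_ FB).
  - apply: (cond_indep_of_kernel measurable_snd measurable_fst piY) => A FA.
    have := kerY (nat_of_ord t).+1 A (ltn_ord t).
    rewrite /past time_ord => /(_ FA)[h [mh h1 hE]].
    by exists h; split => // B mB; rewrite hE// setIC.
apply: le_trans (bad _ (measurable_clamped_bad_set M eta) _) _.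
  move=> z [t zt]; apply/eqP; rewrite eq_le (agreement_ge0 LX LY) andbT leNgt.
  apply/negP => az.
  have [i ik [fX fY]] := common _ _ (factors _ _ az t (ltn_ord t)).
  have [] := loc t _ X Y i _ _ ik fX fY; first by rewrite -ltnS.
  rewrite time_ord => + _; apply/negP; rewrite -ltNge (lt_le_trans _ zt)//.
  rewrite (le_lt_trans _ e_eta)// ler_pdivrMr ?ltr0n//.
  by apply: ler_peMr; [exact: ltW|rewrite ler1n].
rewrite lee_fin (le_trans _ eN)// ler_pM2r// ler_nat//.
Qed.

End equiv_to_AW.

Theorem theorem1p5 (R : realType) (N : nat) (p : R) (hp : 1 <= p)
    (X Y : filtered_process R N) (hX : in_FP p X) (hY : in_FP p Y) :
  adapted_equiv X Y <-> AW X Y p = 0%E.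
Proof.
have p0 : 0 < p := lt_le_trans ltr01 hp.
split=> [XeqY|]; last exact: AW_eq0_adapted_equiv.
by apply: AW_eq0_of_clamped => // M eta M1 eta0; exact: adapted_equiv_coupling.
Qed.
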